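(* Consider the linear Gaussian state-space model $x_k=A_kx_{k-1}+q_k$ ($k=1,\dots,T$), $y_k=C_kx_k+r_k$ ($k=0,\dots,T$), with independent white Gaussian noises $q_k\sim\mathcal{N}(0,Q_k)$, $r_k\sim\mathcal{N}(0,R_k)$ and $x_0\sim\mathcal{N}(0,P_0)$ independent of them; let $\alpha_0,\dots,\alpha_T\ge0$. Let $\mathcal{J}_0^T=(\mathcal{J}_0,\dots,\mathcal{J}_T)$ be jointly distributed with $Y_0^T=(y_0,\dots,y_T)$ (and conditionally independent of $x_0,\dots,x_T$ given $Y_0^T$) such that: (i) $\mathcal{J}_0^T\sim\mathcal{N}\big(0,\operatorname{diag}\{P_0,Q_1,\dots,Q_T\}\big)$; (ii) $\mathcal{J}_k$ is conditionally independent of $y_{k+n}$ given $Y_0^k$ for all $k\in[0,T]$ and $n\ge1$; (iii) $\sum_{k=0}^T\alpha_k\mathbb{E}\|x_k-\chi_k\|^2=\mathcal{C}$, where $\chi_0=\mathcal{J}_0$ and $\chi_k=A_k\chi_{k-1}+\mathcal{J}_k$. Then there exists a jointly Gaussian distribution of $(J_0^T,Y_0^T)$ (with $Y_0^T$ having its given law and $J_0^T$ conditionally independent of $x_0,\dots,x_T$ given $Y_0^T$) for which (i) and (ii) hold with $J$ in place of $\mathcal{J}$, and the estimator $\hat x_0=J_0$, $\hat x_k=A_k\hat x_{k-1}+J_k$ satisfies $\sum_{k=0}^T\alpha_k\mathbb{E}\|x_k-\hat x_k\|^2=\mathcal{C}$. Furthermore, one can write $$J_k=\pi_k\mathcal{I}_k+\phi_k\upsilon_k+w_k,\qquad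 \upsilon_k=\mathcal{I}_0^{k-1}-\mathbb{E}\big[\mathcal{I}_0^{k-1}\mid J_0^{k-1}\big],$$ for deterministic matrices $\pi_k,\phi_k$, where $(w_k)$ is a white Gaussian sequence with $w_k$ independent of $Y_0^T$ and of $J_0^{k-1}$.
   Context: The innovation process is $\mathcal{I}_k=y_k-C_k\hat x^*_{k|k-1}$ with $\hat x^*_{k|k-1}=\mathbb{E}[x_k\mid y_0,\dots,y_{k-1}]$ and $\mathcal{I}_0=y_0$; $\mathcal{I}_0^{k-1}=(\mathcal{I}_0,\dots,\mathcal{I}_{k-1})$ and $J_0^{k-1}=(J_0,\dots,J_{k-1})$. *)

(* Defs.v *)
From HB Require Import structures.
From mathcomp Require Import all_boot all_order all_algebra.
From mathcomp Require Import all_classical all_reals all_analysis.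
Set Implicit Arguments. Unset Strict Implicit. Unset Printing Implicit Defensive.
Import Order.TTheory GRing.Theory Num.Theory.
Local Open Scope classical_set_scope.
Local Open Scope ring_scope.

Section defs.
Context {R : realType} {d : measure_display} {Om : measurableType d}.
Variable P : probability Om R.

Definition dotv (k : nat) (u v : 'cV[R]_k) : R := \sum_(i < k) u i ord0 * v i ord0.
Definition sqnorm (k : nat) (v : 'cV[R]_k) : R := \sum_(i < k) (v i ord0) ^+ 2.

Definition vborel {k : nat} : set (set 'cV[R]_k) :=
  <<s [set S | exists (i : 'I_k) (B : set R), measurable B /\
               S = (fun v : 'cV[R]_k => v i ord0) @^-1` B] >>.

Definition rvec_meas (k : nat) (X : Om -> 'cV[R]_k) :=
  forall i : 'I_k, measurable_fun setT (fun w => X w i ord0).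

Definition rv_events (k : nat) (X : Om -> 'cV[R]_k) : set (set Om) :=
  [set S | exists B : set 'cV[R]_k, vborel B /\ S = X @^-1` B].

(* generators of the sigma-algebra of the family (X j)_{j in I};
   the sigma-algebra itself is <<s ev_fam X I >> *)
Definition ev_fam (k : nat) (X : nat -> Om -> 'cV[R]_k) (I : set nat) : set (set Om) :=
  \bigcup_(j in I) rv_events (X j).

Definition normal_law (X : Om -> R) (mu s2 : R) :=
  0 <= s2 /\
  forall B : set R, measurable B ->
    P (X @^-1` B) = (if s2 == 0 then \d_mu B else normal_prob mu (Num.sqrt s2) B).

Definition gauss_vec (k : nat) (X : Om -> 'cV[R]_k) (mu : 'cV[R]_k) (S : 'M[R]_k) :=
  forall u : 'cV[R]_k,
    normal_law (fun w => dotv u (X w)) (dotv u mu) (dotv u (S *m u)).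

Definition gauss_blockdiag (k : nat) (X : nat -> Om -> 'cV[R]_k) (N : nat)
    (D : nat -> 'M[R]_k) :=
  forall u : nat -> 'cV[R]_k,
    normal_law (fun w => \sum_(j < N.+1) dotv (u j) (X j w)) 0
               (\sum_(j < N.+1) dotv (u j) (D j *m u j)).

Definition jointly_gaussian (k l : nat) (X : nat -> Om -> 'cV[R]_k)
    (Y : nat -> Om -> 'cV[R]_l) (N : nat) :=
  forall (u : nat -> 'cV[R]_k) (v : nat -> 'cV[R]_l), exists mu s2,
    normal_law (fun w => \sum_(j < N.+1) dotv (u j) (X j w)
                       + \sum_(j < N.+1) dotv (v j) (Y j w)) mu s2.

Definition mutual_indep (I : eqType) (D : set I) (E : I -> set (set Om)) :=
  forall s : seq I, uniq s -> (forall i, i \in s -> D i) ->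
  forall B : I -> set Om, (forall i, i \in s -> E i (B i)) ->
    P (\big[setI/setT]_(i <- s) B i) = (\prod_(i <- s) P (B i))%E.

Definition indep2 (F G : set (set Om)) :=
  forall A B, F A -> G B -> P (A `&` B) = (P A * P B)%E.

Definition cexp1 (G : set (set Om)) (X Z : Om -> R) :=
  [/\ P.-integrable setT (EFin \o X), P.-integrable setT (EFin \o Z),
      (forall B : set R, measurable B -> G (Z @^-1` B)) &
      forall S, G S -> (\int[P]_(w in S) (X w)%:E = \int[P]_(w in S) (Z w)%:E)%E].

Definition cexp (k : nat) (G : set (set Om)) (X Z : Om -> 'cV[R]_k) :=
  forall i : 'I_k, cexp1 G (fun w => X w i ord0) (fun w => Z w i ord0).

Definition cond_indep (F1 F2 G : set (set Om)) :=
  forall A B, F1 A -> F2 B -> exists pA pB : Om -> R,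
    [/\ cexp1 G (\1_A) pA, cexp1 G (\1_B) pB & cexp1 G (\1_(A `&` B)) (pA \* pB)].

Definition ssm (n m N : nat) (A : nat -> 'M[R]_n) (C : nat -> 'M[R]_(m, n))
    (P0 : 'M[R]_n) (Q : nat -> 'M[R]_n) (Rn : nat -> 'M[R]_m)
    (x q : nat -> Om -> 'cV[R]_n) (y r : nat -> Om -> 'cV[R]_m) :=
  [/\ rvec_meas (x 0%N) /\ (forall k, (1 <= k <= N)%N -> rvec_meas (q k))
        /\ (forall k, (k <= N)%N -> rvec_meas (r k)),
      gauss_vec (x 0%N) 0 P0 /\ (forall k, (1 <= k <= N)%N -> gauss_vec (q k) 0 (Q k))
        /\ (forall k, (k <= N)%N -> gauss_vec (r k) 0 (Rn k)),
      mutual_indep [set i : nat + nat | match i with inl k => (k <= N)%N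
                                                   | inr k => (k <= N)%N end]
        (fun i => match i with
                  | inl 0 => rv_events (x 0%N)
                  | inl k => rv_events (q k)
                  | inr k => rv_events (r k) end),
      (forall k w, (1 <= k <= N)%N -> x k w = A k *m x k.-1 w + q k w) &
      (forall k w, (k <= N)%N -> y k w = C k *m x k w + r k w)].

Fixpoint est (n : nat) (A : nat -> 'M[R]_n) (J : nat -> Om -> 'cV[R]_n) (k : nat)
    (w : Om) : 'cV[R]_n :=
  match k with
  | 0 => J 0%N w
  | k'.+1 => A k'.+1 *m est A J k' w + J k'.+1 w
  end.

Definition cost (n N : nat) (alpha : nat -> R) (x xh : nat -> Om -> 'cV[R]_n) : \bar R :=
  (\sum_(k < N.+1) (alpha k)%:E * \int[P]_w (sqnorm (x k w - xh k w))%:E)%E.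

(* innovation I_k = y_k - C_k xs_k (xs_k a version of E[x_k | y_0..y_{k-1}]),
   I_0 = y_0 *)
Definition innov (n m : nat) (C : nat -> 'M[R]_(m, n)) (y : nat -> Om -> 'cV[R]_m)
    (xs : nat -> Om -> 'cV[R]_n) (k : nat) (w : Om) : 'cV[R]_m :=
  if k == 0%N then y 0%N w else y k w - C k *m xs k w.

End defs.

Definition diagcov {R : realType} (n : nat) (P0 : 'M[R]_n) (Q : nat -> 'M[R]_n) (k : nat) :=
  if k == 0%N then P0 else Q k.

(* Main.v *)
(* In a Gaussian space (a linear space of centred normal variables) orthogonality
   implies independence, since the expectation of a product of cosines factors and
   cosines generate the events in question. By (ii) and the conditional independence
   of the states, the L2-projection L_k of the given J_k on the span of y_0, ..., y_k
   leaves a residual orthogonal to all of x_0, ..., x_N, y_0, ..., y_N. Put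
   J_k = L_k + v_k on a product extension of the probability space, where v is
   Gaussian noise, independent of the model, with the Gram matrix of these residuals.
   Every second moment of (x, y, J) is then that of the given process, so that (i)
   and the cost are preserved, and (ii) becomes an orthogonality relation.
   Finally w_k is the residual of J_k on the span of I_k and upsilon_k: the
   innovations up to k and J_0, ..., J_{k-1} split into these two and a part that is
   orthogonal to J_k, so w_k is orthogonal to all observations and earlier J's. *)
Require Import Defs.
From HB Require Import structures.
From mathcomp Require Import all_boot all_order all_algebra.
From mathcomp Require Import all_classical all_reals all_analysis.
From mathcomp Require Import measurable_realfun normal_distribution ring lra.
Set Implicit Arguments. Unset Strict Implicit. Unset Printing Implicit Defensive.
Import Order.TTheory GRing.Theory Num.Theory numFieldNormedType.Exports.
Local Open Scope classical_set_scope.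
Local Open Scope ring_scope.

(** The given process is not assumed jointly Gaussian with the observations, so its conditional
    independences cannot be converted into linear algebra by Gaussianity. Only their consequence for
    second moments is extracted, by an argument valid for square-integrable variables, and the new
    process is rebuilt from these moments. The way back, from orthogonality to conditional
    independence, is open because the extended space is Gaussian.

    Variances may vanish and Gram matrices may be singular. Hence every centred normal law, Dirac
    mass included, is handled as the image of the standard one under a scaling, projections are
    built without inverting a covariance matrix, and the noise is adjoined one scalar at a time
    instead of through a matrix square root. The second moment of the standard law enters only as a
    positive constant that cancels.

    The vanishing correlation of the [J_k] at different times, contained in (i), is what makes [w_k]
    orthogonal to the earlier [J_j]; orthogonality to past, present and future innovations has a
    separate reason in each of the three cases. *)

(** * Normal laws *)

(* The canonical measure on [pushforward m f], with the measurability proof explicit. *)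
Definition push d d' (T1 : measurableType d) (T2 : measurableType d')
    (R : realFieldType) (m : {measure set T1 -> \bar R}) (f : T1 -> T2)
    (mf : measurable_fun setT f) : {measure set T2 -> \bar R} :=
  @measure_function_pushforward__canonical__measure_function_Measure
    _ _ _ _ _ m f mf.

(** * Affine changes of variables and integration against the normal density *)

Section affine_change_of_variables.
Context {R : realType}.
Notation mu := (@lebesgue_measure R).

Lemma measurable_fun_affine (a b : R) :
  measurable_fun [set: measurableTypeR R]
    ((fun x => a * x + b) : measurableTypeR R -> measurableTypeR R).
Proof. by apply: measurable_funD => //; exact: measurable_funM. Qed.

(** By uniqueness of Lebesgue measure: the scaled image measure gives half-open intervals their
    length. *)
Lemma lebesgue_measure_affine (a b : R) (B : set R) : 0 < a -> measurable B ->
  (mu B = a%:E * mu ((fun x => a * x + b)%R @^-1` B))%E.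
Proof.
move=> a0 mB.
pose a' : {nonneg R} := NngNum (ltW a0).
rewrite (@lebesgue_measure_unique R
  (mscale a' (push mu (measurable_fun_affine a b))))//.
move=> _ [[c e]] _ <-.
rewrite /= /mscale/= /push/= /pushforward/=.
have -> : (fun x : R => a * x + b) @^-1` `]c, e]%classic =
    `](c - b) / a, (e - b) / a]%classic.
  apply/seteqP; split => x /=; rewrite !in_itv/= ltr_pdivrMr// ler_pdivlMr//;
   by rewrite ltrBlDr lerBrDr mulrC.
rewrite !lebesgue_measure_itv/= !lte_fin ltr_pM2r ?invr_gt0// ltrD2r.
case: ifPn => _; last by rewrite mule0.
rewrite -!EFinB -EFinM; congr EFin; field.
by rewrite gt_eqF.
Qed.

Lemma ge0_integral_affine (a b : R) (f : R -> \bar R) : 0 < a ->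
  measurable_fun setT f -> (forall x, 0 <= f x)%E ->
  (\int[mu]_x f x = a%:E * \int[mu]_x f (a * x + b)%R)%E.
Proof.
move=> a0 mf f0.
pose a' : {nonneg R} := NngNum (ltW a0).
transitivity (\int[mscale a' (push mu (measurable_fun_affine a b))]_x f x)%E.
  apply: eq_measure_integral => B mB _.
  exact: lebesgue_measure_affine.
rewrite ge0_integral_mscale//; congr (_ * _)%E.
by rewrite (ge0_integral_pushforward (measurable_fun_affine a b)).
Qed.

Lemma ge0_integral_opp (f : R -> \bar R) :
  measurable_fun setT f -> (forall x, 0 <= f x)%E ->
  (\int[mu]_x f x = \int[mu]_x f (- x)%R)%E.
Proof.
move=> mf f0.
have mphi : measurable_fun [set: measurableTypeR R]
    ((fun x => - x)%R : measurableTypeR R -> measurableTypeR R).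
  exact: oppr_measurable.
transitivity (\int[push mu mphi]_x f x)%E.
  by apply: eq_measure_integral => B mB _; apply/esym/lebesgue_measureN.
by rewrite (ge0_integral_pushforward mphi).
Qed.

(** The Radon-Nikodym derivative of the normal law and the normal density have the same integral
    over every measurable set, hence agree almost everywhere. *)
Lemma ge0_integral_normal_prob (m s : R) (f : R -> \bar R) :
  measurable_fun setT f -> (forall x, 0 <= f x)%E ->
  (\int[normal_prob m s]_x f x = \int[mu]_x (f x * (normal_pdf m s x)%:E))%E.
Proof.
move=> mf f0.
have dom := @normal_prob_dominates R m s.
rewrite -(Radon_Nikodym_SigmaFinite.change_of_variables dom)//.
apply: ae_eq_integral => //.
- apply: emeasurable_funM => //; apply: (measurable_int mu).
  exact: Radon_Nikodym_SigmaFinite.f_integrable.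
- apply: emeasurable_funM => //=; apply/measurableT_comp => //=.
  exact: measurable_normal_pdf.
- apply: ae_eqe_mul2l => /=.
  apply: integral_ae_eq => //=.
  + exact: Radon_Nikodym_SigmaFinite.f_integrable.
  + by apply/measurableT_comp =>//; exact: measurable_normal_pdf.
  + by move=> E _ mE; rewrite -Radon_Nikodym_SigmaFinite.f_integral.
Qed.

Lemma normal_peak_normr (s : R) : normal_peak s = `|s|^-1 * normal_peak 1.
Proof.
rewrite /normal_peak expr1n mul1r -mulrnAr sqrtrM ?sqr_ge0// sqrtr_sqr.
by rewrite invfM.
Qed.

End affine_change_of_variables.

(** * Scaling and convolution of normal laws *)

Section normal_scaling.
Context {R : realType}.
Notation mu := (@lebesgue_measure R).

Lemma normal_prob_affine (a b m s : R) (B : set R) : 0 < a -> s != 0 ->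
  measurable B ->
  normal_prob m s ((fun x => a * x + b)%R @^-1` B) =
  normal_prob (a * m + b) (a * s) B.
Proof.
move=> a0 s0 mB; rewrite /normal_prob.
have as0 : a * s != 0 by rewrite mulf_neq0// gt_eqF.
have mpdf m' s' : measurable_fun setT (fun x : R => (normal_pdf m' s' x)%:E).
  by apply/measurable_EFinP; exact: measurable_normal_pdf.
have mr m' s' : measurable_fun [set: R] ((fun x : R => (normal_pdf m' s' x)%:E) \_ B).
  exact: (proj1 (measurable_restrictT _ mB) (measurable_funTS (mpdf m' s'))).
have r0 m' s' x : (0 <= ((fun x : R => (normal_pdf m' s' x)%:E) \_ B) x)%E.
  by rewrite patchE; case: ifP => // _; rewrite lee_fin normal_pdf_ge0.
rewrite [RHS]integral_mkcond [RHS](ge0_integral_affine b a0 (mr _ _) (r0 _ _)).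
rewrite [LHS]integral_mkcond -ge0_integralZl//; last 2 first.
- exact: (measurableT_comp (mr _ _) (measurable_fun_affine a b)).
- by rewrite lee_fin ltW.
apply: eq_integral => x _; rewrite !patchE.
have -> : (x \in (fun x : R => a * x + b) @^-1` B) = (a * x + b \in B).
  by apply/idP/idP; rewrite !inE.
case: ifP => _; last by rewrite mule0.
rewrite -EFinM; congr EFin; rewrite !normal_pdfE// (normal_peak_normr (a * s)).
rewrite (normal_peak_normr s) normrM (gtr0_norm a0) invfM !mulrA divff ?gt_eqF//.
rewrite mul1r; congr (_ * expR _).
rewrite -mulr_natr -[in RHS]mulr_natr.
by field; rewrite s0 gt_eqF.
Qed.

Notation gam := (normal_prob 0 1 : probability (measurableTypeR R) R).

Lemma gam_opp (B : set R) : measurable B -> gam (-%R @^-1` B) = gam B.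
Proof.
move=> mB; rewrite /= /normal_prob.
have mr : measurable_fun [set: R] ((fun x : R => (normal_pdf 0 1 x)%:E) \_ B).
  apply: (proj1 (measurable_restrictT _ mB)); apply: measurable_funTS.
  by apply/measurable_EFinP; exact: measurable_normal_pdf.
have r0 x : (0 <= ((fun x : R => (normal_pdf 0 1 x)%:E) \_ B) x)%E.
  by rewrite patchE; case: ifP => // _; rewrite lee_fin normal_pdf_ge0.
rewrite [RHS]integral_mkcond (ge0_integral_opp mr r0) [LHS]integral_mkcond.
apply: eq_integral => x _; rewrite !patchE.
have -> : (x \in (-%R : R -> R) @^-1` B) = (- x \in B).
  by apply/idP/idP; rewrite !inE.
case: ifP => _ //; congr EFin.
by rewrite !normal_pdfE ?oner_neq0// /normal_fun !subr0 sqrrN.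
Qed.

Lemma gam_scale (s : R) (B : set R) : 0 < s -> measurable B ->
  normal_prob 0 s B = gam ((fun z => s * z) @^-1` B).
Proof.
move=> s0 mB; have := @normal_prob_affine s 0 0 1 B s0 (oner_neq0 _) mB.
rewrite mulr0 addr0 mulr1 => <- /=; congr normal_prob.
by congr (_ @^-1` B); apply/funext => z; rewrite addr0.
Qed.

(** Merges the two cases of [normal_law]: degenerate or not, a centred normal law is the image of
    the standard law under multiplication by the standard deviation. *)
Lemma normal_law_gam (s2 : R) (B : set R) : 0 <= s2 -> measurable B ->
  (if s2 == 0 then \d_(0:R) B else normal_prob 0 (Num.sqrt s2) B)
  = gam ((fun z => Num.sqrt s2 * z) @^-1` B).
Proof.
move=> s20 mB; case: ifPn => [/eqP->|s2n0]; last first.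
  by rewrite gam_scale// sqrtr_gt0 lt0r s2n0.
rewrite sqrtr0 diracE; case: (boolP (0 \in B)) => [/set_mem|/negP] B0.
- rewrite (_ : _ @^-1` _ = setT) ?probability_setT//.
  by apply/seteqP; split => // z _ /=; rewrite mul0r.
- rewrite (_ : _ @^-1` _ = set0) ?measure0//.
  by apply/seteqP; split => // z /=; rewrite mul0r => zB; apply: B0; rewrite inE.
Qed.

(** Completing the square. With $X$ standard and $Z=aX+bY$, both sides are the joint density of
    $(X,Z)$: on the left as the law of $X$ times that of $Z$ given $X$, on the right as the law of
    $Z$ times that of $X$ given $Z$, with mean $az/c^2$ and standard deviation $b/c$. *)
Lemma normal_pdf_conv (a b x z : R) : b != 0 ->
  let c := Num.sqrt (a ^+ 2 + b ^+ 2) in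
  normal_pdf 0 1 x * normal_pdf (a * x) b z =
  normal_pdf 0 c z * normal_pdf (a * z / c ^+ 2) (b / c) x.
Proof.
move=> b0 c.
have c2 : c ^+ 2 = a ^+ 2 + b ^+ 2 by rewrite sqr_sqrtr// addr_ge0// sqr_ge0.
have c0 : c != 0.
  rewrite -sqrf_eq0 c2; apply/negP => /eqP.
  have : 0 < b ^+ 2 by rewrite exprn_even_gt0.
  by have := sqr_ge0 a; lra.
clearbody c; have bc0 : b / c != 0 by rewrite mulf_neq0// invr_neq0.
rewrite !normal_pdfE ?oner_neq0//.
rewrite (normal_peak_normr b) (normal_peak_normr c) (normal_peak_normr (b / c)).
rewrite normrM normfV invfM invrK.
rewrite [LHS]mulrACA [RHS]mulrACA -!expRD; congr (_ * expR _).
  by field; rewrite !normr_eq0 b0 c0.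
rewrite /normal_fun -!(mulr_natr (_ ^+ 2) 2).
have -> : - (x - 0) ^+ 2 / (1 ^+ 2 * 2%:R) + - (z - a * x) ^+ 2 / (b ^+ 2 * 2%:R)
  = - (x ^+ 2 * b ^+ 2 + (z - a * x) ^+ 2) / (b ^+ 2 * 2%:R) :> R by field.
have -> : - (z - 0) ^+ 2 / (c ^+ 2 * 2%:R) +
   - (x - a * z / c ^+ 2) ^+ 2 / ((b / c) ^+ 2 * 2%:R) =
   - (z ^+ 2 * b ^+ 2 + (c ^+ 2 * x - a * z) ^+ 2) / (c ^+ 2 * b ^+ 2 * 2%:R) :> R.
  by field; rewrite b0 c0.
have c20 : a ^+ 2 + b ^+ 2 != 0 by rewrite -c2 sqrf_eq0.
by rewrite c2; field; rewrite b0 c20.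
Qed.

End normal_scaling.

Section normal_product.
Context {R : realType}.
Notation mu := (@lebesgue_measure R).
Notation gam := (normal_prob 0 1 : probability (measurableTypeR R) R).

(** [g] is the joint density of the first coordinate and the combination, cut to [B]. After Tonelli
    and [normal_pdf_conv], the inner integral is that of a conditional density, which is 1. *)
Lemma gam_conv_gt0 (a b : R) (B : set R) : 0 < b -> measurable B ->
  (gam \x gam)%E ((fun z => a * z.1 + b * z.2) @^-1` B) =
  gam ((fun z => Num.sqrt (a ^+ 2 + b ^+ 2) * z) @^-1` B).
Proof.
move=> b0 mB; have bn0 : b != 0 by rewrite gt_eqF.
set c := Num.sqrt _.
have c0 : 0 < c.
  have b20 : 0 < b ^+ 2 by rewrite exprn_gt0.
  by rewrite sqrtr_gt0; have := sqr_ge0 a; lra.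
pose g (z : R * R) : R := \1_B z.2 * (normal_pdf 0 1 z.1 * normal_pdf (a * z.1) b z.2).
have g0 z : 0 <= g z by rewrite mulr_ge0 ?mulr_ge0 ?normal_pdf_ge0// indicE.
have mg : measurable_fun [set: measurableTypeR R * measurableTypeR R] g.
  apply: measurable_funM.
    apply: (@measurableT_comp _ _ _ _ _ _ (\1_B : measurableTypeR R -> R) _ snd).
      exact: measurable_indic.
    exact: measurable_snd.
  apply: measurable_funM.
    apply: (@measurableT_comp _ _ _ _ _ _
      (normal_pdf 0 1 : measurableTypeR R -> R) _ fst).
      exact: measurable_normal_pdf.
    exact: measurable_fst.
  rewrite (_ : (fun x : measurableTypeR R * measurableTypeR R => _) =
    (fun z => normal_peak b * expR (- (z.2 - a * z.1) ^+ 2 / (b ^+ 2 *+ 2)))); last first.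
    by apply/funext => z; rewrite normal_pdfE.
  apply: measurable_funM => //; apply: measurableT_comp => //.
  apply: measurable_funM => //; apply: measurableT_comp => //.
  apply: measurable_funX; apply: measurable_funB; first exact: measurable_snd.
  by apply: measurable_funM => //; exact: measurable_fst.
have secE x : xsection ((fun z : R * R => a * z.1 + b * z.2) @^-1` B) x =
    (fun y => b * y + a * x) @^-1` B.
  apply/seteqP; split => y; rewrite /xsection/= inE/= => h; by rewrite addrC.
have mA : measurable ((fun z : measurableTypeR R * measurableTypeR R => a * z.1 + b * z.2) @^-1` B).
  rewrite -[X in measurable X]setTI; apply: (_ : measurable_fun setT _) => //.
  by apply: measurable_funD; apply: measurable_funM.
rewrite /product_measure1 ge0_integral_normal_prob//; last first.
  exact: (measurable_fun_xsection _ mA).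
transitivity (\int[mu]_x \int[mu]_z (g (x, z))%:E)%E.
  apply: eq_integral => x _ /=; rewrite secE normal_prob_affine ?oner_neq0//.
  rewrite mulr0 add0r mulr1 /normal_prob integral_mkcond -ge0_integralZr//.
  - apply: eq_integral => z _; rewrite patchE /g/= indicE.
    by case: (z \in B); rewrite ?mul0e ?mul0r// mul1r EFinM muleC.
  - apply: (proj1 (measurable_restrictT _ mB)); apply: measurable_funTS.
    by apply/measurable_EFinP; exact: measurable_normal_pdf.
  - by move=> z _; rewrite patchE; case: ifP => // _; rewrite lee_fin normal_pdf_ge0.
  - by rewrite lee_fin normal_pdf_ge0.
have mgE : measurable_fun [set: measurableTypeR R * measurableTypeR R] (EFin \o g).
  exact/measurable_EFinP.
have gE0 z : (0 <= (EFin \o g) z)%E by rewrite lee_fin.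
have ft := @fubini_tonelli _ _ _ _ R mu mu _ mgE gE0.
transitivity (\int[mu]_z \int[mu]_x (g (x, z))%:E)%E; first exact: ft.
rewrite -(gam_scale c0 mB) /normal_prob [RHS]integral_mkcond.
apply: eq_integral => z _; rewrite /fubini_G/= patchE /g/=.
transitivity (\int[mu]_x ((\1_B z * normal_pdf 0 c z)%:E *
    (normal_pdf (a * z / c ^+ 2) (b / c) x)%:E))%E.
  apply: eq_integral => x _; rewrite -EFinM; congr EFin.
  by rewrite (normal_pdf_conv a x z bn0) mulrA.
have mp : measurable_fun [set: R]
    (fun x => (normal_pdf (a * z / c ^+ 2) (b / c) x)%:E).
  by apply/measurable_EFinP; exact: measurable_normal_pdf.
transitivity ((\1_B z * normal_pdf 0 c z)%:E *
    \int[mu]_x (normal_pdf (a * z / c ^+ 2) (b / c) x)%:E)%E.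
  apply: (ge0_integralZl mu measurableT mp).
    by move=> x _; rewrite lee_fin normal_pdf_ge0.
  by rewrite lee_fin mulr_ge0 ?normal_pdf_ge0// indicE.
by rewrite integral_normal_pdf mule1 indicE; case: (z \in B); rewrite ?mul1r ?mul0r.
Qed.

Lemma gam_conv (a b : R) (B : set R) : 0 <= b -> measurable B ->
  0 <= a ->
  (gam \x gam)%E ((fun z => a * z.1 + b * z.2) @^-1` B) =
  gam ((fun z => Num.sqrt (a ^+ 2 + b ^+ 2) * z) @^-1` B).
Proof.
rewrite le_eqVlt => /predU1P[<-|b0] mB a0; last exact: gam_conv_gt0.
rewrite expr0n/= addr0 sqrtr_sqr ger0_norm//.
rewrite (_ : _ @^-1` B = ((fun z => a * z) @^-1` B) `*` setT); last first.
  by apply/seteqP; split => -[x y] /=; rewrite mul0r addr0 => //; case.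
have mA : measurable ((fun z : measurableTypeR R => a * z) @^-1` B).
  by rewrite -[X in measurable X]setTI; apply: (_ : measurable_fun setT _) => //;
    exact: measurable_funM.
by rewrite product_measure1E//= /normal_prob integral_normal_pdf mule1.
Qed.

End normal_product.

(** * Expectations *)

Definition itg {R : realType} {d} {T : measurableType d} (P : probability T R)
  (X : T -> R) : Prop := P.-integrable setT (EFin \o X).

Definition Ex {R : realType} {d} {T : measurableType d} (P : probability T R)
  (X : T -> R) : R := \int[P]_w X w.

Section expectation.
Context {R : realType} {d : measure_display} {T : measurableType d}.
Variable P : probability T R.
Implicit Types (X Y f g h : T -> R) (A S : set T).
Local Notation itg := (itg P).
Local Notation Ex := (Ex P).

Lemma itg_meas X : itg X -> measurable_fun setT X.
Proof. by move=> /integrableP[/measurable_EFinP]. Qed.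

Lemma itgD X Y : itg X -> itg Y -> itg (fun w => X w + Y w).
Proof. by move=> iX iY; exact: (integrableD measurableT iX iY). Qed.

Lemma itgZ c X : itg X -> itg (fun w => c * X w).
Proof. by move=> iX; apply: (integrableZl measurableT c iX). Qed.

Lemma itgB X Y : itg X -> itg Y -> itg (fun w => X w - Y w).
Proof. by move=> iX iY; exact: (integrableB measurableT iX iY). Qed.

Lemma itg_bdd M X : measurable_fun setT X -> (forall w, `|X w| <= M) -> itg X.
Proof.
move=> mX bX; apply: measurable_bounded_integrable => //.
  by rewrite (le_lt_trans (probability_le1 P measurableT))// ltry.
apply: (_ : exists K, K \is Num.real /\ forall y, K < y -> forall w, setT w -> `|X w| <= y).
exists M; split; first exact: num_real.
by move=> y My w _; rewrite (le_trans (bX w))// ltW.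
Qed.

Lemma itg_cst c : itg (fun=> c).
Proof. by apply: (@itg_bdd `|c|). Qed.

Lemma itg_le X Y : measurable_fun setT X -> (forall w, `|X w| <= `|Y w|) ->
  itg Y -> itg X.
Proof.
move=> mX XY; apply: le_integrable => //; first exact/measurable_EFinP.
by move=> w _; rewrite lee_fin.
Qed.

Lemma itg_norm X : itg X -> itg (fun w => `|X w|).
Proof. by move=> iX; exact: (integrable_norm iX). Qed.

Lemma itgM_bdd M X Y : measurable_fun setT Y -> (forall w, `|Y w| <= M) ->
  itg X -> itg (fun w => X w * Y w).
Proof.
move=> mY bY iX; apply: (@itg_le _ (fun w => M * X w)); last exact: itgZ.
  by apply: measurable_funM => //; exact: itg_meas.
move=> w; rewrite !normrM mulrC ler_wpM2r//.
by rewrite (le_trans (bY w))// ler_norm.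
Qed.

Lemma indic_bdd A w : `|\1_A w : R| <= 1.
Proof. by rewrite indicE; case: (_ \in _); rewrite ?normr0 ?normr1. Qed.

Lemma itg_indic A : measurable A -> itg \1_A.
Proof. by move=> mA; apply: (@itg_bdd 1) => //; exact: indic_bdd. Qed.

Lemma itgM_indic X A : measurable A -> itg X -> itg (fun w => X w * \1_A w).
Proof.
by move=> mA; apply: (@itgM_bdd 1); [exact: measurable_indic|exact: indic_bdd].
Qed.

Lemma itg_sum (I : Type) (s : seq I) (F : I -> T -> R) :
  (forall i, itg (F i)) -> itg (fun w => \sum_(i <- s) F i w).
Proof.
move=> iF; elim: s => [|i s ih].
  by rewrite (_ : (fun w => _) = fun=> 0); [exact: itg_cst|
    apply/funext => w; rewrite big_nil].
rewrite (_ : (fun w => _) = (fun w => F i w + \sum_(j <- s) F j w)).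
  exact: itgD.
by apply/funext => w; rewrite big_cons.
Qed.

Lemma ExD X Y : itg X -> itg Y -> Ex (fun w => X w + Y w) = Ex X + Ex Y.
Proof. by move=> iX iY; apply: RintegralD. Qed.

Lemma ExB X Y : itg X -> itg Y -> Ex (fun w => X w - Y w) = Ex X - Ex Y.
Proof. by move=> iX iY; apply: RintegralB. Qed.

Lemma ExZ c X : itg X -> Ex (fun w => c * X w) = c * Ex X.
Proof. by move=> iX; apply: RintegralZl. Qed.

Lemma Ex_cst c : Ex (fun=> c) = c.
Proof.
rewrite /Ex Rintegral_cst// -[RHS]mulr1; congr (_ * _); rewrite -[RHS]/(fine 1%E).
by congr fine; exact: probability_setT.
Qed.

Lemma Ex_sum (I : Type) (s : seq I) (F : I -> T -> R) :
  (forall i, itg (F i)) -> Ex (fun w => \sum_(i <- s) F i w) = \sum_(i <- s) Ex (F i).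
Proof.
move=> iF; elim: s => [|i s ih].
  rewrite big_nil -[RHS](Ex_cst 0); congr Ex.
  by apply/funext => w; rewrite big_nil.
rewrite big_cons -ih -ExD//; last exact: itg_sum.
by congr Ex; apply/funext => w; rewrite big_cons.
Qed.

Lemma Ex_ge0 X : (forall w, 0 <= X w) -> 0 <= Ex X.
Proof. by move=> X0; apply: Rintegral_ge0. Qed.

(** Bridge between the extended-real integrals over events in the definitions and the real-valued
    moments on which the computations are done. *)
Lemma integral_indic_Ex X S : measurable S -> itg X ->
  (\int[P]_(w in S) (X w)%:E = (Ex (fun w => X w * \1_S w))%:E)%E.
Proof.
move=> mS iX; rewrite integral_mkcond fineK; last first.
  by apply: integrable_fin_num => //; exact: itgM_indic.
apply: eq_integral => w _; rewrite patchE indicE.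
by case: (w \in S); rewrite ?mulr1 ?mulr0.
Qed.

Lemma Ex_indic A : measurable A -> (Ex \1_A)%:E = P A.
Proof.
move=> mA; rewrite fineK; last by apply: integrable_fin_num => //; exact: itg_indic.
by rewrite integral_indic// setIT.
Qed.

Lemma Ex_dominated (F : nat -> T -> R) f g : itg g ->
  (forall n, measurable_fun setT (F n)) -> (forall n w, `|F n w| <= g w) ->
  (forall w, F n w @[n --> \oo] --> f w) ->
  itg f /\ (Ex (F n) @[n --> \oo] --> Ex f).
Proof.
move=> ig mF bF cF.
have mf : measurable_fun setT f by apply: measurable_fun_cvg => // w _; exact: cF.
have [|||||i1 _ i3] := @dominated_convergence _ _ _ P setT measurableT
  (fun n => EFin \o F n) (EFin \o f) (EFin \o g).
- by move=> n; exact/measurable_EFinP.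
- exact/measurable_EFinP.
- by apply: aeW => w _; apply/fine_cvgP; split; [exact: nearW|exact: cF].
- exact: ig.
- by apply: aeW => w n _; rewrite lee_fin.
split => //.
apply: fine_cvg; rewrite fineK; first exact: i3.
exact: integrable_fin_num.
Qed.

Lemma Ex_limit0 (F : nat -> T -> R) f g : itg g ->
  (forall n, measurable_fun setT (F n)) -> (forall n w, `|F n w| <= g w) ->
  (forall w, F n w @[n --> \oo] --> f w) -> (forall n, Ex (F n) = 0) -> Ex f = 0.
Proof.
move=> ig mF bF cF E0; have [_] := Ex_dominated ig mF bF cF.
under eq_fun do rewrite E0.
by move=> /cvg_lim <- //; rewrite lim_cst.
Qed.

End expectation.

(** * From indicators of events to measurable functions, and from pi-systems to sigma-algebras *)

Section simple_approximation.
Context {R : realType}.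

Import HBNNSimple.

(** Stated on the real line rather than on the sample space: composed with [X], the level sets
    become preimages under [X] and stay in whatever sigma-algebra [X] is measurable for. *)
Lemma positive_part_approx : exists phi : nat -> R -> R,
  [/\ forall n t, 0 <= phi n t <= Num.max t 0,
      forall t, phi n t @[n --> \oo] --> Num.max t 0 &
      forall n, exists (s : seq R) (B : R -> set R),
        (forall k, measurable (B k)) /\
        forall t, phi n t = \sum_(k <- s) k * \1_(B k) t].
Proof.
pose f (t : R) := (Num.max t 0)%:E.
have mf : measurable_fun [set: R] f.
  by apply/measurable_EFinP; apply: measurable_maxr.
have f0 t : (0 <= f t)%E by rewrite lee_fin le_max lexx orbT.
exists (fun n t => nnsfun_approx measurableT mf n t); split.
- move=> n t; apply/andP; split; first exact: fun_ge0.
  rewrite -lee_fin nnsfun_approxE.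
  exact: (@le_approx _ _ _ setT f n t (fun t _ => f0 t) Logic.I).
- move=> t; have := cvg_nnsfun_approx measurableT mf (fun t _ => f0 t) (x := t) Logic.I.
  by move=> /fine_cvgP[_]; apply: cvg_trans; apply: near_eq_cvg; near=> n.
- move=> n; set phi := nnsfun_approx _ _ _.
  exists (finmap.enum_fset (fset_set (range phi))), (fun k => phi @^-1` [set k]); split.
    by move=> k; exact: measurable_sfunP.
  move=> t; rewrite [LHS]fimfunE.
  by rewrite fsbig_finite.
Unshelve. all: end_near. Qed.

End simple_approximation.

Section extension.
Context {R : realType} {d : measure_display} {T : measurableType d}.
Variable P : probability T R.
Local Notation itg := (itg P).
Local Notation Ex := (Ex P).

Definition sigma_meas (G : set (set T)) (X : T -> R) :=
  forall B : set R, measurable B -> G (X @^-1` B).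

Lemma sigma_meas_fun (G : set (set T)) X :
  G `<=` measurable -> sigma_meas G X -> measurable_fun setT X.
Proof. by move=> mG GX _ B mB; rewrite setTI; apply: mG; exact: GX. Qed.

(** Dominated convergence along simple functions of [X], with the integrable [|h * X|] as the
    bound. *)
Lemma Ex_mul_pos0 (G : set (set T)) h X : G `<=` measurable ->
  itg h -> (forall A, G A -> Ex (fun w => h w * \1_A w) = 0) ->
  sigma_meas G X -> itg (fun w => h w * X w) ->
  Ex (fun w => h w * Num.max (X w) 0) = 0.
Proof.
move=> mG ih h0 GX ihX.
have mX := sigma_meas_fun mG GX.
have [phi [phib phic phis]] := @positive_part_approx R.
have phiX n : exists (s : seq R) (B : R -> set T), (forall k, G (B k)) /\
    forall w, phi n (X w) = \sum_(k <- s) k * \1_(B k) w.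
  have [s [B [mB phiE]]] := phis n.
  exists s, (fun k => X @^-1` B k); split; first by move=> k; exact: GX.
  by move=> w; rewrite phiE.
have mphi n : measurable_fun setT (fun w => phi n (X w)).
  have [s [B [GB phiE]]] := phiX n.
  under eq_fun do rewrite phiE.
  apply: measurable_sum => k; apply: measurable_funM => //.
  by apply: measurable_indic; exact: mG.
apply: (@Ex_limit0 _ _ _ P (fun n w => h w * phi n (X w)) _ _ (itg_norm ihX)).
- by move=> n; apply: measurable_funM => //; exact: (itg_meas ih).
- move=> n w; rewrite !normrM ler_wpM2l//.
  have /andP[p0 p1] := phib n (X w); rewrite ger0_norm// (le_trans p1)//.
  by rewrite ge_max ler_norm normr_ge0.
- move=> w; apply: cvgM; first exact: cvg_cst.
  exact: phic.
- move=> n; have [s [B [GB phiE]]] := phiX n.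
  transitivity (\sum_(k <- s) k * Ex (fun w => h w * \1_(B k) w)).
    have itgB k : itg (fun w => h w * \1_(B k) w).
      by apply: itgM_indic => //; exact: mG.
    rewrite -[in RHS](eq_bigr _ (fun k _ => ExZ k (itgB k))) -Ex_sum//.
      congr Ex; apply/funext => w; rewrite phiE mulr_sumr.
      by apply: eq_bigr => k _; rewrite mulrCA.
    by move=> k; exact: itgZ.
  by rewrite big1// => k _; rewrite h0 ?mulr0.
Qed.

(** A variable with zero mean on all events of [G] has conditional expectation zero given [G], so it
    is orthogonal to every [G]-measurable multiplier. Conditional expectations are used through this
    lemma, on the positive and the negative part of [X]. *)
Lemma Ex_mul_sigma_meas0 (G : set (set T)) h X : G `<=` measurable ->
  itg h -> (forall A, G A -> Ex (fun w => h w * \1_A w) = 0) ->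
  sigma_meas G X -> itg (fun w => h w * X w) ->
  Ex (fun w => h w * X w) = 0.
Proof.
move=> mG ih h0 GX ihX.
have mX := sigma_meas_fun mG GX; have mh := itg_meas ih.
have GNX : sigma_meas G (fun w => - X w).
  move=> B mB; have mNB : measurable ((-%R : R -> R) @^-1` B).
    by rewrite -[X in measurable X]setTI; apply: (_ : measurable_fun setT _).
  exact: (GX _ mNB).
have ihNX : itg (fun w => h w * - X w).
  by under eq_fun do rewrite mulrN -mulN1r; exact: itgZ.
have e1 := Ex_mul_pos0 mG ih h0 GX ihX.
have e2 := Ex_mul_pos0 mG ih h0 GNX ihNX.
have i1 : itg (fun w => h w * Num.max (X w) 0).
  apply: (itg_le _ _ ihX); first by apply: measurable_funM => //; exact: measurable_maxr.
  move=> w; rewrite !normrM ler_wpM2l// ger0_norm ?le_max ?lexx ?orbT//.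
  by rewrite ge_max ler_norm normr_ge0.
have i2 : itg (fun w => h w * Num.max (- X w) 0).
  apply: (itg_le _ _ ihNX).
    apply: measurable_funM => //; apply: measurable_maxr => //.
    exact: measurable_funN.
  move=> w; rewrite !normrM ler_wpM2l// ger0_norm ?le_max ?lexx ?orbT//.
  by rewrite ge_max ler_norm normr_ge0.
transitivity (Ex (fun w => h w * Num.max (X w) 0) -
  Ex (fun w => h w * Num.max (- X w) 0)); last by rewrite e1 e2 subrr.
rewrite -ExB//; congr Ex; apply/funext => w; rewrite -mulrBr; congr (_ * _).
by rewrite /Num.max; case: ifPn; case: ifPn; rewrite -?leNgt; lra.
Qed.

(** The events over which [h] integrates to zero form a lambda-system; the whole space belongs to it
    because [h] has mean zero. *)
Lemma Ex_pi_system0 (C : set (set T)) h : C `<=` measurable -> setI_closed C ->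
  itg h -> Ex h = 0 -> (forall A, C A -> Ex (fun w => h w * \1_A w) = 0) ->
  forall A, <<s C >> A -> Ex (fun w => h w * \1_A w) = 0.
Proof.
move=> mC CI ih h0 hC A sA; pose H := [set A | measurable A /\ Ex (fun w => h w * \1_A w) = 0].
suff : <<s C >> `<=` H by move=> /(_ _ sA) [].
apply: lambda_system_subset => //.
- split => //.
  + split => //; rewrite -[RHS]h0; congr Ex; apply/funext => w.
    by rewrite indicT/= mulr1.
  + move=> B1 B2 B21 [mB1 E1] [mB2 E2]; split; first exact: measurableD.
    transitivity (Ex (fun w => h w * \1_B1 w) - Ex (fun w => h w * \1_B2 w));
      last by rewrite E1 E2 subrr.
    rewrite -ExB; [|exact: itgM_indic..].
    congr Ex; apply/funext => w; rewrite -mulrBr; congr (_ * _).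
    rewrite !indicE in_setD; case: (boolP (w \in B1)) => w1; case: (boolP (w \in B2)) => w2;
      rewrite /= ?subrr ?subr0//.
    by move: w1; rewrite inE in w2; rewrite mem_set//; exact: B21.
  + move=> F ndF HF; split; first by apply: bigcupT_measurable => n; case: (HF n).
    apply: (@Ex_limit0 _ _ _ P (fun n w => h w * \1_(F n) w) _ _ (itg_norm ih)).
    * move=> n; apply: measurable_funM; first exact: itg_meas ih.
      by apply: measurable_indic; case: (HF n).
    * move=> n w; rewrite normrM ler_piMr//; exact: indic_bdd.
    * move=> w; apply: cvgM; first exact: cvg_cst.
      have [[n _ Fnw]|nF] := pselect ((\bigcup_n F n) w).
        apply: cvg_near_cst; exists n => // m /= nm; rewrite !indicE !mem_set//.
          by exists n.
        by have /subsetPset := ndF _ _ nm; apply.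
      apply: cvg_near_cst; near=> m; rewrite !indicE !memNset//.
      by move=> Fmw; apply: nF; exists m.
    * by move=> n; case: (HF n).
- by move=> B CB; split; [exact: mC|exact: hC].
Unshelve. all: end_near. Qed.

End extension.

(** * Events as limits of trigonometric functions *)

Section sign_iteration.
Context {R : realType}.
Implicit Types (t : R) (n : nat).

(* The odd map t |-> (3 t - t^3) / 2 preserves [-1, 1] and its iterates
   converge there to the sign. *)
Definition sign_step t := (3 * t - t ^+ 3) / 2.

Lemma iter_sign_stepN n t : iter n sign_step (- t) = - iter n sign_step t.
Proof.
elim: n => //= n ->; rewrite /sign_step.
by set u := iter _ _ _; ring.
Qed.

Lemma sign_step_itv t : 0 <= t <= 1 -> t <= sign_step t <= 1.
Proof.
rewrite /sign_step => /andP[t0 t1].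
(* [h1] and [h2] are the factored forms of twice [sign_step t - t] and twice [1 - sign_step t]. *)
have h1 : 0 <= t * (1 - t) * (1 + t) by rewrite !mulr_ge0//; lra.
have h2 : 0 <= (1 - t) * (1 - t) * (2 + t) by rewrite !mulr_ge0//; lra.
by apply/andP; split; lra.
Qed.

Lemma iter_sign_step_itv n t : 0 <= t <= 1 -> t <= iter n sign_step t <= 1.
Proof.
move=> /andP[t0 t1]; elim: n => /= [|n /andP[h1 h2]]; first by rewrite lexx.
have /andP[h3 h4] : iter n sign_step t <= sign_step (iter n sign_step t) <= 1.
  by apply: sign_step_itv; rewrite h2 (le_trans t0).
by rewrite (le_trans h1).
Qed.

Lemma norm_iter_sign_step n t : `|t| <= 1 -> `|iter n sign_step t| <= 1.
Proof.
have pos u : 0 <= u -> u <= 1 -> `|iter n sign_step u| <= 1.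
  move=> u0 u1; have /andP[h1 h2] : u <= iter n sign_step u <= 1.
    by apply: iter_sign_step_itv; rewrite u0.
  by rewrite ger0_norm// (le_trans u0).
rewrite ler_norml => /andP[t1 t2].
have [t0|t0] := leP 0 t; first exact: pos.
by rewrite -[t]opprK iter_sign_stepN normrN; apply: pos; lra.
Qed.

(** The iterates stay above [t], and as long as they do each step shrinks the distance to 1 by a
    factor of at most [1 - t / 2]. *)
Lemma cvg_iter_sign_step_gt0 t : 0 < t -> t <= 1 ->
  iter n sign_step t @[n --> \oo] --> (1 : R).
Proof.
move=> t0 t1.
have t01 : 0 <= t <= 1 by rewrite t1 ltW.
have geo n : 1 - iter n sign_step t <= (1 - t / 2) ^+ n.
  elim: n => [|n ih] /=; first by rewrite expr0; lra.
  have /andP[h1 h2] := iter_sign_step_itv n t01.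
  rewrite exprS; apply: (@le_trans _ _ ((1 - t / 2) * (1 - iter n sign_step t))).
    rewrite /sign_step; move: (iter n sign_step t) h1 h2 => u h1 h2.
    have : 0 <= (1 - u) * ((u - t) + u ^+ 2).
      by apply: mulr_ge0; [lra|have := sqr_ge0 u; lra].
    by lra.
  by rewrite ler_wpM2l//; lra.
have c0 : (1 - t / 2) ^+ n @[n --> \oo] --> (0 : R).
  by apply: cvg_expr; rewrite ger0_norm; lra.
apply: (@squeeze_cvgr _ _ _ _ (fun n => 1 - (1 - t / 2) ^+ n) (fun=> 1)).
- near=> n; have /andP[h1 h2] := iter_sign_step_itv n t01.
  by rewrite h2 andbT; have := geo n; lra.
- by rewrite -[X in _ --> X]subr0; apply: cvgB => //; exact: cvg_cst.
- exact: cvg_cst.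
Unshelve. all: end_near. Qed.

Lemma cvg_iter_sign_step t : `|t| <= 1 ->
  iter n sign_step t @[n --> \oo] --> Num.sg t.
Proof.
rewrite ler_norml => /andP[t1 t2].
have [t0|t0|t0] := ltgtP 0 t.
- by rewrite gtr0_sg//; exact: cvg_iter_sign_step_gt0.
- rewrite ltr0_sg// -[t]opprK; under eq_fun do rewrite iter_sign_stepN.
  by apply: cvgN; apply: cvg_iter_sign_step_gt0; lra.
- rewrite -t0 sgr0; apply: cvg_near_cst; near=> n.
  by elim: (n) => //= k ->; rewrite /sign_step; ring.
Unshelve. all: end_near. Qed.

(** Reaches the sign of an unbounded variable through bounded sines: for large [n] the angle is so
    close to 0 that its sine has the sign of [t]. *)
Lemma cvg_sg_sin t : Num.sg (sin (n.+1%:R^-1 * t)) @[n --> \oo] --> Num.sg t.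
Proof.
have pos u : 0 < u -> \forall n \near \oo, 0 < sin (n.+1%:R^-1 * u).
  move=> u0; near=> n; apply: sin2_gt0; rewrite mulr_gt0//=.
  rewrite mulrC ltr_pdivrMr//.
  have un : u < n%:R by near: n; exact: nbhs_infty_gtr.
  by rewrite (lt_trans un)// -natr1; have : (0 : R) <= n%:R by []; lra.
apply: cvg_near_cst.
have [t0|t0|t0] := ltgtP 0 t.
- by near=> n; rewrite (gtr0_sg t0) gtr0_sg//; near: n; exact: pos.
- near=> n; rewrite (ltr0_sg t0) ltr0_sg// -[t]opprK mulrN sinN oppr_lt0.
  by near: n; apply: pos; lra.
- by near=> n; rewrite -t0 mulr0 sin0.
Unshelve. all: end_near. Qed.

End sign_iteration.

Section trigonometric_class.
Context {R : realType} {T : Type}.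
Implicit Types (f g U V : T -> R) (S : set (T -> R)).

(* The closure of the functions cos (U + c), U in S, under linear combinations and
   bounded pointwise limits. Products stay inside (cosines linearize), hence so do
   signs and then the indicators of all events generated by S: identities between
   cosine moments extend to these events without Fourier inversion. *)
Inductive trigcl S : (T -> R) -> Prop :=
| trigcl_cos U c of S U : trigcl S (fun w => cos (U w + c))
| trigcl_lin a f g of trigcl S f & trigcl S g :
    trigcl S (fun w => a * f w + g w)
| trigcl_lim (F : nat -> T -> R) f M of (forall n, trigcl S (F n)) &
    (forall n w, `|F n w| <= M) & (forall w, F n w @[n --> \oo] --> f w) :
    trigcl S f.

Definition fun_submod S :=
  S (fun=> 0) /\ forall a U V, S U -> S V -> S (fun w => a * U w + V w).

Lemma submod0 S : fun_submod S -> S (fun=> 0).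
Proof. by case. Qed.

Lemma submodD S U V : fun_submod S -> S U -> S V -> S (fun w => U w + V w).
Proof.
move=> SS SU SV; have := SS.2 1 U V SU SV.
by congr S; apply/funext => w; rewrite mul1r.
Qed.

Lemma submodZ S a U : fun_submod S -> S U -> S (fun w => a * U w).
Proof.
move=> SS SU; have := SS.2 a U _ SU (submod0 SS).
by congr S; apply/funext => w; rewrite addr0.
Qed.

Lemma submodB S U V : fun_submod S -> S U -> S V -> S (fun w => U w - V w).
Proof.
move=> SS SU SV; have := SS.2 (-1) V U SV SU.
by congr S; apply/funext => w; ring.
Qed.

Lemma trigcl_bounded S f : trigcl S f -> exists M, forall w, `|f w| <= M.
Proof.
elim=> [U c _|a {}f g _ [M fM] _ [N gN]|F {}f M _ _ FM Ff].
- by exists 1 => w; exact: cos_max.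
- exists (`|a| * M + N) => w; rewrite (le_trans (ler_normD _ _))//.
  by rewrite lerD// normrM ler_wpM2l.
- exists M => w; apply: (cvgr_to_le (cvg_norm (Ff w))).
  by near=> n; exact: FM.
Unshelve. all: end_near. Qed.

Section submod.
Variables (S : set (T -> R)) (SS : fun_submod S).

Lemma trigcl1 : trigcl S (fun=> 1).
Proof.
have := trigcl_cos 0 SS.1.
by rewrite (_ : (fun w => _) = (fun=> 1))//; apply/funext => w; rewrite addr0 cos0.
Qed.

Lemma trigcl0 : trigcl S (fun=> 0).
Proof.
have := trigcl_lin (-1) trigcl1 trigcl1.
by rewrite (_ : (fun w => _) = (fun=> 0))//; apply/funext => w; rewrite mulN1r addNr.
Qed.

Lemma trigclZ a f : trigcl S f -> trigcl S (fun w => a * f w).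
Proof.
move=> Sf; have := trigcl_lin a Sf trigcl0.
by rewrite (_ : (fun w => _) = (fun w => a * f w))//; apply/funext => w; rewrite addr0.
Qed.

(** Induction on both factors. Two cosines multiply to half the sum of the cosines of the sum and
    the difference of their angles, which is where the linearity of [S] enters; limits pass through
    because members are bounded. *)
Lemma trigclM f g : trigcl S f -> trigcl S g -> trigcl S (fun w => f w * g w).
Proof.
move=> Sf; elim: Sf g => [U c SU|a {}f f' _ ihf _ ihf'|F {}f M SF ihF FM Ff] g Sg.
- elim: Sg => [V e SV|a {}g g' _ ihg _ ihg'|G {}g M SG ihG GM Gg].
  + have := trigcl_lin (2^-1) (trigcl_cos (c + e) (submodD SS SU SV))
      (trigclZ (2^-1) (trigcl_cos (c - e) (submodB SS SU SV))).
    congr trigcl; apply/funext => w.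
    rewrite (_ : U w + V w + (c + e) = (U w + c) + (V w + e)); last by ring.
    rewrite (_ : U w - V w + (c - e) = (U w + c) - (V w + e)); last by ring.
    by rewrite cosD cosB; field.
  + have := trigcl_lin a ihg ihg'; congr trigcl; apply/funext => w; ring.
  + apply: (trigcl_lim (M := M) ihG).
    * move=> n w; rewrite normrM (le_trans _ (GM n w))// ler_piMl//; exact: cos_max.
    * by move=> w; apply: cvgM; [exact: cvg_cst|exact: Gg].
- have := trigcl_lin a (ihf _ Sg) (ihf' _ Sg); congr trigcl; apply/funext => w; ring.
- have [N gN] := trigcl_bounded Sg.
  apply: (trigcl_lim (M := M * N) (fun n => ihF n _ Sg)).
  * by move=> n w; rewrite normrM ler_pM.
  * by move=> w; apply: cvgM; [exact: Ff|exact: cvg_cst].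
Qed.

Lemma trigcl_sg f : trigcl S f -> (forall w, `|f w| <= 1) ->
  trigcl S (fun w => Num.sg (f w)).
Proof.
move=> Sf f1.
apply: (@trigcl_lim S (fun n w => iter n sign_step (f w)) _ 1).
- elim=> [//|n ih] /=.
  have := trigcl_lin (3 / 2) ih (trigclZ (- 2^-1) (trigclM ih (trigclM ih ih))).
  by congr trigcl; apply/funext => w; rewrite /sign_step; field.
- by move=> n w; exact: norm_iter_sign_step.
- by move=> w; exact: cvg_iter_sign_step.
Qed.

Lemma trigcl_sgB U a : S U -> trigcl S (fun w => Num.sg (U w - a)).
Proof.
move=> SU.
apply: (@trigcl_lim S (fun n w => Num.sg (sin (n.+1%:R^-1 * (U w - a)))) _ 1).
- move=> n; apply: trigcl_sg; last by move=> w; exact: sin_max.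
  have SnU := submodZ n.+1%:R^-1 SS SU.
  have := trigcl_cos (- (n.+1%:R^-1 * a) - pi / 2) SnU.
  by congr trigcl; apply/funext => w; rewrite addrA cosBpihalf mulrBr.
- by move=> n w; rewrite normr_sg; case: (_ != 0).
- by move=> w; exact: cvg_sg_sin.
Qed.

(** Intersections are products and complements are affine combinations; a countable union is the
    bounded limit of its finite parts. *)
Lemma trigcl_sigma_algebra : sigma_algebra setT [set A | trigcl S \1_A].
Proof.
have SI A B : trigcl S \1_A -> trigcl S \1_B -> trigcl S \1_(A `&` B).
  by move=> SA SB; have := trigclM SA SB; congr trigcl; apply/funext => w; rewrite indicI.
have SC A : trigcl S \1_A -> trigcl S \1_(~` A).
  move=> SA; have := trigcl_lin (-1) SA trigcl1; congr trigcl; apply/funext => w.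
  by rewrite !indicE in_setC; case: (w \in A); rewrite /= ?mulr1 ?mulr0; ring.
split.
- by have := trigcl0; congr trigcl; apply/funext => w; rewrite indic0.
- by move=> A /= SA; rewrite setTD; exact: SC.
- move=> F SF /=.
  have SU n : trigcl S \1_(\big[setU/set0]_(i < n) F i).
    elim: n => [|n ih].
      by rewrite big_ord0; have := trigcl0; congr trigcl; apply/funext => w; rewrite indic0.
    rewrite big_ord_recr/= -[_ `|` _]setCK setCU; apply: (SC).
    by apply: (SI); [exact: (SC _ ih)|exact: (SC _ (SF n))].
  apply: (trigcl_lim (M := 1) SU).
    by move=> n w; rewrite indicE; case: (_ \in _); rewrite ?normr0 ?normr1.
  move=> w; apply: cvg_near_cst.
  have [[n _ Fnw]|nF] := pselect ((\bigcup_n F n) w).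
    exists n.+1 => // m /= nm; rewrite !indicE !mem_set//; first by exists n.
    by rewrite -bigcup_mkord; exists n.
  near=> m; rewrite !indicE !memNset//.
  by rewrite -bigcup_mkord => -[i _ Fiw]; apply: nF; exists i.
Unshelve. all: end_near. Qed.

(** Open rays generate the Borel sets, and with $s$ the sign of $U-a$ the indicator of $U>a$ is
    $(s^2+s)/2$. *)
Lemma trigcl_preimage U (B : set R) : S U -> measurable B ->
  trigcl S \1_(U @^-1` B).
Proof.
move=> SU.
have sa : sigma_algebra setT [set B : set R | trigcl S \1_(U @^-1` B)].
  have [h0 hC hU] := trigcl_sigma_algebra.
  split => /=.
  - by rewrite preimage_set0.
  - by move=> A /hC; rewrite !setTD -preimage_setC.
  - by move=> F /hU; rewrite preimage_bigcup.
rewrite (_ : measurable = <<s @RGenOInfty.G R >>); last exact: RGenOInfty.measurableE.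
move: B; apply: smallest_sub => //= _ [a ->].
have Ss := trigcl_sgB a SU.
have := trigcl_lin (2^-1) (trigclM Ss Ss) (trigclZ (2^-1) Ss).
congr trigcl; apply/funext => w; rewrite indicE.
have [wa|wa|wa] := ltgtP (U w - a) 0.
- rewrite ltr0_sg// memNset/=; first by field.
  by rewrite in_itv/= andbT => h; lra.
- rewrite gtr0_sg// mem_set/=; first by field.
  by rewrite in_itv/= andbT; lra.
- rewrite wa sgr0 memNset/=; first by ring.
  by rewrite in_itv/= andbT => h; lra.
Qed.

End submod.

Definition sigma_fun S : set (set T) :=
  <<s [set A | exists U (B : set R), [/\ S U, measurable B & A = U @^-1` B]] >>.

Lemma trigcl_sigma_fun S : fun_submod S -> forall A, sigma_fun S A -> trigcl S \1_A.
Proof.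
move=> SS; apply: smallest_sub; first exact: trigcl_sigma_algebra.
by move=> _ [U [B [SU mB ->]]]; exact: trigcl_preimage.
Qed.

End trigonometric_class.

Section trigonometric_extension.
Context {R : realType} {d : measure_display} {T : measurableType d}.
Variable P : probability T R.
Implicit Types (S : set (T -> R)) (h : T -> R).
Local Notation itg := (itg P).
Local Notation Ex := (Ex P).

Definition fun_meas S := forall U, S U -> measurable_fun setT U.

Lemma trigcl_measurable S f : fun_meas S -> trigcl S f -> measurable_fun setT f.
Proof.
move=> mS; elim=> [U c SU|a {}f g _ mf _ mg|F {}f M _ mF _ Ff].
- apply: (@measurableT_comp _ _ _ _ _ _ (@cos R) _ (fun w => U w + c)).
    by apply: continuous_measurable_fun; exact: continuous_cos.
  by apply: measurable_funD => //; exact: mS.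
- by apply: measurable_funD => //; exact: measurable_funM.
- by apply: measurable_fun_cvg => // w _; exact: Ff.
Qed.

Lemma sigma_fun_measurable S : fun_meas S -> sigma_fun S `<=` measurable.
Proof.
move=> mS; apply: smallest_sub; first exact: sigma_algebra_measurable.
by move=> _ [U [B [SU mB ->]]]; rewrite -[_ @^-1` _]setTI; exact: mS.
Qed.

(** The functions orthogonal to [h] are closed under linear combinations and, by dominated
    convergence with a multiple of [|h|] as the bound, under bounded limits. *)
Lemma Ex_mul_trigcl0 S h f : fun_meas S -> itg h ->
  (forall U c, S U -> Ex (fun w => h w * cos (U w + c)) = 0) ->
  trigcl S f -> Ex (fun w => h w * f w) = 0.
Proof.
move=> mS ih h0; have mh := itg_meas ih.
elim=> [U c SU|a {}f g Sf ef Sg eg|F {}f M SF eF FM Ff]; first exact: h0.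
- have [M fM] := trigcl_bounded Sf; have [N gN] := trigcl_bounded Sg.
  have i1 : itg (fun w => h w * f w).
    by apply: (itgM_bdd (trigcl_measurable mS Sf) fM ih).
  have i2 : itg (fun w => h w * g w).
    by apply: (itgM_bdd (trigcl_measurable mS Sg) gN ih).
  transitivity (a * Ex (fun w => h w * f w) + Ex (fun w => h w * g w)).
    rewrite -ExZ// -ExD//; last exact: itgZ.
    by congr Ex; apply/funext => w; ring.
  by rewrite ef eg mulr0 addr0.
- apply: (@Ex_limit0 _ _ _ P (fun n w => h w * F n w) _ _ (itgZ M (itg_norm ih))) => //.
  + by move=> n; apply: measurable_funM => //; exact: trigcl_measurable (SF n).
  + by move=> n w; rewrite normrM mulrC ler_wpM2r.
  + by move=> w; apply: cvgM; [exact: cvg_cst|exact: Ff].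
Qed.

Lemma Ex_mul_sigma_fun0 S h : fun_submod S -> fun_meas S -> itg h ->
  (forall U c, S U -> Ex (fun w => h w * cos (U w + c)) = 0) ->
  forall A, sigma_fun S A -> Ex (fun w => h w * \1_A w) = 0.
Proof.
move=> SS mS ih h0 A sA; apply: (Ex_mul_trigcl0 mS ih h0).
exact: trigcl_sigma_fun.
Qed.

End trigonometric_extension.

Notation std_normal R :=
  (normal_prob (0 : R) (1 : R) : probability (measurableTypeR R) R).

(** * Independence and equality of laws for expectations *)

Section independence.
Context {R : realType} {d : measure_display} {T : measurableType d}.
Variable P : probability T R.
Implicit Types (X Y : T -> R).

(** Two passes of [Ex_mul_sigma_meas0]: a centred indicator from [F] against [Y], then the centred
    [Y] against [X]. *)
Lemma Ex_indep (F G : set (set T)) X Y M : F `<=` measurable -> G `<=` measurable ->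
  indep2 P F G -> sigma_meas F X -> sigma_meas G Y -> itg P X ->
  (forall w, `|Y w| <= M) -> Ex P (fun w => X w * Y w) = Ex P X * Ex P Y.
Proof.
move=> mF mG FG FX GY iX YM.
have mY := sigma_meas_fun mG GY.
have iY : itg P Y by exact: itg_bdd YM.
have EI A : F A -> Ex P (fun w => (Y w - Ex P Y) * \1_A w) = 0.
  move=> FA; have mA := mF _ FA.
  have h0 : Ex P (fun w => (\1_A w - Ex P \1_A) * Y w) = 0.
    apply: (@Ex_mul_sigma_meas0 _ _ _ _ G) => //.
    - by apply: itgB; [exact: itg_indic|exact: itg_cst].
    - move=> B GB; have mB := mG _ GB.
      transitivity (Ex P \1_(A `&` B) - Ex P \1_A * Ex P \1_B).
        rewrite -ExZ; last exact: itg_indic.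
        rewrite -ExB; last 2 first.
        - by apply: itg_indic; exact: measurableI.
        - by apply: itgZ; exact: itg_indic.
        by congr Ex; apply/funext => w; rewrite indicI/= mulrBl.
      apply/eqP; rewrite subr_eq0; apply/eqP/EFin_inj.
      by rewrite EFinM !Ex_indic//; [exact: FG|exact: measurableI].
    - apply: (itgM_bdd mY YM); apply: itgB; [exact: itg_indic|exact: itg_cst].
  rewrite -[RHS]h0.
  transitivity (Ex P (fun w => Y w * \1_A w) - Ex P Y * Ex P \1_A).
    rewrite -ExZ; last exact: itg_indic.
    rewrite -ExB; last 2 first.
    - exact: itgM_indic.
    - by apply: itgZ; exact: itg_indic.
    by congr Ex; apply/funext => w; rewrite mulrBl.
  rewrite mulrC -ExZ// -ExB; last 2 first.
  - exact: itgM_indic.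
  - exact: itgZ.
  by congr Ex; apply/funext => w; rewrite mulrBl mulrC.
have iXY : itg P (fun w => X w * Y w) by exact: itgM_bdd YM iX.
have : Ex P (fun w => (Y w - Ex P Y) * X w) = 0.
  apply: (@Ex_mul_sigma_meas0 _ _ _ _ F) => //.
  - by apply: itgB => //; exact: itg_cst.
  - rewrite (_ : (fun w => _) = (fun w => X w * Y w - Ex P Y * X w)).
      by apply: itgB => //; exact: itgZ.
    by apply/funext => w; ring.
rewrite (_ : (fun w => _) = (fun w => X w * Y w - Ex P Y * X w)); last first.
  by apply/funext => w; ring.
rewrite ExB//; last exact: itgZ.
by rewrite ExZ// mulrC => /eqP; rewrite subr_eq0 => /eqP.
Qed.

End independence.

Section law_transfer.
Context {R : realType} {d d' : measure_display} {T : measurableType d}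
  {T' : measurableType d'}.
Variables (P : probability T R) (P' : probability T' R).
Implicit Types (X : T -> R) (Y : T' -> R).

Lemma same_law_ge0_integral X Y (f : R -> \bar R) :
  measurable_fun setT X -> measurable_fun setT Y ->
  (forall B, measurable B -> P (X @^-1` B) = P' (Y @^-1` B)) ->
  measurable_fun setT f -> (forall x, 0 <= f x)%E ->
  (\int[P]_w f (X w) = \int[P']_w f (Y w))%E.
Proof.
move=> mX mY XY mf f0.
have <- := ge0_integral_pushforward mX P measurableT mf (fun x _ => f0 x).
have <- := ge0_integral_pushforward mY P' measurableT mf (fun x _ => f0 x).
apply: (@eq_measure_integral _ _ _ setT (push P' mY) (push P mX) f) => B mB _.
exact: XY.
Qed.

Lemma same_law_itg X Y (f : R -> R) :
  measurable_fun setT X -> measurable_fun setT Y ->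
  (forall B, measurable B -> P (X @^-1` B) = P' (Y @^-1` B)) ->
  measurable_fun setT f -> itg P' (f \o Y) ->
  itg P (f \o X) /\ Ex P (f \o X) = Ex P' (f \o Y).
Proof.
move=> mX mY XY mf ifY.
have mfX : measurable_fun setT (f \o X) by exact: measurableT_comp.
have ifX : itg P (f \o X).
  apply/integrableP; split; first exact/measurable_EFinP.
  have mnf : measurable_fun setT (fun x => `|f x|%:E).
    by apply/measurable_EFinP; exact: measurableT_comp.
  have nf0 x : (0 <= `|f x|%:E)%E by rewrite lee_fin.
  have /= -> := same_law_ge0_integral mX mY XY mnf nf0.
  by have /integrableP[_] := ifY.
split => //; congr fine.
have mfE : measurable_fun [set: R] (EFin \o f) by exact/measurable_EFinP.
have /= <- := integral_pushforward mX mfE ifX measurableT.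
have /= <- := integral_pushforward mY mfE ifY measurableT.
apply: (@eq_measure_integral _ _ _ setT (push P' mY) (push P mX) _) => B mB _.
exact: XY.
Qed.

End law_transfer.

(** * Moments and characteristic functions of centred normal laws *)

Section normal_moments.
Context {R : realType}.
Local Notation gam := (std_normal R).
Notation mu := (@lebesgue_measure R).

(** From $1+u\le e^u$ at $u=z^2/4$ follows $z^2e^{-z^2/2}\le 4e^{-z^2/4}$, and the right-hand side
    is a multiple of the density of variance 2; [c] also carries the ratio of the two normalizing
    constants. *)
Lemma itg_std_normal_sqr : itg gam (fun z => z ^+ 2).
Proof.
apply/integrableP; split; first by apply/measurable_EFinP; exact: measurable_funX.
have mabs : measurable_fun [set: R] (fun z : R => `|(z ^+ 2)%:E|%E).
  by apply: measurableT_comp => //; apply/measurable_EFinP; exact: measurable_funX.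
rewrite (ge0_integral_normal_prob 0 1 mabs); last by move=> z; rewrite abse_ge0.
pose s : R := Num.sqrt 2.
have s2 : s ^+ 2 = 2 by rewrite sqr_sqrtr.
have s0 : s != 0 by rewrite -sqrf_eq0 s2.
pose c := 4 * (normal_peak 1 / normal_peak s).
have p0 := normal_peak_gt0 s0.
have c0 : 0 <= c by rewrite mulr_ge0// divr_ge0// normal_peak_ge0.
apply: (@le_lt_trans _ _ (\int[mu]_z (c%:E * (normal_pdf 0 s z)%:E))%E).
  apply: ge0_le_integral => //.
  - by move=> z _; apply: mule_ge0; rewrite ?abse_ge0// lee_fin normal_pdf_ge0.
  - apply: emeasurable_funM => //; apply/measurable_EFinP; exact: measurable_normal_pdf.
  - by apply: emeasurable_funM => //; apply/measurable_EFinP; exact: measurable_normal_pdf.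
  - move=> z _; rewrite /= -!EFinM lee_fin ger0_norm ?sqr_ge0//.
    rewrite !normal_pdfE ?oner_neq0// /c.
    rewrite [leRHS](_ : _ = normal_peak 1 * (4 * normal_fun 0 s z)); last first.
      by field; rewrite gt_eqF.
    rewrite mulrCA ler_wpM2l ?normal_peak_ge0// /normal_fun !subr0 s2 expr1n.
    rewrite (_ : - z ^+ 2 / (1 *+ 2) = - (z ^+ 2 / 4) + - z ^+ 2 / (2 *+ 2)); last by field.
    rewrite expRD mulrA ler_wpM2r ?expR_ge0// expRN.
    rewrite ler_pdivrMr ?expR_gt0//.
    have := expR_ge1Dx (z ^+ 2 / 4); have := sqr_ge0 z; lra.
have mp : measurable_fun [set: R] (fun z => (normal_pdf 0 s z)%:E).
  by apply/measurable_EFinP; exact: measurable_normal_pdf.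
rewrite (_ : (\int[mu]_z _)%E = (c%:E * \int[mu]_z (normal_pdf 0 s z)%:E)%E); last first.
  by apply: (ge0_integralZl mu measurableT mp) => [z _|]; rewrite lee_fin ?normal_pdf_ge0.
by rewrite integral_normal_pdf mule1 ltry.
Qed.

(* The constant is 1, but its positivity suffices: variances are always recovered
   from second moments by dividing by kappa. *)
Definition kappa : R := Ex gam (fun z => z ^+ 2).

(** If the second moment vanished, the law would be concentrated at 0; but points are Lebesgue null,
    hence null for a law with a density. *)
Lemma kappa_gt0 : 0 < kappa.
Proof.
have k0 : 0 <= kappa by apply: Ex_ge0 => z; exact: sqr_ge0.
rewrite lt0r k0 andbT; apply/negP => /eqP kE.
have i0 : (\int[gam]_z `|(z ^+ 2)%:E| = 0)%E.
  under eq_integral do rewrite abse_EFin ger0_norm ?sqr_ge0//.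
  apply/eqP; rewrite -fine_eq0 ?kE//.
    by apply/eqP; exact: kE.
  exact: (integrable_fin_num measurableT itg_std_normal_sqr).
have mz : measurable_fun [set: measurableTypeR R] (fun z : R => (z ^+ 2)%:E).
  by apply/measurable_EFinP; exact: measurable_funX.
have : ae_eq gam setT (fun z : R => (z ^+ 2)%:E) (cst 0%E).
  by apply/ae_eq_integral_abs.
move=> [N [mN gN sN]].
have N0 : [set~ (0:R)] `<=` N.
  move=> z /= z0; apply: sN => /= /(_ Logic.I) [] /eqP.
  by rewrite sqrf_eq0 => /eqP.
have g0 : (gam [set (0%R:R)] = 0)%E.
  have := @normal_prob_dominates R 0 1.
  move=> /null_content_dominatesP; apply => //; exact: lebesgue_measure_set1.
have m0 : measurable ([set 0] : set (measurableTypeR R)) by exact: measurable_set1.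
have mU := measureU2 gam m0 (measurableC m0).
have gC : (gam (~` [set 0%R]) <= gam N)%E.
  by apply: le_measure; rewrite ?inE//; exact: measurableC.
have eqle (a b : \bar R) : a = b -> (a <= b)%E by move=> ->.
have : (gam setT <= 0)%E.
  rewrite -(setUv [set 0%R]); apply: (le_trans mU); rewrite -[leRHS]add0e.
  by apply: leeD; [exact: (eqle _ _ g0)|exact: (le_trans gC (eqle _ _ gN))].
by apply/negP; rewrite -ltNge; apply: (@lt_le_trans _ _ 1%E); rewrite ?lte01//
   -(probability_setT gam).
Qed.

End normal_moments.

Definition cnormal {R : realType} {d} {T : measurableType d}
    (P : probability T R) (X : T -> R) (s2 : R) :=
  measurable_fun setT X /\ normal_law P X 0 s2.

Section centered_normal.
Context {R : realType} {d : measure_display} {T : measurableType d}.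
Variable P : probability T R.
Implicit Types (X Y : T -> R) (a b c : R).
Local Notation gam := (std_normal R).

Lemma measurable_scale c : measurable_fun [set: measurableTypeR R] (fun z : R => c * z).
Proof. exact: measurable_funM. Qed.

Lemma cnormal_gam X s2 : cnormal P X s2 ->
  forall B, measurable B -> P (X @^-1` B) = gam ((fun z => Num.sqrt s2 * z) @^-1` B).
Proof. by move=> [_ [s0 XE]] B mB; rewrite XE//; exact: normal_law_gam. Qed.

Lemma gam_cnormal X s2 : measurable_fun setT X -> 0 <= s2 ->
  (forall B, measurable B -> P (X @^-1` B) = gam ((fun z => Num.sqrt s2 * z) @^-1` B)) ->
  cnormal P X s2.
Proof.
by move=> mX s0 XE; split => //; split => // B mB; rewrite XE//; apply/esym/normal_law_gam.
Qed.

Lemma cnormal_ge0 X s2 : cnormal P X s2 -> 0 <= s2.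
Proof. by case=> _ []. Qed.

Lemma cnormal_itg X s2 (f : R -> R) : cnormal P X s2 -> measurable_fun setT f ->
  itg gam (fun z => f (Num.sqrt s2 * z)) ->
  itg P (fun w => f (X w)) /\ Ex P (fun w => f (X w)) = Ex gam (fun z => f (Num.sqrt s2 * z)).
Proof.
move=> cX mf; have [mX _] := cX.
exact: (same_law_itg mX (measurable_scale _) (cnormal_gam cX) mf).
Qed.

Lemma cnormal_Ex_bdd X s2 (f : R -> R) M : cnormal P X s2 -> measurable_fun setT f ->
  (forall x, `|f x| <= M) ->
  Ex P (fun w => f (X w)) = Ex gam (fun z => f (Num.sqrt s2 * z)).
Proof.
move=> cX mf fM; apply: (cnormal_itg cX mf _).2.
by apply: (@itg_bdd _ _ _ _ M) => //; apply: measurableT_comp.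
Qed.

Lemma cnormal_sqr X s2 : cnormal P X s2 ->
  itg P (fun w => X w ^+ 2) /\ Ex P (fun w => X w ^+ 2) = kappa * s2.
Proof.
move=> cX.
have fE : (fun z : R => (Num.sqrt s2 * z) ^+ 2) = (fun z => s2 * z ^+ 2).
  by apply/funext => z; rewrite exprMn sqr_sqrtr// (cnormal_ge0 cX).
have mf : measurable_fun [set: R] (fun x : R => x ^+ 2) by exact: measurable_funX.
have ig : itg gam (fun z => (Num.sqrt s2 * z) ^+ 2).
  by rewrite fE; apply: itgZ; exact: itg_std_normal_sqr.
have [i e] := cnormal_itg cX mf ig.
split; first exact: i.
rewrite [LHS]e fE (ExZ s2 itg_std_normal_sqr).
exact: mulrC.
Qed.

(** For negative [c] the symmetry of the standard law absorbs the sign. *)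
Lemma cnormalZ c X s2 : cnormal P X s2 -> cnormal P (fun w => c * X w) (c ^+ 2 * s2).
Proof.
move=> cX; have [mX _] := cX; have s0 := cnormal_ge0 cX.
apply: gam_cnormal; first exact: measurable_funM.
  by rewrite mulr_ge0// sqr_ge0.
move=> B mB.
have mcB : measurable ((fun x : R => c * x) @^-1` B).
  by rewrite -[_ @^-1` _]setTI; apply: (measurable_scale c).
rewrite [LHS](cnormal_gam cX mcB) sqrtrM ?sqr_ge0// sqrtr_sqr.
have [c0|c0] := leP 0 c.
  by rewrite ger0_norm//; congr (_ (_ @^-1` B)); apply/funext => z; rewrite mulrA.
rewrite ltr0_norm// -[RHS]gam_opp.
  congr (normal_prob 0 1 (_ @^-1` B)); apply/funext => z /=.
  by ring.
by rewrite -[_ @^-1` _]setTI; apply: measurable_scale.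
Qed.

(* The characteristic function of the centred normal law of variance s2. *)
Definition psi (s2 : R) : R := Ex gam (fun z => cos (Num.sqrt s2 * z)).

Lemma measurable_cos : measurable_fun [set: R] (@cos R).
Proof. by apply: continuous_measurable_fun; exact: continuous_cos. Qed.

Lemma measurable_sin : measurable_fun [set: R] (@sin R).
Proof. by apply: continuous_measurable_fun; exact: continuous_sin. Qed.

Lemma itg_comp_bdd (f : R -> R) M X : measurable_fun setT f ->
  (forall x, `|f x| <= M) -> measurable_fun setT X -> itg P (fun w => f (X w)).
Proof.
by move=> mf fM mX; apply: (@itg_bdd _ _ _ _ M) => //; exact: (measurableT_comp mf).
Qed.

Lemma cnormal_Ex_cos X s2 : cnormal P X s2 -> Ex P (fun w => cos (X w)) = psi s2.
Proof. move=> cX; exact: (cnormal_Ex_bdd cX measurable_cos (@cos_max R)). Qed.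

(** [X] and its opposite have the same law, and the sine is odd. *)
Lemma cnormal_Ex_sin X s2 : cnormal P X s2 -> Ex P (fun w => sin (X w)) = 0.
Proof.
move=> cX; have [mX _] := cX.
have := cnormal_Ex_bdd cX measurable_sin (@sin_max R).
have := cnormal_Ex_bdd (cnormalZ (-1) cX) measurable_sin (@sin_max R).
rewrite sqrrN expr1n mul1r => <-.
rewrite (_ : (fun w => sin (-1 * X w)) = (fun w => -1 * sin (X w))); last first.
  by apply/funext => w; rewrite !mulN1r sinN.
rewrite ExZ; first by move=> h; lra.
exact: (itg_comp_bdd measurable_sin (@sin_max R)).
Qed.

Lemma cnormal_Ex_cosD X s2 c : cnormal P X s2 ->
  Ex P (fun w => cos (X w + c)) = psi s2 * cos c.
Proof.
move=> cX; have [mX _] := cX.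
have icos : itg P (fun w => cos (X w)).
  exact: (itg_comp_bdd measurable_cos (@cos_max R)).
have isin : itg P (fun w => sin (X w)).
  exact: (itg_comp_bdd measurable_sin (@sin_max R)).
transitivity (cos c * Ex P (fun w => cos (X w)) - sin c * Ex P (fun w => sin (X w))).
  rewrite -!ExZ// -ExB; [|exact: itgZ..].
  by congr Ex; apply/funext => w; rewrite cosD; ring.
by rewrite (cnormal_Ex_sin cX) (cnormal_Ex_cos cX); ring.
Qed.

(** The addition formula splits by independence, and the product of sines drops out because the sine
    of a centred normal variable has mean zero. *)
Lemma cnormal_sum_indep X Y a b : cnormal P X a -> cnormal P Y b ->
  (forall B C, measurable B -> measurable C ->
    P (X @^-1` B `&` Y @^-1` C) = (P (X @^-1` B) * P (Y @^-1` C))%E) ->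
  (forall t c, Ex P (fun w => cos (t * (X w + Y w) + c)) =
     psi (t ^+ 2 * a) * psi (t ^+ 2 * b) * cos c).
Proof.
move=> cX cY XY t c; have [mX _] := cX; have [mY _] := cY.
pose F := [set A | exists2 B : set R, measurable B & A = X @^-1` B].
pose G := [set A | exists2 B : set R, measurable B & A = Y @^-1` B].
have mF : F `<=` measurable.
  by move=> _ [B mB ->]; rewrite -[_ @^-1` _]setTI; exact: mX.
have mG : G `<=` measurable.
  by move=> _ [B mB ->]; rewrite -[_ @^-1` _]setTI; exact: mY.
have FG : indep2 P F G by move=> _ _ [B mB ->] [C mC ->]; exact: XY.
have mpre (f : R -> R) B : measurable_fun setT f -> measurable B -> measurable (f @^-1` B).
  by move=> mf mB; rewrite -[_ @^-1` _]setTI; exact: mf.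
have m1 (f : R -> R) e : measurable_fun setT f -> measurable_fun setT (fun x => f (t * x + e)).
  move=> mf; apply: (measurableT_comp mf).
  by apply: measurable_funD => //; exact: measurable_funM.
have FX (f : R -> R) e : measurable_fun setT f -> sigma_meas F (fun w => f (t * X w + e)).
  by move=> mf B mB; exists ((fun x => f (t * x + e)) @^-1` B) => //; apply: mpre => //; exact: m1.
have GY (f : R -> R) e : measurable_fun setT f -> sigma_meas G (fun w => f (t * Y w + e)).
  by move=> mf B mB; exists ((fun x => f (t * x + e)) @^-1` B) => //; apply: mpre => //; exact: m1.
have iF (f : R -> R) e M : measurable_fun setT f -> (forall x, `|f x| <= M) ->
    itg P (fun w => f (t * X w + e)).
  move=> mf fM; apply: (itg_comp_bdd mf fM).
  by apply: measurable_funD => //; exact: measurable_funM.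
have iG (f : R -> R) e M : measurable_fun setT f -> (forall x, `|f x| <= M) ->
    itg P (fun w => f (t * Y w + e)).
  move=> mf fM; apply: (itg_comp_bdd mf fM).
  by apply: measurable_funD => //; exact: measurable_funM.
have e1 := Ex_indep mF mG FG (FX _ c measurable_cos) (GY _ 0 measurable_cos)
  (iF _ c _ measurable_cos (@cos_max R)) (fun w => cos_max _).
have e2 := Ex_indep mF mG FG (FX _ c measurable_sin) (GY _ 0 measurable_sin)
  (iF _ c _ measurable_sin (@sin_max R)) (fun w => sin_max _).
have i1 := itgM_bdd (sigma_meas_fun mG (GY _ 0 measurable_cos)) (fun w => cos_max _)
  (iF _ c _ measurable_cos (@cos_max R)).
have i2 := itgM_bdd (sigma_meas_fun mG (GY _ 0 measurable_sin)) (fun w => sin_max _)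
  (iF _ c _ measurable_sin (@sin_max R)).
transitivity (Ex P (fun w => cos (t * X w + c) * cos (t * Y w + 0)) -
   Ex P (fun w => sin (t * X w + c) * sin (t * Y w + 0))).
  rewrite -ExB//; congr Ex; apply/funext => w.
  by rewrite -cosD; congr cos; ring.
rewrite e1 e2 (cnormal_Ex_cosD c (cnormalZ t cX)) (cnormal_Ex_cosD 0 (cnormalZ t cY)).
have -> : (fun w => sin (t * Y w + 0)) = (fun w => sin (t * Y w)).
  by apply/funext => w; rewrite addr0.
by rewrite (cnormal_Ex_sin (cnormalZ t cY)) cos0; ring.
Qed.

End centered_normal.

(** * Uniqueness of laws and sums of independent normal variables *)

Section characteristic_function.
Context {R : realType} {d d' : measure_display} {T : measurableType d}
  {T' : measurableType d'}.
Variables (P : probability T R) (P' : probability T' R).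

(** Replaces an inversion formula: the functions with equal expectation under the two laws contain
    all cosines of affine functions and are closed under the operations of [trigcl], so they contain
    the indicators of Borel sets. *)
Lemma law_unique (U : T -> R) (W : T' -> R) :
  measurable_fun setT U -> measurable_fun setT W ->
  (forall t c, Ex P (fun w => cos (t * U w + c)) = Ex P' (fun w => cos (t * W w + c))) ->
  forall B : set R, measurable B -> P (U @^-1` B) = P' (W @^-1` B).
Proof.
move=> mU mW UW.
pose S := [set f : R -> R | exists t, f = (fun x => t * x)].
have SS : fun_submod S.
  split; first by exists 0; apply/funext => x; rewrite mul0r.
  by move=> a _ _ [t ->] [u ->]; exists (a * t + u); apply/funext => x; ring.
have mS : fun_meas S by move=> _ [t ->]; exact: measurable_funM.
have main f : trigcl S f -> Ex P (fun w => f (U w)) = Ex P' (fun w => f (W w)).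
  elim=> [_ c [t ->]|a {}f g Sf ef Sg eg|F {}f M SF eF FM Ff]; first exact: UW.
  - have [M fM] := trigcl_bounded Sf; have [N gN] := trigcl_bounded Sg.
    have mf := trigcl_measurable mS Sf; have mg := trigcl_measurable mS Sg.
    have i1 := itg_comp_bdd P mf fM mU; have i2 := itg_comp_bdd P mg gN mU.
    have i3 := itg_comp_bdd P' mf fM mW; have i4 := itg_comp_bdd P' mg gN mW.
    rewrite !ExD ?ExZ ?ef ?eg//; exact: itgZ.
  - have mF n := trigcl_measurable mS (SF n).
    have [_ h1] := @Ex_dominated _ _ _ P (fun n w => F n (U w)) (fun w => f (U w)) _
      (itg_cst P M) (fun n => measurableT_comp (mF n) mU) (fun n w => FM n _) (fun w => Ff _).
    have [_ h2] := @Ex_dominated _ _ _ P' (fun n w => F n (W w)) (fun w => f (W w)) _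
      (itg_cst P' M) (fun n => measurableT_comp (mF n) mW) (fun n w => FM n _) (fun w => Ff _).
    move: h1; under eq_fun do rewrite eF; move=> h1.
    exact: (cvg_unique _ h1 h2).
move=> B mB.
have Sid : S id by exists 1; apply/funext => x; rewrite mul1r.
have := main _ (trigcl_preimage SS Sid mB).
have mUB : measurable (U @^-1` B) by rewrite -[_ @^-1` _]setTI; exact: mU.
have mWB : measurable (W @^-1` B) by rewrite -[_ @^-1` _]setTI; exact: mW.
by rewrite -!Ex_indic// => h; congr EFin; exact: h.
Qed.

End characteristic_function.

Section normal_convolution.
Context {R : realType}.
Local Notation gam := (std_normal R).

Lemma cnormal_std a : 0 <= a -> cnormal gam (fun z => Num.sqrt a * z) a.
Proof. by move=> a0; apply: gam_cnormal => //; exact: measurable_scale. Qed.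

Lemma product_indep d1 d2 (T1 : measurableType d1) (T2 : measurableType d2)
    (P1 : probability T1 R) (P2 : probability T2 R) (X : T1 -> R) (Z : T2 -> R)
    (PP := (P1 \x P2)%E : probability _ R) :
  measurable_fun setT X -> measurable_fun setT Z ->
  [/\ forall B, measurable B -> PP ((fun w => X w.1) @^-1` B) = P1 (X @^-1` B),
      forall B, measurable B -> PP ((fun w => Z w.2) @^-1` B) = P2 (Z @^-1` B) &
      forall B C, measurable B -> measurable C ->
        PP ((fun w => X w.1) @^-1` B `&` (fun w => Z w.2) @^-1` C) =
        (PP ((fun w => X w.1) @^-1` B) * PP ((fun w => Z w.2) @^-1` C))%E].
Proof.
move=> mX mZ.
have mpX B : measurable B -> measurable (X @^-1` B).
  by move=> mB; rewrite -[_ @^-1` _]setTI; exact: mX.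
have mpZ B : measurable B -> measurable (Z @^-1` B).
  by move=> mB; rewrite -[_ @^-1` _]setTI; exact: mZ.
have XE B : (fun w : T1 * T2 => X w.1) @^-1` B = (X @^-1` B) `*` setT.
  by apply/seteqP; split => // -[z1 z2] //= [].
have ZE B : (fun w : T1 * T2 => Z w.2) @^-1` B = setT `*` (Z @^-1` B).
  by apply/seteqP; split => // -[z1 z2] //= [].
have T1E : (P1 setT = 1)%E := probability_setT P1.
have T2E : (P2 setT = 1)%E := probability_setT P2.
have PX B : measurable B -> PP ((fun w : T1 * T2 => X w.1) @^-1` B) = P1 (X @^-1` B).
  move=> mB; rewrite XE; transitivity (P1 (X @^-1` B) * P2 setT)%E.
    by apply: product_measure1E => //; exact: mpX.
  by rewrite T2E mule1.
have PZ B : measurable B -> PP ((fun w : T1 * T2 => Z w.2) @^-1` B) = P2 (Z @^-1` B).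
  move=> mB; rewrite ZE; transitivity (P1 setT * P2 (Z @^-1` B))%E.
    by apply: product_measure1E => //; exact: mpZ.
  by rewrite T1E mul1e.
split => // B C mB mC; rewrite PX// PZ// XE ZE -setXI setTI setIT.
by apply: product_measure1E; [exact: mpX|exact: mpZ].
Qed.

(** The characteristic function of a sum of two scaled coordinates on the product space is evaluated
    twice, by independence and by [gam_conv]; no closed form of [psi] is involved. *)
Lemma psiD a b : 0 <= a -> 0 <= b -> psi (a + b) = psi a * psi b :> R.
Proof.
move=> a0 b0; pose PP : probability _ R := (gam \x gam)%E.
pose X (z : measurableTypeR R * measurableTypeR R) : R := Num.sqrt a * z.1.
pose Y (z : measurableTypeR R * measurableTypeR R) : R := Num.sqrt b * z.2.
have [PX PY XY] := product_indep gam gam (measurable_scale (Num.sqrt a))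
  (measurable_scale (Num.sqrt b)).
have mX : measurable_fun setT X by apply: measurable_funM => //; exact: measurable_fst.
have mY : measurable_fun setT Y by apply: measurable_funM => //; exact: measurable_snd.
have cX : cnormal PP X a by exact: gam_cnormal.
have cY : cnormal PP Y b by exact: gam_cnormal.
have := cnormal_sum_indep cX cY XY 1 0.
rewrite expr1n !mul1r cos0 mulr1 => <-.
have cXY : cnormal PP (fun w => X w + Y w) (a + b).
  apply: gam_cnormal; [exact: measurable_funD|exact: addr_ge0|].
  move=> B mB; have := gam_conv (sqrtr_ge0 b) mB (sqrtr_ge0 a).
  by rewrite !sqr_sqrtr//; exact.
rewrite -(cnormal_Ex_cos cXY); congr Ex; apply/funext => w.
by rewrite mul1r addr0.
Qed.

End normal_convolution.

Section normal_sum.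
Context {R : realType} {d : measure_display} {T : measurableType d}.
Variable P : probability T R.

Lemma cnormalD (X Y : T -> R) a b : cnormal P X a -> cnormal P Y b ->
  (forall B C, measurable B -> measurable C ->
    P (X @^-1` B `&` Y @^-1` C) = (P (X @^-1` B) * P (Y @^-1` C))%E) ->
  cnormal P (fun w => X w + Y w) (a + b).
Proof.
move=> cX cY XY; have a0 := cnormal_ge0 cX; have b0 := cnormal_ge0 cY.
have [mX _] := cX; have [mY _] := cY.
have mXY : measurable_fun setT (fun w => X w + Y w) by exact: measurable_funD.
apply: gam_cnormal => //; first exact: addr_ge0.
apply: law_unique => //; first exact: measurable_scale.
move=> t c; rewrite (cnormal_sum_indep cX cY XY).
have cW := cnormalZ t (cnormal_std (addr_ge0 a0 b0)).
rewrite (cnormal_Ex_cosD c cW) -(psiD (mulr_ge0 (sqr_ge0 t) a0) (mulr_ge0 (sqr_ge0 t) b0)).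
by rewrite mulrDr.
Qed.

End normal_sum.

(** * Conditional probabilities and conditional independence *)

Section conditional_probability.
Context {R : realType} {d : measure_display} {T : measurableType d}.
Variable P : probability T R.
Variable G : set (set T).
Hypothesis sG : sigma_algebra setT G.
Hypothesis mG : G `<=` measurable.

Let TG := g_sigma_algebraType G.

Let GE : <<s G >> = G.
Proof. exact: smallest_id. Qed.

(** Makes the closure properties of measurable functions available for [G], by viewing [G] as the
    measurable sets of a second structure [TG] on the sample space. *)
Lemma sub_sigma_measP (f : T -> R) :
  measurable_fun setT (f : TG -> R) <-> sigma_meas G f.
Proof.
split => [mf B mB|Gf _ B mB].
  by have := mf measurableT B mB; rewrite setTI /measurable/= GE.
by rewrite setTI /measurable/= GE; exact: Gf.
Qed.

Lemma sigma_algebra_setT : G setT.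
Proof. by have [h0 hC _] := sG; rewrite -(setD0 setT); exact: hC. Qed.

(** Radon-Nikodym on [TG]. The identity [mid] is measurable because [G] consists of events, and
    image measures under it are restrictions to [G]; the derivative is that of the restriction of
    $S\mapsto P(S\cap A)$ with respect to the restriction of $P$. *)
Lemma cond_prob_L1 (A : set T) : measurable A -> exists f : T -> R,
  [/\ sigma_meas G f, itg P f &
      forall S, G S -> Ex P (fun w => f w * \1_S w) = Ex P \1_(A `&` S)].
Proof.
move=> mA.
have mid : measurable_fun [set: T] (id : T -> TG).
  by move=> _ B; rewrite {1}/measurable/= GE preimage_id setTI; exact: mG.
pose muG0 : {measure set TG -> \bar R} := push P mid.
pose nuG0 : {measure set TG -> \bar R} := push (mrestr P mA) mid.
have muE S : measurable S -> muG0 S = P S by [].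
have nuE S : measurable S -> nuG0 S = P (S `&` A) by [].
have mS S : (measurable (S : set TG)) -> measurable (S : set T).
  by rewrite {1}/measurable/= GE; exact: mG.
have finmu : fin_num_fun muG0.
  by move=> S /mS mS'; rewrite /muG0/= /pushforward/=; exact: fin_num_measure.
have finnu : fin_num_fun nuG0.
  by move=> S /mS mS'; rewrite /nuG0/= /pushforward/mrestr/=;
    apply: fin_num_measure; exact: measurableI.
pose muG : {finite_measure set TG -> \bar R} :=
  HB.pack (Measure.sort muG0) (Measure.class muG0) (Measure_isFinite.Build _ _ _ muG0 finmu).
pose nuG : {finite_measure set TG -> \bar R} :=
  HB.pack (Measure.sort nuG0) (Measure.class nuG0) (Measure_isFinite.Build _ _ _ nuG0 finnu).
have dom : nuG `<< muG.
  apply/null_content_dominatesP => S mSS S0.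
  rewrite /= nuE; last exact: mSS.
  apply/eqP; rewrite eq_le measure_ge0 andbT -[leRHS]S0; apply: le_measure;
    rewrite ?inE; [by apply: measurableI => //; exact: mS|exact: mS|exact: subIsetl].
have f0 x : (0 <= Radon_Nikodym_SigmaFinite.f nuG muG x)%E.
  exact: Radon_Nikodym_SigmaFinite.f_ge0.
have ffin x : Radon_Nikodym_SigmaFinite.f nuG muG x \is a fin_num.
  exact: Radon_Nikodym_SigmaFinite.f_fin_num.
have fint := Radon_Nikodym_SigmaFinite.f_integrable dom.
have fE := Radon_Nikodym_SigmaFinite.f_integral dom.
move: (Radon_Nikodym_SigmaFinite.f nuG muG) f0 ffin fint fE => f f0 ffin fint fE.
pose g (w : T) : R := fine (f w).
have gE w : (g w)%:E = f w by rewrite fineK.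
have mf : measurable_fun [set: TG] f by exact: measurable_int fint.
have Gg : sigma_meas G g.
  by apply/sub_sigma_measP; apply: (measurableT_comp _ mf) => //; exact: measurable_fine.
have mg := sigma_meas_fun mG Gg.
have intg S : G S -> (\int[P]_(w in S) (g w)%:E = P (S `&` A))%E.
  move=> GS; have mSG : measurable (S : set TG) by rewrite /measurable/= GE.
  rewrite -nuE; last exact: mSG.
  rewrite [RHS](fE S mSG).
  transitivity (\int[push P mid]_(w in S) f w)%E; last first.
    exact: eq_measure_integral.
  have h := @ge0_integral_pushforward _ _ _ _ R _ mid P S f mSG (measurable_funTS mf)
    (fun y _ => f0 y).
  rewrite [RHS]h preimage_id; apply: eq_integral => w _; exact: gE.
have ig : itg P g.
  apply/integrableP; split; first exact/measurable_EFinP.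
  under eq_integral do rewrite /= ger0_norm ?fine_ge0//.
  rewrite intg; first by rewrite setTI (le_lt_trans (probability_le1 P mA))// ltry.
  exact: sigma_algebra_setT.
exists g; split => // S GS; apply: EFin_inj.
rewrite -integral_indic_Ex ?intg ?Ex_indic//; last exact: mG.
  by rewrite setIC.
by apply: measurableI => //; exact: mG.
Qed.

Lemma sigma_algebra_setI A B : G A -> G B -> G (A `&` B).
Proof.
move=> GA GB; have : measurable ((A : set TG) `&` B).
  by apply: measurableI; rewrite /measurable/= GE.
by rewrite /measurable/= GE.
Qed.

(** Turns bounds valid almost surely into bounds valid everywhere by clipping. The set [N] where
    clipping acts belongs to [G], so the defining identity on [S] met with [N] forces the clipped
    part to have integral zero. *)
Lemma cond_prob (A : set T) : measurable A -> exists f : T -> R,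
  [/\ sigma_meas G f, forall w, 0 <= f w <= 1 &
      forall S, G S -> Ex P (fun w => f w * \1_S w) = Ex P \1_(A `&` S)].
Proof.
move=> mA; have [f [Gf ifi fE]] := cond_prob_L1 mA.
have mf := sigma_meas_fun mG Gf.
pose g w := Num.max (f w) 0; pose h w := Num.min (g w) 1.
have mg : measurable_fun setT g by exact: measurable_maxr.
have Gg : sigma_meas G g.
  apply/sub_sigma_measP; apply: measurable_maxr => //.
  exact/sub_sigma_measP.
have Gh : sigma_meas G h.
  apply/sub_sigma_measP; apply: measurable_minr => //.
  exact/sub_sigma_measP.
have ig : itg P g.
  apply: (itg_le mg _ ifi) => w; rewrite /g ger0_norm ?le_max ?lexx ?orbT//.
  by rewrite ge_max ler_norm normr_ge0.
have mS S : G S -> measurable S by exact: mG.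
have gE S : G S -> Ex P (fun w => g w * \1_S w) = Ex P \1_(A `&` S).
  move=> GS; pose N := f @^-1` `]-oo, 0[%classic.
  have GN : G N by apply: Gf; exact: measurable_itv.
  have GSN := sigma_algebra_setI GS GN.
  rewrite -fE//; apply/eqP; rewrite -subr_eq0 -ExB; [|exact: itgM_indic (mS _ GS) _..].
  have e : (fun w => g w * \1_S w - f w * \1_S w) = (fun w => -1 * (f w * \1_(S `&` N) w)).
    apply/funext => w; rewrite indicI/= /g.
    rewrite !indicE; have [fw|fw] := leP 0 (f w).
      have -> : w \in N = false.
        by apply: memNset; rewrite /N/= in_itv/= => h1; lra.
      by rewrite /= !mulr0 subrr.
    have -> : w \in N by apply: mem_set; rewrite /N/= in_itv.
    by rewrite /=; ring.
  rewrite e ExZ; last by apply: itgM_indic => //; exact: mS.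
  have h1 : 0 <= Ex P (fun w => -1 * (f w * \1_(S `&` N) w)).
    apply: Ex_ge0 => w; rewrite mulN1r oppr_ge0 indicE.
    case: (boolP (w \in S `&` N)); rewrite ?mulr0// inE => -[_].
    by rewrite /N/= in_itv/= => /ltW; rewrite mulr1.
  have h2 : 0 <= Ex P (fun w => f w * \1_(S `&` N) w).
    by rewrite fE//; apply: Ex_ge0 => w; rewrite indicE.
  move: h1; rewrite ExZ; last by apply: itgM_indic => //; exact: mS.
  by move=> h1; apply/eqP; lra.
exists h; split => //.
- by move=> w; rewrite /h /g le_min ge_min lexx !orbT andbT le_max lexx orbT ler01.
- move=> S GS; pose N := g @^-1` `]1, +oo[%classic.
  have GN : G N by apply: Gg; exact: measurable_itv.
  have GSN := sigma_algebra_setI GS GN.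
  have mh := sigma_meas_fun mG Gh.
  have ih : itg P h.
    apply: (itg_le mh _ ig) => w; rewrite /h ger0_norm.
      by rewrite ge_min ler_norm.
    by rewrite le_min ler01 andbT /g le_max lexx orbT.
  rewrite -gE//; apply/eqP; rewrite eq_sym -subr_eq0 -ExB; [|exact: itgM_indic (mS _ GS) _..].
  have e : (fun w => g w * \1_S w - h w * \1_S w) =
    (fun w => g w * \1_(S `&` N) w - \1_(S `&` N) w).
    apply/funext => w; rewrite indicI/= /h.
    rewrite !indicE; have [fw|fw] := leP (g w) 1.
      have -> : w \in N = false.
        by apply: memNset; rewrite /N/= in_itv/= andbT => h1; lra.
      by rewrite /=; ring.
    have -> : w \in N by apply: mem_set; rewrite /N/= in_itv/= andbT.
    by rewrite /=; ring.
  rewrite e.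
  have h1 : 0 <= Ex P (fun w => g w * \1_(S `&` N) w - \1_(S `&` N) w).
    apply: Ex_ge0 => w; rewrite indicE.
    case: (boolP (w \in S `&` N)); rewrite ?mulr0 ?subr0// inE => -[_].
    by rewrite /N/= in_itv/= andbT mulr1; lra.
  have iSN : itg P (\1_(S `&` N)) by apply: itg_indic; exact: mS.
  have iASN : itg P (\1_(A `&` (S `&` N))) by apply: itg_indic; apply: measurableI => //; exact: mS.
  have h2 : 0 <= Ex P (fun w => \1_(S `&` N) w - \1_(A `&` (S `&` N)) w).
    apply: Ex_ge0 => w; rewrite subr_ge0 !indicE [w \in A `&` _]in_setI.
    by case: (w \in A); case: (w \in S `&` N).
  have igSN : itg P (fun w => g w * \1_(S `&` N) w) by apply: itgM_indic => //; exact: mS.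
  move: h1 h2; rewrite (ExB igSN iSN) (ExB iSN iASN).
  by rewrite gE// => h1 h2; apply/eqP; lra.
Qed.

End conditional_probability.

Section conditional_independence.
Context {R : realType} {d : measure_display} {T : measurableType d}.
Variable P : probability T R.
Variables F1 F2 G : set (set T).
Hypothesis sG : sigma_algebra setT G.
Hypothesis mG : G `<=` measurable.

Lemma cexp1_Ex (X Z : T -> R) : itg P X -> itg P Z -> sigma_meas G Z ->
  (forall S, G S -> Ex P (fun w => X w * \1_S w) = Ex P (fun w => Z w * \1_S w)) ->
  cexp1 P G X Z.
Proof.
move=> iX iZ GZ XZ; split => // S GS; have mS := mG GS.
by rewrite !integral_indic_Ex// XZ.
Qed.

Lemma Ex_cexp1 (X Z : T -> R) : cexp1 P G X Z ->
  [/\ itg P X, itg P Z, sigma_meas G Z &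
  (forall S, G S -> Ex P (fun w => X w * \1_S w) = Ex P (fun w => Z w * \1_S w))].
Proof.
move=> [iX iZ GZ XZ]; split => // S GS; have mS := mG GS; apply: EFin_inj.
by rewrite -!integral_indic_Ex// XZ.
Qed.

(** One-sided form of conditional independence: refining [G] by events of [F1] leaves the
    conditional probability of [B] unchanged. Multiplying by the conditional probability of [A] then
    gives the product version. *)
Lemma cond_indepI : F1 `<=` measurable -> F2 `<=` measurable ->
  (forall A B (pB : T -> R), F1 A -> F2 B -> sigma_meas G pB ->
    (forall w, 0 <= pB w <= 1) ->
    (forall S, G S -> Ex P (fun w => pB w * \1_S w) = Ex P \1_(B `&` S)) ->
    forall S, G S -> Ex P (fun w => (\1_B w - pB w) * \1_(A `&` S) w) = 0) ->
  cond_indep P F1 F2 G.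
Proof.
move=> mF1 mF2 H A B FA FB; have mA := mF1 _ FA; have mB := mF2 _ FB.
have [pA [GpA pA1 pAE]] := cond_prob P sG mG mA.
have [pB [GpB pB1 pBE]] := cond_prob P sG mG mB.
have mpA := sigma_meas_fun mG GpA; have mpB := sigma_meas_fun mG GpB.
have bA w : `|pA w| <= 1 by have /andP[h1 h2] := pA1 w; rewrite ger0_norm.
have bB w : `|pB w| <= 1 by have /andP[h1 h2] := pB1 w; rewrite ger0_norm.
have ipA : itg P pA by exact: itg_bdd bA.
have ipB : itg P pB by exact: itg_bdd bB.
have ipAB : itg P (pA \* pB) by apply: (itgM_bdd mpB bB ipA).
have iI S : measurable S -> itg P (\1_S) by move=> mS; exact: itg_indic.
exists pA, pB; split; apply: cexp1_Ex => //.
- exact: iI.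
- by move=> S GS; rewrite pAE//; congr Ex; apply/funext => w; rewrite indicI.
- exact: iI.
- by move=> S GS; rewrite pBE//; congr Ex; apply/funext => w; rewrite indicI.
- exact/iI/measurableI.
- exact/(sub_sigma_measP sG)/measurable_funM/(sub_sigma_measP sG)/GpB/(sub_sigma_measP sG).
- move=> S GS; have mS := mG GS.
  have e1 := H _ _ _ FA FB GpB pB1 pBE S GS.
  have mAS : measurable (A `&` S) by exact: measurableI.
  have i1 : itg P (fun w => \1_B w * \1_(A `&` S) w) by apply: itgM_indic => //; exact: iI.
  have i2 : itg P (fun w => pB w * \1_(A `&` S) w) by exact: itgM_indic.
  have e2 : Ex P (fun w => (\1_A w - pA w) * (pB w * \1_S w)) = 0.
    apply: (@Ex_mul_sigma_meas0 _ _ _ _ G) => //.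
    + by apply: itgB => //; exact: iI.
    + move=> S' GS'; have mS' := mG GS'.
      transitivity (Ex P \1_(A `&` S') - Ex P (fun w => pA w * \1_S' w)).
        rewrite -ExB; [|exact/iI/measurableI|exact: itgM_indic].
        by congr Ex; apply/funext => w; rewrite indicI/= mulrBl.
      by rewrite pAE ?subrr.
    + apply/(sub_sigma_measP sG); apply: measurable_funM.
        exact/(sub_sigma_measP sG).
      by apply: measurable_indic; rewrite /measurable/= smallest_id.
    + apply: (itgM_bdd (M := 1)).
      * by apply: measurable_funM => //; exact: measurable_indic.
      * by move=> w; rewrite normrM mulr_ile1// indic_bdd.
      * by apply: itgB => //; exact: iI.
  move: e1; rewrite (_ : (fun w => _) = (fun w => \1_B w * \1_(A `&` S) w -
     pB w * \1_(A `&` S) w)); last by apply/funext => w; rewrite mulrBl.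
  rewrite ExB// => /eqP; rewrite subr_eq0 => /eqP e1.
  transitivity (Ex P (fun w => \1_B w * \1_(A `&` S) w)).
    by congr Ex; apply/funext => w; rewrite !indicI/=; ring.
  rewrite e1; apply/eqP; rewrite -subr_eq0 -ExB//; last exact: itgM_indic.
  apply/eqP; rewrite -[RHS]e2; congr Ex; apply/funext => w.
  by rewrite indicI/=; ring.
Qed.

End conditional_independence.

(** * Second moments and linear spaces of variables *)

Section square_integrable.
Context {R : realType} {d : measure_display} {T : measurableType d}.
Variable P : probability T R.
Implicit Types (X Y Z : T -> R).

Definition L2 X := measurable_fun setT X /\ itg P (fun w => X w ^+ 2).

Definition ip X Y := Ex P (fun w => X w * Y w).

Lemma L2_itgM X Y : L2 X -> L2 Y -> itg P (fun w => X w * Y w).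
Proof.
move=> [mX iX] [mY iY].
apply: (@itg_le _ _ _ P _ (fun w => X w ^+ 2 + Y w ^+ 2)); last exact: itgD.
  exact: measurable_funM.
move=> w; rewrite [leRHS]ger0_norm ?addr_ge0 ?sqr_ge0// ler_norml.
have := sqr_ge0 (X w + Y w); have := sqr_ge0 (X w - Y w).
have := sqr_ge0 (X w); have := sqr_ge0 (Y w).
by move=> *; apply/andP; split; lra.
Qed.

Lemma L2_cst c : L2 (fun=> c).
Proof. by split => //; exact: itg_cst. Qed.

Lemma L2_itg X : L2 X -> itg P X.
Proof.
move=> LX; have := L2_itgM LX (L2_cst 1).
by congr itg; apply/funext => w; rewrite mulr1.
Qed.

Lemma L2_lin a X Y : L2 X -> L2 Y -> L2 (fun w => a * X w + Y w).
Proof.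
move=> LX LY; have [mX iX] := LX; have [mY iY] := LY; split.
  by apply: measurable_funD => //; exact: measurable_funM.
rewrite (_ : (fun w => _) = (fun w => a ^+ 2 * X w ^+ 2 +
   ((2 * a) * (X w * Y w) + Y w ^+ 2))); last by apply/funext => w; ring.
apply: itgD; first exact: itgZ.
by apply: itgD => //; apply: itgZ; exact: L2_itgM.
Qed.

Lemma L2D X Y : L2 X -> L2 Y -> L2 (fun w => X w + Y w).
Proof.
move=> LX LY; have := L2_lin 1 LX LY.
by congr L2; apply/funext => w; rewrite mul1r.
Qed.

Lemma L2Z a X : L2 X -> L2 (fun w => a * X w).
Proof.
move=> LX; have := L2_lin a LX (L2_cst 0).
by congr L2; apply/funext => w; rewrite addr0.
Qed.

Lemma L2B X Y : L2 X -> L2 Y -> L2 (fun w => X w - Y w).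
Proof.
move=> LX LY; have := L2_lin (-1) LY LX.
by congr L2; apply/funext => w; ring.
Qed.

Lemma L2_sum (I : Type) (s : seq I) (F : I -> T -> R) :
  (forall i, L2 (F i)) -> L2 (fun w => \sum_(i <- s) F i w).
Proof.
move=> LF; elim: s => [|i s ih].
  by under eq_fun do rewrite big_nil; exact: L2_cst.
by under eq_fun do rewrite big_cons; exact: L2D.
Qed.

Lemma ipC X Y : ip X Y = ip Y X.
Proof. by congr Ex; apply/funext => w; rewrite mulrC. Qed.

Lemma ipDl X Y Z : L2 X -> L2 Y -> L2 Z -> ip (fun w => X w + Y w) Z = ip X Z + ip Y Z.
Proof.
move=> LX LY LZ; rewrite -ExD; [|exact: L2_itgM..].
by congr Ex; apply/funext => w; rewrite mulrDl.
Qed.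

Lemma ipBl X Y Z : L2 X -> L2 Y -> L2 Z -> ip (fun w => X w - Y w) Z = ip X Z - ip Y Z.
Proof.
move=> LX LY LZ; rewrite -ExB; [|exact: L2_itgM..].
by congr Ex; apply/funext => w; rewrite mulrBl.
Qed.

Lemma ipZl a X Z : L2 X -> L2 Z -> ip (fun w => a * X w) Z = a * ip X Z.
Proof.
move=> LX LZ; rewrite -ExZ; last exact: L2_itgM.
by congr Ex; apply/funext => w; rewrite mulrA.
Qed.

Lemma ip0l Z : ip (fun=> 0) Z = 0.
Proof. by rewrite -[RHS](Ex_cst P 0); congr Ex; apply/funext => w; rewrite mul0r. Qed.

Lemma ip_suml (I : Type) (s : seq I) (F : I -> T -> R) Z :
  (forall i, L2 (F i)) -> L2 Z ->
  ip (fun w => \sum_(i <- s) F i w) Z = \sum_(i <- s) ip (F i) Z.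
Proof.
move=> LF LZ; rewrite -Ex_sum; last by move=> i; exact: L2_itgM.
by congr Ex; apply/funext => w; rewrite mulr_suml.
Qed.

Lemma ipDr X Y Z : L2 X -> L2 Y -> L2 Z -> ip Z (fun w => X w + Y w) = ip Z X + ip Z Y.
Proof. by move=> LX LY LZ; rewrite ipC ipDl// !(ipC Z). Qed.

Lemma ipBr X Y Z : L2 X -> L2 Y -> L2 Z -> ip Z (fun w => X w - Y w) = ip Z X - ip Z Y.
Proof. by move=> LX LY LZ; rewrite ipC ipBl// !(ipC Z). Qed.

Lemma ipZr a X Z : L2 X -> L2 Z -> ip Z (fun w => a * X w) = a * ip Z X.
Proof. by move=> LX LZ; rewrite ipC ipZl// ipC. Qed.

Lemma ip_sumr (I : Type) (s : seq I) (F : I -> T -> R) Z :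
  (forall i, L2 (F i)) -> L2 Z ->
  ip Z (fun w => \sum_(i <- s) F i w) = \sum_(i <- s) ip Z (F i).
Proof. by move=> LF LZ; rewrite ipC ip_suml//; apply: eq_bigr => i _; rewrite ipC. Qed.

Lemma ip_ge0 X : 0 <= ip X X.
Proof. by apply: Ex_ge0 => w; rewrite -expr2 sqr_ge0. Qed.

(** [ip] is only semidefinite, so projections need this degenerate case of Cauchy-Schwarz. A
    nonnegative quadratic in $t$ without constant term is evaluated at $-c/(k+1)$; the added 1
    covers the case $k=0$. *)
Lemma ip_self0 X Y : L2 X -> L2 Y -> ip Y Y = 0 -> ip X Y = 0.
Proof.
move=> LX LY Y0.
have q t : 0 <= 2 * t * ip X Y + t ^+ 2 * ip X X.
  have LtX := L2Z t LX.
  have := ip_ge0 (fun w => t * X w + Y w).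
  rewrite ipDl//; last exact: L2D.
  rewrite ipDr// ipDr// Y0 !ipZl ?ipZr// (ipC Y X).
  lra.
pose c := ip X Y; pose k := ip X X.
have k0 : 0 <= k by exact: ip_ge0.
have := q (- c / (k + 1)); rewrite -/c -/k => h.
have k1 : 0 < k + 1 by lra.
have e : 2 * (- c / (k + 1)) * c + (- c / (k + 1)) ^+ 2 * k =
  - (c ^+ 2 * (k + 2)) / (k + 1) ^+ 2 by field; lra.
move: h; rewrite e pmulr_lge0 ?invr_gt0 ?exprn_gt0// oppr_ge0 pmulr_lle0; last by lra.
by move=> h; apply/eqP; rewrite -sqrf_eq0 eq_le h sqr_ge0.
Qed.

End square_integrable.

Section submodules.
Context {R : realType} {T : Type}.
Implicit Types (S : set (T -> R)) (U V : T -> R).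

Lemma submod_sum S (I : eqType) (s : seq I) (F : I -> T -> R) :
  fun_submod S -> (forall i, i \in s -> S (F i)) -> S (fun w => \sum_(i <- s) F i w).
Proof.
move=> SS; elim: s => [|i s ih] SF.
  by under eq_fun do rewrite big_nil; exact: submod0.
under eq_fun do rewrite big_cons; apply: submodD => //.
  by apply: SF; rewrite mem_head.
by apply: ih => j js; apply: SF; rewrite in_cons js orbT.
Qed.

Definition add_submod S1 S2 : set (T -> R) :=
  [set f | exists U V, [/\ S1 U, S2 V & f = (fun w => U w + V w)]].

Lemma add_submodP S1 S2 : fun_submod S1 -> fun_submod S2 -> fun_submod (add_submod S1 S2).
Proof.
move=> h1 h2; split.
  exists (fun=> 0), (fun=> 0); split; [exact: submod0|exact: submod0|].
  by apply/funext => w; rewrite addr0.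
move=> a _ _ [U [V [SU SV ->]]] [U' [V' [SU' SV' ->]]].
exists (fun w => a * U w + U' w), (fun w => a * V w + V' w); split.
- exact: h1.2.
- exact: h2.2.
- by apply/funext => w; ring.
Qed.

Lemma sub_add_submodl S1 S2 : fun_submod S2 -> S1 `<=` add_submod S1 S2.
Proof.
move=> h2 U SU; exists U, (fun=> 0); split => //; first exact: submod0.
by apply/funext => w; rewrite addr0.
Qed.

Lemma sub_add_submodr S1 S2 : fun_submod S1 -> S2 `<=` add_submod S1 S2.
Proof.
move=> h2 U SU; exists (fun=> 0), U; split => //; first exact: submod0.
by apply/funext => w; rewrite add0r.
Qed.

Definition line U : set (T -> R) := [set f | exists a, f = (fun w => a * U w)].

Lemma lineP U : fun_submod (line U).
Proof.
split; first by exists 0; apply/funext => w; rewrite mul0r.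
by move=> a _ _ [b ->] [c ->]; exists (a * b + c); apply/funext => w; ring.
Qed.

Lemma line_id U : line U U.
Proof. by exists 1; apply/funext => w; rewrite mul1r. Qed.

Lemma sigma_funS S1 S2 : S1 `<=` S2 -> sigma_fun S1 `<=` sigma_fun S2.
Proof.
move=> S12; apply: sub_smallest2r => // _ [U [B [SU mB ->]]].
by exists U, B; split => //; exact: S12.
Qed.

End submodules.

Section sigma_of_functions.
Context {R : realType} {d : measure_display} {T : measurableType d}.

Lemma sigma_fun_algebra (S : set (T -> R)) : sigma_algebra setT (sigma_fun S).
Proof. exact: smallest_sigma_algebra. Qed.

Lemma sigma_fun_meas (S : set (T -> R)) U : S U -> sigma_meas (sigma_fun S) U.
Proof. by move=> SU B mB; apply: sub_gen_smallest; exists U, B. Qed.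

Lemma sigma_meas_comp (G : set (set T)) (f : R -> R) U : measurable_fun setT f ->
  sigma_meas G U -> sigma_meas G (fun w => f (U w)).
Proof.
move=> mf GU B mB; have mfB : measurable (f @^-1` B).
  by rewrite -[_ @^-1` _]setTI; exact: mf.
exact: (GU _ mfB).
Qed.

End sigma_of_functions.

(** * Gaussian spaces *)

Section gaussian_space.
Context {R : realType} {d : measure_display} {T : measurableType d}.
Variable P : probability T R.
Implicit Types (S V : set (T -> R)) (X Y U : T -> R).

(** Closure under linear combinations is what makes finitely many members jointly Gaussian. *)
Definition gspace V := fun_submod V /\ forall X, V X -> exists s2, cnormal P X s2.

Lemma cnormal_L2 X s2 : cnormal P X s2 -> L2 P X.
Proof. by move=> cX; split; [case: cX|exact: (cnormal_sqr cX).1]. Qed.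

Lemma cnormal_ip X s2 : cnormal P X s2 -> ip P X X = kappa * s2.
Proof. by move=> cX; rewrite -(cnormal_sqr cX).2; congr Ex; apply/funext => w; rewrite expr2. Qed.

Lemma cnormal_var X s2 : cnormal P X s2 -> s2 = ip P X X / kappa.
Proof. by move=> /cnormal_ip ->; rewrite mulrAC divff ?mul1r// gt_eqF// kappa_gt0. Qed.

Lemma cnormal_Ex0 X s2 : cnormal P X s2 -> Ex P X = 0.
Proof.
move=> cX; have mid : measurable_fun [set: R] (id : R -> R) by [].
have iz : itg (std_normal R) (fun z => Num.sqrt s2 * z).
  have L2id : L2 (std_normal R) (fun z : measurableTypeR R => z).
    by split => //; exact: itg_std_normal_sqr.
  exact: itgZ (L2_itg L2id).
have [iX eX] := cnormal_itg cX mid iz.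
have cNX := cnormalZ (-1) cX; rewrite sqrrN expr1n mul1r in cNX.
have [_] := cnormal_itg cNX mid iz; rewrite -eX ExZ//.
by move=> h; lra.
Qed.

Variables (V : set (T -> R)) (gV : gspace V).

Lemma gspaceP X : V X -> cnormal P X (ip P X X / kappa).
Proof. by move=> /gV.2[s2 cX]; rewrite -(cnormal_var cX). Qed.

Lemma gspace_L2 X : V X -> L2 P X.
Proof. by move=> /gspaceP/cnormal_L2. Qed.

Lemma gspace_meas S : S `<=` V -> fun_meas S.
Proof. by move=> SV X /SV/gspaceP[]. Qed.

(** Orthogonality gives [X + Y] and [X - Y] the same variance, so the product-to-sum formula and
    [psiD] factor the expectation of two cosines. Cosines are then exchanged for events on one side
    at a time. *)
Lemma gspace_indep S1 S2 : fun_submod S1 -> fun_submod S2 -> S1 `<=` V -> S2 `<=` V ->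
  (forall X Y, S1 X -> S2 Y -> ip P X Y = 0) ->
  indep2 P (sigma_fun S1) (sigma_fun S2).
Proof.
move=> sm1 sm2 S1V S2V orth A B FA GB.
have mS1 := gspace_meas S1V; have mS2 := gspace_meas S2V.
have mA := sigma_fun_measurable mS1 FA; have mB := sigma_fun_measurable mS2 GB.
have icos X c : V X -> itg P (fun w => cos (X w + c)).
  move=> VX; apply: (itg_comp_bdd P (measurable_cos (R := R)) (@cos_max R)).
  by apply: measurable_funD => //; case: (gspace_L2 VX).
have bcos X c w : `|cos ((X w : R) + c)| <= 1 by exact: cos_max.
have main X Y a b : S1 X -> S2 Y ->
    Ex P (fun w => cos (X w + a) * cos (Y w + b)) =
    Ex P (fun w => cos (X w + a)) * Ex P (fun w => cos (Y w + b)).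
  move=> SX SY; have VX := S1V _ SX; have VY := S2V _ SY.
  have LX := gspace_L2 VX; have LY := gspace_L2 VY.
  have VD : V (fun w => X w + Y w) by apply: submodD => //; case: gV.
  have VB : V (fun w => X w - Y w) by apply: submodB => //; case: gV.
  rewrite (cnormal_Ex_cosD a (gspaceP VX)) (cnormal_Ex_cosD b (gspaceP VY)).
  transitivity (2^-1 * Ex P (fun w => cos (X w + Y w + (a + b))) +
     2^-1 * Ex P (fun w => cos (X w - Y w + (a - b)))).
    rewrite -!ExZ; [|exact: (icos _ _ VB)|exact: (icos _ _ VD)].
    rewrite -ExD; [|exact/itgZ/(icos _ _ VD)|exact/itgZ/(icos _ _ VB)].
    congr Ex; apply/funext => w.
    rewrite (_ : X w + Y w + (a + b) = (X w + a) + (Y w + b)); last by ring.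
    rewrite (_ : X w - Y w + (a - b) = (X w + a) - (Y w + b)); last by ring.
    by move: (X w + a) (Y w + b) => u v; rewrite cosD cosB; field.
  rewrite (cnormal_Ex_cosD _ (gspaceP VD)) (cnormal_Ex_cosD _ (gspaceP VB)).
  have e1 : ip P (fun w => X w + Y w) (fun w => X w + Y w) = ip P X X + ip P Y Y.
    rewrite (ipDl LX LY (L2D LX LY)) (ipDr LX LY LX) (ipDr LX LY LY).
    by rewrite (ipC P Y X) (orth _ _ SX SY) addr0 add0r.
  have e2 : ip P (fun w => X w - Y w) (fun w => X w - Y w) = ip P X X + ip P Y Y.
    rewrite (ipBl LX LY (L2B LX LY)) (ipBr LX LY LX) (ipBr LX LY LY).
    by rewrite (ipC P Y X) (orth _ _ SX SY) subr0 sub0r opprK.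
  rewrite e1 e2 mulrDl psiD ?divr_ge0 ?ip_ge0 ?(ltW (kappa_gt0 R))//.
  by rewrite cosD cosB; field.
have step1 X a : S1 X -> Ex P (fun w => (\1_B w - Ex P \1_B) * cos (X w + a)) = 0.
  move=> SX; have VX := S1V _ SX.
  have ih : itg P (fun w => cos (X w + a) - Ex P (fun w => cos (X w + a))).
    by apply: itgB; [exact: icos|exact: itg_cst].
  have h0 Y b : S2 Y -> Ex P (fun w => (cos (X w + a) - Ex P (fun w => cos (X w + a))) *
      cos (Y w + b)) = 0.
    move=> SY; have VY := S2V _ SY.
    transitivity (Ex P (fun w => cos (X w + a) * cos (Y w + b)) -
       Ex P (fun w => cos (X w + a)) * Ex P (fun w => cos (Y w + b))).
      rewrite -ExZ; last exact: icos.
      rewrite -ExB; last 2 first.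
      - apply: (itgM_bdd (M := 1) _ _ (icos _ _ VX)) => //.
        exact: itg_meas (icos _ b VY).
      - by apply: itgZ; exact: icos.
      by congr Ex; apply/funext => w; rewrite mulrBl.
    by rewrite main// subrr.
  have e := Ex_mul_sigma_fun0 sm2 mS2 ih h0 GB.
  transitivity (Ex P (fun w => cos (X w + a) * \1_B w) -
      Ex P \1_B * Ex P (fun w => cos (X w + a))).
    rewrite -ExZ; last exact: icos.
    rewrite -ExB; last 2 first.
    - by apply: itgM_indic => //; exact: icos.
    - by apply: itgZ; exact: icos.
    by congr Ex; apply/funext => w; ring.
  rewrite -[RHS]e mulrC -ExZ; last exact: itg_indic.
  rewrite -ExB; last 2 first.
  - by apply: itgM_indic => //; exact: icos.
  - by apply: itgZ; exact: itg_indic.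
  by congr Ex; apply/funext => w; ring.
have ih : itg P (fun w => \1_B w - Ex P \1_B).
  by apply: itgB; [exact: itg_indic|exact: itg_cst].
have e := Ex_mul_sigma_fun0 sm1 mS1 ih step1 FA.
have mAB : measurable (A `&` B) by exact: measurableI.
rewrite -!Ex_indic// -EFinM; congr EFin; apply/eqP.
rewrite -subr_eq0 mulrC -ExZ; last exact: itg_indic.
rewrite -ExB; [|exact: itg_indic|by apply: itgZ; exact: itg_indic].
apply/eqP; rewrite -[RHS]e; congr Ex; apply/funext => w.
by rewrite indicI/=; ring.
Qed.

(** The part [v] of [U] is independent of everything generated by [S2] and [S0] together, so the
    addition formula isolates it as a factor; what remains is [h], of conditional mean zero given
    [S0], times an [S0]-measurable function. Cosines over the sum of [S1] and [S0] are tested, so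
    that [A] and the conditioning event are reached at once. *)
Lemma gspace_cond_indep (F1 F2 : set (set T)) S0 S1 S2 :
  fun_submod S0 -> fun_submod S1 -> fun_submod S2 ->
  S0 `<=` V -> S1 `<=` V -> S2 `<=` V ->
  (forall U, S1 U -> exists t v, [/\ S0 t, V v, U = (fun w => t w + v w),
     forall X, S0 X -> ip P v X = 0 & forall X, S2 X -> ip P v X = 0]) ->
  F1 `<=` sigma_fun S1 -> F2 `<=` sigma_fun S2 ->
  cond_indep P F1 F2 (sigma_fun S0).
Proof.
move=> sm0 sm1 sm2 S0V S1V S2V dec F1S F2S.
have mS0 := gspace_meas S0V; have mS1 := gspace_meas S1V; have mS2 := gspace_meas S2V.
have mG := sigma_fun_measurable mS0.
have sG := sigma_fun_algebra S0.
apply: cond_indepI => //.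
- by move=> A /F1S; exact: sigma_fun_measurable.
- by move=> A /F2S; exact: sigma_fun_measurable.
move=> A B pB /F1S FA /F2S FB GpB pB1 pBE D0 GS.
have mA := sigma_fun_measurable mS1 FA; have mB := sigma_fun_measurable mS2 FB.
have mpB := sigma_meas_fun mG GpB.
pose h w := \1_B w - pB w.
have mh : measurable_fun setT h by apply: measurable_funB => //; exact: measurable_indic.
have h1 w : `|h w| <= 1.
  have /andP[p0 p1] := pB1 w; rewrite /h indicE ler_norml.
  by case: (w \in B) => /=; apply/andP; split; lra.
have ih : itg P h by exact: itg_bdd h1.
have bB w : `|pB w| <= 1 by have /andP[p0 p1] := pB1 w; rewrite ger0_norm.
have ipB : itg P pB by exact: itg_bdd bB.
have hG D : sigma_fun S0 D -> Ex P (fun w => h w * \1_D w) = 0.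
  move=> GD; have mD := mG _ GD.
  transitivity (Ex P \1_(B `&` D) - Ex P (fun w => pB w * \1_D w)).
    rewrite -ExB; [|by apply: itg_indic; exact: measurableI|exact: itgM_indic].
    by congr Ex; apply/funext => w; rewrite /h indicI/=; ring.
  by rewrite pBE// subrr.
have sm20 := add_submodP sm2 sm0.
have S20V : add_submod S2 S0 `<=` V.
  by move=> _ [U [W [SU SW ->]]]; apply: submodD; [case: gV|exact: S2V|exact: S0V].
have sm10 := add_submodP sm1 sm0.
have S10V : add_submod S1 S0 `<=` V.
  by move=> _ [U [W [SU SW ->]]]; apply: submodD; [case: gV|exact: S1V|exact: S0V].
have mS20 := gspace_meas S20V.
have cosm : measurable_fun [set: R] (@cos R) := measurable_cos (R := R).
have sinm : measurable_fun [set: R] (@sin R) := measurable_sin (R := R).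
have h0 W c : add_submod S1 S0 W -> Ex P (fun w => h w * cos (W w + c)) = 0.
  move=> [U [t' [SU St' ->]]]; have [t [v [St Vv -> orth0 orth2]]] := dec _ SU.
  have Su : S0 (fun w => t w + t' w) by exact: submodD.
  have lV : line v `<=` V by move=> _ [a ->]; apply: submodZ => //; case: gV.
  have ind : indep2 P (sigma_fun (add_submod S2 S0)) (sigma_fun (line v)).
    apply: gspace_indep => //; first exact: lineP.
    move=> _ _ [X [Y [SX SY ->]]] [a ->].
    have Lv := gspace_L2 Vv; have LX := gspace_L2 (S2V _ SX); have LY := gspace_L2 (S0V _ SY).
    have LXY := L2D LX LY.
    by rewrite ipZr// ipDl// !(ipC P _ v) orth2// orth0// addr0 mulr0.
  have Gu (f : R -> R) : measurable_fun setT f ->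
      sigma_meas (sigma_fun S0) (fun w => f (t w + t' w + c)).
    move=> mf; have mfc : measurable_fun [set: R] (fun x => f (x + c)).
      by apply: (measurableT_comp mf); exact: measurable_funD.
    exact: (sigma_meas_comp mfc (sigma_fun_meas Su)).
  have FG (f : R -> R) (g : R -> R) : measurable_fun setT f -> measurable_fun setT g ->
      (forall x, `|f x| <= 1) -> (forall x, `|g x| <= 1) ->
      Ex P (fun w => h w * f (t w + t' w + c) * g (v w)) = 0.
    move=> mf mg f1 g1.
    have if1 : itg P (fun w => h w * f (t w + t' w + c)).
      by apply: (itgM_bdd (M := 1)) => //; exact: sigma_meas_fun mG (Gu _ mf).
    have -> := Ex_indep (sigma_fun_measurable mS20)
      (sigma_fun_measurable (gspace_meas lV)) ind (X := fun w => h w * f (t w + t' w + c))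
      (Y := fun w => g (v w)) (M := 1) _ _ if1 (fun w => g1 (v w)); last first.
    - by apply: sigma_meas_comp => //; apply: sigma_fun_meas; exact: line_id.
    - have sg20 := sigma_fun_algebra (add_submod S2 S0).
      apply/(sub_sigma_measP sg20); apply: measurable_funM.
        apply: measurable_funB.
          apply: measurable_indic; rewrite /measurable/= smallest_id//.
          by apply: sigma_funS FB; exact: sub_add_submodl.
        apply/(sub_sigma_measP sg20) => D mD; apply: (sigma_funS (S1 := S0)).
          exact: sub_add_submodr.
        exact: GpB.
      apply/(sub_sigma_measP sg20) => D mD; apply: (sigma_funS (S1 := S0)).
        exact: sub_add_submodr.
      exact: Gu.
    have -> : Ex P (fun w => h w * f (t w + t' w + c)) = 0; last by rewrite mul0r.
    apply: (@Ex_mul_sigma_meas0 _ _ _ _ (sigma_fun S0)) => //; exact: Gu.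
  have i1 (f : R -> R) (g : R -> R) : measurable_fun setT f -> measurable_fun setT g ->
      (forall x, `|f x| <= 1) -> (forall x, `|g x| <= 1) ->
      itg P (fun w => h w * f (t w + t' w + c) * g (v w)).
    move=> mf mg f1 g1; apply: (itgM_bdd (M := 1)) => //.
      by apply: (measurableT_comp mg); case: (gspace_L2 Vv).
    by apply: (itgM_bdd (M := 1)) => //; exact: sigma_meas_fun mG (Gu _ mf).
  have e1 := FG _ _ cosm cosm (@cos_max R) (@cos_max R).
  have e2 := FG _ _ sinm sinm (@sin_max R) (@sin_max R).
  transitivity (Ex P (fun w => h w * cos (t w + t' w + c) * cos (v w)) -
     Ex P (fun w => h w * sin (t w + t' w + c) * sin (v w))); last by rewrite e1 e2 subrr.
  rewrite -ExB; [|exact: (i1 _ _ cosm cosm (@cos_max R) (@cos_max R))|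
                  exact: (i1 _ _ sinm sinm (@sin_max R) (@sin_max R))].
  congr Ex; apply/funext => w.
  rewrite (_ : t w + v w + t' w + c = (t w + t' w + c) + v w); last by ring.
  by move: (t w + t' w + c) (v w) => a b; rewrite cosD; ring.
apply: (Ex_mul_sigma_fun0 sm10 (gspace_meas S10V) ih h0).
apply: (sigma_algebra_setI (sigma_fun_algebra _)).
- by apply: sigma_funS FA; exact: sub_add_submodl.
- by apply: sigma_funS GS; exact: sub_add_submodr.
Qed.

End gaussian_space.

(** * Orthogonal projection and adjunction of noise *)

Section projection.
Context {R : realType} {d : measure_display} {T : measurableType d}.
Variable P : probability T R.

Definition lcomb {U : Type} {I : Type} (s : seq I) (c : I -> R) (V : I -> U -> R) : U -> R :=
  fun w => \sum_(i <- s) c i * V i w.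

Lemma L2_lcomb (I : Type) (s : seq I) c (V : I -> T -> R) :
  (forall i, L2 P (V i)) -> L2 P (lcomb s c V).
Proof. by move=> LV; apply: L2_sum => i; exact: L2Z. Qed.

Lemma ip_lcombr (I : eqType) (s : seq I) c (V : I -> T -> R) X :
  (forall i, L2 P (V i)) -> L2 P X -> (forall i, i \in s -> ip P X (V i) = 0) ->
  ip P X (lcomb s c V) = 0.
Proof.
move=> LV LX X0; rewrite ip_sumr//; last by move=> i; exact: L2Z.
by rewrite big_seq big1// => i si; rewrite ipZr// X0// mulr0.
Qed.

(** Gram-Schmidt for a family that may be linearly dependent: the projection on the tail is
    corrected along the residual [r0] of the new vector. *)
Lemma projection_exists (I : eqType) (s : seq I) (V : I -> T -> R) X :
  uniq s -> (forall i, L2 P (V i)) -> L2 P X ->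
  exists c : I -> R, forall j, j \in s -> ip P (fun w => X w - lcomb s c V w) (V j) = 0.
Proof.
move=> + LV; elim: s X => [|i0 s ih] X; first by exists (fun=> 0).
move=> /= /andP[i0s us] LX.
have [c Hc] := ih _ us LX; have [c0 Hc0] := ih _ us (LV i0).
pose p := lcomb s c V; pose p0 := lcomb s c0 V; pose r0 w := V i0 w - p0 w.
have Lp : L2 P p by exact: L2_lcomb.
have Lp0 : L2 P p0 by exact: L2_lcomb.
have Lr0 : L2 P r0 by exact: L2B.
(* If [r0] has norm zero, any value of [a] does: [X] is then orthogonal to [r0] by [ip_self0]. *)
pose a := ip P X r0 / ip P r0 r0.
have aE : ip P X r0 - a * ip P r0 r0 = 0.
  have [r00|r00] := eqVneq (ip P r0 r0) 0; last by rewrite /a divfK// subrr.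
  by rewrite r00 mulr0 subr0 ip_self0.
pose c' j := if j == i0 then a else c j - a * c0 j.
have c'E w : lcomb (i0 :: s) c' V w = p w + a * r0 w.
  rewrite /lcomb big_cons /c' eqxx /r0 mulrBr /p0 /p /lcomb mulr_sumr.
  rewrite (eq_big_seq (fun j => c j * V j w - a * (c0 j * V j w))); last first.
    move=> j js; rewrite ifF; first by rewrite mulrBl mulrA.
    by apply/negbTE/eqP => ji; rewrite -ji js in i0s.
  by rewrite sumrB; ring.
have Lar : L2 P (fun w => a * r0 w) by exact: L2Z.
have Lq : L2 P (fun w => (X w - p w) - a * r0 w) by apply: L2B => //; exact: L2B.
exists c' => j.
have -> : (fun w => X w - lcomb (i0 :: s) c' V w) = (fun w => (X w - p w) - a * r0 w).
  by apply/funext => w; rewrite c'E; ring.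
have orth k : k \in s -> ip P (fun w => (X w - p w) - a * r0 w) (V k) = 0.
  by move=> ks; rewrite ipBl ?ipZl// ?Hc// ?Hc0// ?mulr0 ?subr0//; exact: L2B.
rewrite in_cons => /predU1P[->|]; last exact: orth.
have -> : V i0 = (fun w => r0 w + p0 w) by apply/funext => w; rewrite /r0 subrK.
rewrite ipDr// (ip_lcombr c0 LV Lq orth) addr0.
rewrite ipBl ?ipZl//; last exact: L2B.
rewrite ipBl// (ipC P p) (ip_lcombr c LV Lr0 Hc0).
by rewrite subr0.
Qed.

End projection.

Section noise_extension.
Context {R : realType}.

Lemma cnormal_prod d1 d2 (T1 : measurableType d1) (T2 : measurableType d2)
    (P1 : probability T1 R) (P2 : probability T2 R) (X : T1 -> R) (Z : T2 -> R) a b :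
  cnormal P1 X a -> cnormal P2 Z b ->
  cnormal ((P1 \x P2)%E : probability _ R) (fun w => X w.1 + Z w.2) (a + b).
Proof.
move=> cX cZ; pose PP : probability _ R := (P1 \x P2)%E; rewrite -/PP.
have [mX [a0 _]] := cX; have [mZ [b0 _]] := cZ.
have [PX PZ XZ] := product_indep P1 P2 mX mZ.
apply: cnormalD.
- apply: gam_cnormal => //; first by apply: measurableT_comp => //; exact: measurable_fst.
  by move=> B mB; rewrite [LHS]PX//; exact: cnormal_gam.
- apply: gam_cnormal => //; first by apply: measurableT_comp => //; exact: measurable_snd.
  by move=> B mB; rewrite [LHS]PZ//; exact: cnormal_gam.
- exact: XZ.
Qed.

(* Gram-Schmidt in reverse: each step adjoins one independent normal variable whose
   variance is that of the residual of V i0 on the span of the V i, i in s. *)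
Lemma noise_extension d (T : measurableType d) (P : probability T R)
    (V0 : set (T -> R)) (I : eqType) (s : seq I) (V : I -> T -> R) :
  uniq s -> (forall i, L2 P (V i)) -> gspace P V0 ->
  exists d' (T' : measurableType d') (P' : probability T' R) (proj : T' -> T)
    (v : I -> T' -> R),
    [/\ measurable_fun setT proj,
        forall A, measurable A -> P' (proj @^-1` A) = P A &
        forall X (c : I -> R), V0 X ->
          cnormal P' (fun w => X (proj w) + lcomb s c v w)
            ((ip P X X + ip P (lcomb s c V) (lcomb s c V)) / kappa)].
Proof.
move=> + LV gV; elim: s => [_|i0 s ih /= /andP[i0s us]].
  exists d, T, P, id, (fun _ _ => 0); split => // X c VX.
  rewrite (_ : (fun w => _) = X); last by apply/funext => w; rewrite /lcomb big_nil addr0.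
  rewrite (_ : lcomb [::] c V = fun=> 0); last by apply/funext => w; rewrite /lcomb big_nil.
  by rewrite ip0l addr0; exact: gspaceP gV _ VX.
have [d1 [T1 [P1 [proj1 [v1 [mproj1 P1E cn]]]]]] := ih us.
have [c0 Hc0] := projection_exists us LV (LV i0).
pose r0 w := V i0 w - lcomb s c0 V w.
have Lr0 : L2 P r0 by apply: L2B => //; exact: L2_lcomb.
pose s2 : R := ip P r0 r0 / kappa.
have s20 : 0 <= s2 by rewrite divr_ge0 ?ip_ge0// ltW// kappa_gt0.
pose sg := Num.sqrt s2.
pose PP : probability _ R := (P1 \x std_normal R)%E.
pose v (i : I) (w : T1 * measurableTypeR R) : R :=
  if i == i0 then lcomb s c0 v1 w.1 + sg * w.2 else v1 i w.1.
exists _, _, PP, (fun w => proj1 w.1), v; split.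
- by apply: (measurableT_comp mproj1); exact: measurable_fst.
- move=> A mA; rewrite (_ : _ @^-1` A = (proj1 @^-1` A) `*` setT); last first.
    by apply/seteqP; split => // -[z1 z2] //= [].
  transitivity (P1 (proj1 @^-1` A) * std_normal R setT)%E.
    by apply: product_measure1E => //; rewrite -[_ @^-1` _]setTI; exact: mproj1.
  by rewrite P1E// (_ : std_normal R setT = 1%E) ?mule1//; exact: (probability_setT (std_normal R)).
(* Writing [V i0] as its projection plus [r0], [c1] collects the coefficients on [s]. The same
   elimination applies to [v], with the new coordinate scaled by [sg] in place of [r0]; the two last
   summands have matching variances. *)
- move=> X c VX; pose c1 j := c j + c i0 * c0 j.
  have key (U : Type) (u : I -> U -> R) w :
      c i0 * (lcomb s c0 u w) + lcomb s c u w = lcomb s c1 u w.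
    rewrite /lcomb mulr_sumr -big_split/=; apply: eq_bigr => j _.
    by rewrite /c1; ring.
  have csum (U : Type) (u u' : I -> U -> R) w : (forall j, j \in s -> u j w = u' j w) ->
      lcomb s c u w = lcomb s c u' w.
    by move=> uu; rewrite /lcomb; apply: eq_big_seq => j js; rewrite uu.
  have := cnormal_prod (cn X c1 VX) (cnormalZ (c i0) (cnormal_std s20)).
  rewrite (_ : (fun w => _) = (fun w => X (proj1 w.1) + lcomb (i0 :: s) c v w)); last first.
    apply/funext => w; rewrite -key [in RHS]/lcomb big_cons -/(lcomb s c v w).
    rewrite (_ : lcomb s c v w = lcomb s c v1 w.1).
      by rewrite /v eqxx -/sg; ring.
    rewrite /lcomb; apply: eq_big_seq => j js; rewrite /v ifF//.
    by apply/negbTE/eqP => ji; rewrite -ji js in i0s.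
  congr cnormal.
  have VE : lcomb (i0 :: s) c V = (fun w => lcomb s c1 V w + c i0 * r0 w).
    apply/funext => w; rewrite -key [LHS]/lcomb big_cons -/(lcomb s c V w) /r0; ring.
  have LW : L2 P (lcomb s c1 V) by exact: L2_lcomb.
  have Lcr : L2 P (fun w => c i0 * r0 w) by exact: L2Z.
  have Wr : ip P (lcomb s c1 V) r0 = 0.
    by rewrite ipC; apply: ip_lcombr => // j js; exact: Hc0.
  rewrite VE (ipDl LW Lcr (L2D LW Lcr)) (ipDr LW Lcr LW) (ipDr LW Lcr Lcr).
  rewrite (ipZl _ Lr0 LW) (ipZr _ Lr0 LW) (ipC P r0) Wr (ipZl _ Lr0 Lcr) (ipZr _ Lr0 Lr0).
  by rewrite /s2; ring.
Qed.

End noise_extension.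

(** * Events of random vectors and spans of their coordinates *)

Section vector_events.
Context {R : realType} {d : measure_display} {T : measurableType d}.

Lemma rv_events_sigma (k : nat) (X : T -> 'cV[R]_k) : sigma_algebra setT (rv_events X).
Proof.
have [b0 bC bU] : sigma_algebra setT (@vborel R k) by exact: smallest_sigma_algebra.
split.
- by exists set0; rewrite preimage_set0.
- move=> _ [B [vB ->]]; exists (setT `\` B); split; first exact: bC.
  by rewrite !setTD preimage_setC.
- move=> F FX; have [B HB] := choice FX.
  exists (\bigcup_n B n); split; first by apply: bU => n; case: (HB n).
  by rewrite preimage_bigcup; apply: eq_bigcupr => n _; case: (HB n).
Qed.

Lemma rv_events_coord (k : nat) (X : T -> 'cV[R]_k) i :
  sigma_meas (rv_events X) (fun w => X w i ord0).
Proof.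
move=> B mB; exists ((fun v : 'cV[R]_k => v i ord0) @^-1` B); split => //.
by apply: sub_gen_smallest; exists i, B.
Qed.

Lemma rv_events_sub (k : nat) (X : T -> 'cV[R]_k) (G : set (set T)) :
  sigma_algebra setT G -> (forall i, sigma_meas G (fun w => X w i ord0)) ->
  rv_events X `<=` G.
Proof.
move=> [g0 gC gU] GX _ [B [vB ->]].
suff : vborel `<=` [set B : set 'cV[R]_k | G (X @^-1` B)] by exact.
apply: smallest_sub; last by move=> _ [i [D [mD ->]]]; exact: GX.
split => /=.
- by rewrite preimage_set0.
- by move=> D /gC; rewrite !setTD preimage_setC.
- by move=> F /gU; rewrite preimage_bigcup.
Qed.

Lemma rv_events_measurable (k : nat) (X : T -> 'cV[R]_k) :
  rvec_meas X -> rv_events X `<=` measurable.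
Proof.
move=> mX; apply: rv_events_sub; first exact: sigma_algebra_measurable.
by move=> i B mB; rewrite -[_ @^-1` _]setTI; exact: mX.
Qed.

Lemma sigma_meas_sum (G : set (set T)) (I : Type) (s : seq I) (F : I -> T -> R) :
  sigma_algebra setT G -> (forall i, sigma_meas G (F i)) ->
  sigma_meas G (fun w => \sum_(i <- s) F i w).
Proof.
move=> sG GF; apply/(sub_sigma_measP sG); apply: measurable_sum => i.
exact/(sub_sigma_measP sG).
Qed.

Lemma sigma_meas_sum_seq (G : set (set T)) (I : eqType) (s : seq I) (F : I -> T -> R) :
  sigma_algebra setT G -> (forall i, i \in s -> sigma_meas G (F i)) ->
  sigma_meas G (fun w => \sum_(i <- s) F i w).
Proof.
move=> sG GF.
rewrite (_ : (fun w => _) = (fun w => \sum_(i <- s) if i \in s then F i w else 0)).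
  apply: sigma_meas_sum => // i; case: (boolP (i \in s)) => [|_]; first exact: GF.
  exact/(sub_sigma_measP sG)/measurable_cst.
by apply/funext => w; apply: eq_big_seq => i ->.
Qed.

Lemma sigma_measZ (G : set (set T)) c (X : T -> R) : sigma_algebra setT G ->
  sigma_meas G X -> sigma_meas G (fun w => c * X w).
Proof.
move=> sG GX; apply: (sigma_meas_comp (f := fun x => c * x)) => //.
exact: measurable_funM.
Qed.

Lemma rv_events_dotv (k : nat) (X : T -> 'cV[R]_k) u :
  sigma_meas (rv_events X) (fun w => dotv u (X w)).
Proof.
apply: sigma_meas_sum; first exact: rv_events_sigma.
by move=> i; apply: sigma_measZ; [exact: rv_events_sigma|exact: rv_events_coord].
Qed.

End vector_events.

Section spans.
Context {R : realType} {T : Type}.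

(** Pairs of a time strictly below [K] and a coordinate, which flatten a family of random vectors
    into a finite family of scalars. Times up to and including [k] correspond to [K] equal to
    [k.+1]. *)
Definition idx (K n : nat) : seq (nat * 'I_n) :=
  [seq (j, i) | j <- iota 0 K, i <- enum 'I_n].

Definition coord (n : nat) (X : nat -> T -> 'cV[R]_n) (a : nat * 'I_n) : T -> R :=
  fun w => X a.1 w a.2 ord0.

Lemma mem_idx K n (a : nat * 'I_n) : (a \in idx K n) = (a.1 < K)%N.
Proof.
case: a => j i; apply/allpairsP/idP => [[[j' i'] /= [h _ [-> _]]]|/= jK].
  by move: h; rewrite mem_iota.
by exists (j, i); rewrite /= mem_iota mem_enum.
Qed.

Lemma idx_uniq K n : uniq (idx K n).
Proof.
apply: allpairs_uniq; [exact: iota_uniq|exact: enum_uniq|].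
by move=> [? ?] [? ?] _ _ /= [-> ->].
Qed.

Lemma lcomb_idx K n (c : nat * 'I_n -> R) (V : nat * 'I_n -> T -> R) w :
  lcomb (idx K n) c V w = \sum_(j < K) \sum_(i < n) c (nat_of_ord j, i) * V (nat_of_ord j, i) w.
Proof.
rewrite /lcomb /idx big_allpairs/= -(big_mkord xpredT (fun j => \sum_(i < n) c (j, i) * V (j, i) w)).
rewrite /index_iota subn0; apply: eq_bigr => j _.
by rewrite big_enum.
Qed.

Lemma lcomb_col K n (c : nat * 'I_n -> R) (X : nat -> T -> 'cV[R]_n) w :
  lcomb (idx K n) c (coord X) w = \sum_(j <- iota 0 K) dotv (\col_i c (j, i)) (X j w).
Proof.
rewrite lcomb_idx -(big_mkord xpredT (fun j => \sum_(i < n) c (j, i) * coord X (j, i) w)).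
by rewrite /index_iota subn0; apply: eq_bigr => j _; apply: eq_bigr => i _; rewrite mxE.
Qed.

Lemma lcomb_dotv K n (u : nat -> 'cV[R]_n) (X : nat -> T -> 'cV[R]_n) w :
  \sum_(j < K) dotv (u j) (X j w) = lcomb (idx K n) (fun a => u a.1 a.2 ord0) (coord X) w.
Proof. by rewrite lcomb_idx. Qed.

Definition lspan (I : Type) (s : seq I) (V : I -> T -> R) : set (T -> R) :=
  [set f | exists c, f = lcomb s c V].

Lemma lspanP (I : Type) (s : seq I) (V : I -> T -> R) : fun_submod (lspan s V).
Proof.
split.
  by exists (fun=> 0); apply/funext => w; rewrite /lcomb big1// => i _; rewrite mul0r.
move=> a _ _ [c ->] [e ->]; exists (fun i => a * c i + e i); apply/funext => w.
rewrite /lcomb mulr_sumr -big_split/=; apply: eq_bigr => i _; ring.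
Qed.

Lemma lspan_sub (I : eqType) (s : seq I) (V : I -> T -> R) (S : set (T -> R)) :
  fun_submod S -> (forall i, i \in s -> S (V i)) -> lspan s V `<=` S.
Proof.
move=> sS SV _ [c ->]; apply: submod_sum => // i si.
by apply: submodZ => //; exact: SV.
Qed.

Lemma lcomb_delta (I : eqType) (s : seq I) (V : I -> T -> R) i0 w :
  uniq s -> i0 \in s -> lcomb s (fun i => (i == i0)%:R) V w = V i0 w.
Proof.
move=> us si; rewrite /lcomb (bigD1_seq i0)//= eqxx mul1r big1 ?addr0//.
by move=> i /negbTE ->; rewrite mul0r.
Qed.

Lemma lspan_mem (I : eqType) (s : seq I) (V : I -> T -> R) i :
  uniq s -> i \in s -> lspan s V (V i).
Proof.
by move=> us si; exists (fun j => (j == i)%:R); apply/funext => w; rewrite lcomb_delta.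
Qed.

Lemma coord_span K n (X : nat -> T -> 'cV[R]_n) j i : (j < K)%N ->
  lspan (idx K n) (coord X) (fun w => X j w i ord0).
Proof.
move=> jK; have ji : (j, i) \in idx K n by rewrite mem_idx.
exact: (lspan_mem (coord X) (idx_uniq K n) ji).
Qed.

Lemma lspan_coord_sub K n (X : nat -> T -> 'cV[R]_n) (S : set (T -> R)) :
  fun_submod S -> (forall j i, (j < K)%N -> S (fun w => X j w i ord0)) ->
  lspan (idx K n) (coord X) `<=` S.
Proof.
by move=> sS SX; apply: lspan_sub => // -[j i]; rewrite mem_idx; exact: SX.
Qed.

Lemma lspanS K L n (X : nat -> T -> 'cV[R]_n) : (K <= L)%N ->
  lspan (idx K n) (coord X) `<=` lspan (idx L n) (coord X).
Proof.
move=> KL; apply: lspan_coord_sub; first exact: lspanP.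
by move=> j i jK; apply: coord_span; exact: leq_trans jK KL.
Qed.

End spans.

Section sigma_spans.
Context {R : realType} {d : measure_display} {T : measurableType d}.

Lemma ev_fam_sub n (X : nat -> T -> 'cV[R]_n) (I : set nat) (S : set (T -> R)) :
  (forall j i, I j -> S (fun w => X j w i ord0)) ->
  ev_fam X I `<=` sigma_fun S.
Proof.
move=> SX A [j Ij]; apply: rv_events_sub; first exact: sigma_fun_algebra.
by move=> i; apply: sigma_fun_meas; exact: SX.
Qed.

(** Passage from the sigma-algebras of the statement to those of linear spans, for which Gaussian
    orthogonality is available. *)
Lemma sigma_ev_fam K n (X : nat -> T -> 'cV[R]_n) :
  <<s ev_fam X [set j | (j < K)%N] >> = sigma_fun (lspan (idx K n) (coord X)).
Proof.
apply/seteqP; split.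
  apply: smallest_sub; first exact: sigma_fun_algebra.
  by apply: ev_fam_sub => j i; exact: coord_span.
have sE : sigma_algebra setT <<s ev_fam X [set j | (j < K)%N] >>.
  exact: smallest_sigma_algebra.
apply: smallest_sub => // _ [_ [B [[c ->] mB ->]]].
apply: sigma_meas_sum_seq => // -[j i]; rewrite mem_idx/= => jK.
apply: sigma_measZ => // D mD; apply: sub_gen_smallest; exists j => //.
exact: rv_events_coord.
Qed.

End sigma_spans.

(** * Sums of mutually independent normal variables *)

Section grouping.
Context {R : realType} {d : measure_display} {T : measurableType d}.
Variable P : probability T R.

Definition bigI_sys (I : eqType) (s : seq I) (E : I -> set (set T)) : set (set T) :=
  [set B | exists b : I -> set T, (forall i, i \in s -> E i (b i)) /\
     B = \big[setI/setT]_(i <- s) b i].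

Lemma bigsetI_measurable (I : eqType) (s : seq I) (b : I -> set T) :
  (forall i, i \in s -> measurable (b i)) -> measurable (\big[setI/setT]_(i <- s) b i).
Proof.
by move=> mb; rewrite big_seq; elim/big_ind: _ => // A B; exact: measurableI.
Qed.

(** Mutual independence gives the product rule on finite intersections; these form a pi-system, and
    [Ex_pi_system0] with the centred indicator of [A] extends the rule to what they generate. *)
Lemma mutual_indep_cons (I : eqType) (D : set I) (E : I -> set (set T)) i0 (s : seq I) :
  (forall i, D i -> sigma_algebra setT (E i) /\ E i `<=` measurable) ->
  mutual_indep P D E -> uniq (i0 :: s) -> (forall i, i \in i0 :: s -> D i) ->
  indep2 P (E i0) <<s bigI_sys s E >>.
Proof.
move=> sE mE /= us Ds A B EA GB.
have Di0 : D i0 by apply: Ds; rewrite mem_head.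
have [sE0 mE0] := sE _ Di0; have mA := mE0 _ EA.
have Ds' i : i \in s -> D i by move=> si; apply: Ds; rewrite in_cons si orbT.
have mC : bigI_sys s E `<=` measurable.
  move=> _ [b [Eb ->]]; apply: bigsetI_measurable => i si.
  by apply: (sE _ (Ds' _ si)).2; exact: Eb.
have mB : measurable B.
  by move: B GB; apply: smallest_sub => //; exact: sigma_algebra_measurable.
have CI : setI_closed (bigI_sys s E).
  move=> _ _ [b [Eb ->]] [c [Ec ->]]; exists (fun i => b i `&` c i); split.
    by move=> i si; apply: sigma_algebra_setI; [exact: (sE _ (Ds' _ si)).1|exact: Eb|exact: Ec].
  by rewrite -big_split.
have ih : itg P (fun w => \1_A w - Ex P \1_A).
  by apply: itgB; [exact: itg_indic|exact: itg_cst].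
have h0 : Ex P (fun w => \1_A w - Ex P \1_A) = 0.
  by rewrite ExB ?Ex_cst ?subrr//; [exact: itg_indic|exact: itg_cst].
have ABE C : measurable C -> Ex P (fun w => (\1_A w - Ex P \1_A) * \1_C w) =
    Ex P \1_(A `&` C) - Ex P \1_A * Ex P \1_C.
  move=> mCC; rewrite -ExZ; last exact: itg_indic.
  rewrite -ExB; [|by apply: itg_indic; exact: measurableI|by apply: itgZ; exact: itg_indic].
  by congr Ex; apply/funext => w; rewrite indicI/= mulrBl.
have hC C : bigI_sys s E C -> Ex P (fun w => (\1_A w - Ex P \1_A) * \1_C w) = 0.
  move=> CC; have mCC := mC _ CC; rewrite ABE//; move: CC => [b [Eb CE]].
  have /andP[i0s us'] := us.
  pose b' i := if i == i0 then A else b i.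
  have b's i : i \in s -> b' i = b i.
    move=> si; rewrite /b' ifF//; apply/negbTE/eqP => ii0.
    by rewrite -ii0 si in i0s.
  have := mE (i0 :: s) us Ds b'.
  have b'0 : b' i0 = A by rewrite /b' eqxx.
  rewrite !big_cons b'0.
  have -> : \big[setI/setT]_(j <- s) b' j = C by rewrite CE; exact: eq_big_seq.
  rewrite (eq_big_seq (fun j => P (b j))); last by move=> j sj; rewrite b's.
  rewrite -(mE s us' Ds' b Eb) -CE => h.
  apply/eqP; rewrite subr_eq0; apply/eqP/EFin_inj; rewrite EFinM !Ex_indic//.
    rewrite h// => i; rewrite in_cons => /predU1P[->|si]; first by rewrite b'0.
    by rewrite b's//; exact: Eb.
  exact: measurableI.
have := Ex_pi_system0 mC CI ih h0 hC GB; rewrite ABE// => /eqP.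
rewrite subr_eq0 => /eqP e; rewrite -!Ex_indic//; last exact: measurableI.
by rewrite e EFinM.
Qed.

Lemma bigI_sys_sub (I : eqType) (s : seq I) (E : I -> set (set T)) i :
  (forall i, i \in s -> sigma_algebra setT (E i)) -> uniq s -> i \in s ->
  E i `<=` bigI_sys s E.
Proof.
move=> sE us si A EA; exists (fun j => if j == i then A else setT); split.
  move=> j sj; case: eqP => [->//|_]; exact: sigma_algebra_setT (sE _ sj).
rewrite (bigD1_seq i)//= eqxx big1 ?setIT//.
by move=> j /negbTE ->.
Qed.

Lemma mutual_indep_sum (I : eqType) (D : set I) (E : I -> set (set T))
    (g : I -> T -> R) (s2 : I -> R) (s : seq I) :
  (forall i, D i -> sigma_algebra setT (E i) /\ E i `<=` measurable) ->
  (forall i, D i -> sigma_meas (E i) (g i) /\ cnormal P (g i) (s2 i)) ->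
  mutual_indep P D E -> uniq s -> (forall i, i \in s -> D i) ->
  cnormal P (fun w => \sum_(i <- s) g i w) (\sum_(i <- s) s2 i).
Proof.
move=> sE gE mE; elim: s => [_ _|i0 s ih us Ds].
  rewrite big_nil (_ : (fun w => _) = fun=> 0); last first.
    by apply/funext => w; rewrite big_nil.
  split => //; split => // B mB; rewrite eqxx diracE.
  case: (boolP (0 \in B)) => [/set_mem|/negP] B0.
    by rewrite preimage_cst mem_set// probability_setT.
  by rewrite preimage_cst (negbTE (introN idP B0)) measure0.
have Di0 : D i0 by apply: Ds; rewrite mem_head.
have Ds' i : i \in s -> D i by move=> si; apply: Ds; rewrite in_cons si orbT.
have us' : uniq s by case/andP: us.
rewrite big_cons (_ : (fun w => _) = (fun w => g i0 w + \sum_(i <- s) g i w)); last first.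
  by apply/funext => w; rewrite big_cons.
apply: cnormalD; [exact: (gE _ Di0).2|exact: ih|].
move=> B C mB mC; apply: (mutual_indep_cons sE mE us Ds).
  exact: (gE _ Di0).1.
have sB : sigma_algebra setT <<s bigI_sys s E >> by exact: smallest_sigma_algebra.
suff gs : sigma_meas <<s bigI_sys s E >> (fun w => \sum_(i <- s) g i w) by exact: gs.
apply: sigma_meas_sum_seq => // i si D0 mD0; apply: sub_gen_smallest.
have sEs j : j \in s -> sigma_algebra setT (E j) by move=> sj; exact: (sE _ (Ds' _ sj)).1.
by apply: (bigI_sys_sub sEs us' si); exact: (gE _ (Ds' _ si)).1.
Qed.

End grouping.

(** * Orthogonality extracted from conditional independence *)

Section extraction.
Context {R : realType} {d : measure_display} {T : measurableType d}.
Variable P : probability T R.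

(* Test X against indicators \1_A and subtract from these their conditional
   probability given G: what remains is orthogonal to the events B `&` S with B in F2
   and S in G, which generate Z - p. *)
Lemma cond_indep_orth (F1 F2 G : set (set T)) (X Z p : T -> R) :
  sigma_algebra setT F1 -> sigma_algebra setT F2 -> sigma_algebra setT G ->
  F1 `<=` measurable -> F2 `<=` measurable -> G `<=` measurable ->
  cond_indep P F1 F2 G -> sigma_meas F1 X -> sigma_meas F2 Z -> sigma_meas G p ->
  L2 P X -> L2 P Z -> L2 P p ->
  (forall S, G S -> Ex P (fun w => (Z w - p w) * \1_S w) = 0) ->
  ip P X (fun w => Z w - p w) = 0.
Proof.
move=> sF1 sF2 sG mF1 mF2 mG ci F1X F2Z Gp LX LZ Lp zG.
pose z w := Z w - p w; rewrite -/z.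
have Lz : L2 P z by exact: L2B.
have iz := L2_itg Lz.
rewrite ipC; apply: (@Ex_mul_sigma_meas0 _ _ _ _ F1) => //; last exact: L2_itgM.
move=> A FA; have mA := mF1 _ FA.
(* A version with values in the unit interval everywhere; those that [cond_indep] supplies are
   merely integrable. *)
have [qA [GqA qA1 qAE]] := cond_prob P sG mG mA.
have mqA := sigma_meas_fun mG GqA.
have bqA w : `|qA w| <= 1 by have /andP[? ?] := qA1 w; rewrite ger0_norm.
have iqA : itg P qA by exact: itg_bdd bqA.
pose h w := \1_A w - qA w.
have mh : measurable_fun setT h by apply: measurable_funB => //; exact: measurable_indic.
have h1 w : `|h w| <= 1.
  have /andP[p0 p1] := qA1 w; rewrite /h indicE ler_norml.
  by case: (w \in A) => /=; apply/andP; split; lra.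
have ih : itg P h by exact: itg_bdd h1.
pose C := [set D | exists B S, [/\ F2 B, G S & D = B `&` S]].
have mC : C `<=` measurable.
  by move=> _ [B [S [FB GS ->]]]; apply: measurableI; [exact: mF2|exact: mG].
have CI : setI_closed C.
  move=> _ _ [B [S [FB GS ->]]] [B' [S' [FB' GS' ->]]].
  exists (B `&` B'), (S `&` S'); split; [exact: sigma_algebra_setI|exact: sigma_algebra_setI|].
  by rewrite setIACA.
have hC D : C D -> Ex P (fun w => h w * \1_D w) = 0.
  move=> [B [S [FB GS ->]]]; have mB := mF2 _ FB; have mS := mG _ GS.
  have [pA [pB [cA cB cAB]]] := ci A B FA FB.
  have [iA ipA GpA pAE] := Ex_cexp1 mG cA.
  have [iB ipB GpB pBE] := Ex_cexp1 mG cB.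
  have [iAB ipAB _ pABE] := Ex_cexp1 mG cAB.
  have mpA := sigma_meas_fun mG GpA; have mpB := sigma_meas_fun mG GpB.
  have iqB : itg P (fun w => pB w * qA w) by exact: itgM_bdd bqA ipB.
  have iqBS : itg P (fun w => pB w * qA w * \1_S w) by exact: itgM_indic.
  (* The aim is that $1_A$ and [qA] have the same integral over $B\cap S$. Conditional independence
     turns the former into that of [pA * pB] over $S$; [e1] exchanges $1_B$ for [pB], and [e2]
     exchanges [pA] for [qA], another version of the same conditional probability. *)
  have e1 : Ex P (fun w => \1_B w * (qA w * \1_S w)) = Ex P (fun w => pB w * (qA w * \1_S w)).
    have bqS w : `|qA w * \1_S w : R| <= 1 by rewrite normrM mulr_ile1// indic_bdd.
    have mqS : measurable_fun setT (fun w => qA w * \1_S w).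
      by apply: measurable_funM => //; exact: measurable_indic.
    apply/eqP; rewrite -subr_eq0 -ExB; [|exact: itgM_bdd mqS bqS iB|exact: itgM_bdd mqS bqS ipB].
    apply/eqP; have e : Ex P (fun w => (\1_B w - pB w) * (qA w * \1_S w)) = 0.
      apply: (@Ex_mul_sigma_meas0 _ _ _ _ G) => //.
      - exact: itgB.
      - move=> S' GS'; have mS' := mG _ GS'.
        rewrite (_ : (fun w => _) = (fun w => \1_B w * \1_S' w - pB w * \1_S' w)).
          by rewrite ExB ?pBE ?subrr//; exact: itgM_indic.
        by apply/funext => w; rewrite mulrBl.
      - apply/(sub_sigma_measP sG); apply: measurable_funM; first exact/(sub_sigma_measP sG).
        by apply: measurable_indic; rewrite /measurable/= smallest_id.
      - by apply: (itgM_bdd mqS bqS); exact: itgB.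
    by rewrite -[RHS]e; congr Ex; apply/funext => w; rewrite mulrBl.
  have e2 : Ex P (fun w => pA w * pB w * \1_S w) = Ex P (fun w => pB w * qA w * \1_S w).
    have iABS : itg P (fun w => pA w * pB w * \1_S w) by apply: itgM_indic.
    apply/eqP; rewrite -subr_eq0 -ExB//; apply/eqP.
    have e : Ex P (fun w => (pA w - qA w) * (pB w * \1_S w)) = 0.
      apply: (@Ex_mul_sigma_meas0 _ _ _ _ G) => //.
      - exact: itgB.
      - move=> S' GS'; have mS' := mG _ GS'.
        rewrite (_ : (fun w => _) = (fun w => pA w * \1_S' w - qA w * \1_S' w)).
          rewrite ExB; [|exact: itgM_indic..].
          rewrite qAE// -pAE//; apply/eqP; rewrite subr_eq0; apply/eqP.
          by congr Ex; apply/funext => w; rewrite indicI.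
        by apply/funext => w; rewrite mulrBl.
      - apply/(sub_sigma_measP sG); apply: measurable_funM; first exact/(sub_sigma_measP sG).
        by apply: measurable_indic; rewrite /measurable/= smallest_id.
      - rewrite (_ : (fun w => _) = (fun w => pA w * pB w * \1_S w - pB w * qA w * \1_S w)).
          exact: itgB.
        by apply/funext => w; ring.
    by rewrite -[RHS]e; congr Ex; apply/funext => w; ring.
  have mBS : measurable (B `&` S) by exact: measurableI.
  rewrite (_ : (fun w => _) = (fun w => \1_(A `&` B) w * \1_S w - \1_B w * (qA w * \1_S w))).
    rewrite ExB.
    - rewrite e1 pABE// e2; apply/eqP; rewrite subr_eq0; apply/eqP.
      by congr Ex; apply/funext => w; rewrite mulrA.
    - exact: itgM_indic.
    - apply: (itgM_bdd (M := 1)) => //.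
        by apply: measurable_funM => //; exact: measurable_indic.
      by move=> w; rewrite normrM mulr_ile1// indic_bdd.
  by apply/funext => w; rewrite /h !indicI/=; ring.
have hT : Ex P h = 0.
  have := hC setT; rewrite (_ : (fun w => h w * \1_setT w) = h).
    apply; exists setT, setT; split; [exact: sigma_algebra_setT|exact: sigma_algebra_setT|].
    by rewrite setIT.
  by apply/funext => w; rewrite indicT mulr1.
have sC : sigma_algebra setT <<s C >> by exact: smallest_sigma_algebra.
have e3 : Ex P (fun w => h w * z w) = 0.
  apply: (@Ex_mul_sigma_meas0 _ _ _ _ <<s C >>) => //.
  - by apply: smallest_sub => //; exact: sigma_algebra_measurable.
  - exact: Ex_pi_system0.
  - apply/(sub_sigma_measP sC); apply: measurable_funB; apply/(sub_sigma_measP sC).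
    + move=> D mD; apply: sub_gen_smallest; exists (Z @^-1` D), setT; split.
      * exact: F2Z.
      * exact: sigma_algebra_setT.
      * by rewrite setIT.
    + move=> D mD; apply: sub_gen_smallest; exists setT, (p @^-1` D); split.
      * exact: sigma_algebra_setT.
      * exact: Gp.
      * by rewrite setTI.
  - by under eq_fun do rewrite mulrC; exact: (itgM_bdd mh h1 iz).
have e4 : Ex P (fun w => z w * qA w) = 0.
  by apply: (@Ex_mul_sigma_meas0 _ _ _ _ G) => //; exact: itgM_bdd bqA iz.
transitivity (Ex P (fun w => h w * z w) + Ex P (fun w => z w * qA w)); last by rewrite e3 e4 addr0.
rewrite -ExD.
- by congr Ex; apply/funext => w; rewrite /h; ring.
- by under eq_fun do rewrite mulrC; exact: (itgM_bdd mh h1 iz).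
- exact: itgM_bdd bqA iz.
Qed.

End extraction.

(** * Conditional expectation as orthogonal projection *)

Section gaussian_conditional_expectation.
Context {R : realType} {d : measure_display} {T : measurableType d}.
Variable P : probability T R.
Variables (V : set (T -> R)) (gV : gspace P V).

(** Orthogonality to [S] upgrades to independence, and [Z] is centred. *)
Lemma gspace_residual (S : set (T -> R)) Z : fun_submod S -> S `<=` V -> V Z ->
  (forall Y, S Y -> ip P Z Y = 0) ->
  forall A, sigma_fun S A -> Ex P (fun w => Z w * \1_A w) = 0.
Proof.
move=> sS SV VZ ZS A FA.
have mS := gspace_meas gV SV; have mA := sigma_fun_measurable mS FA.
have lV : line Z `<=` V by move=> _ [a ->]; apply: submodZ => //; case: gV.
have mZ := gspace_meas gV lV.
have iZ := L2_itg (gspace_L2 gV VZ).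
have ind : indep2 P (sigma_fun (line Z)) (sigma_fun S).
  apply: (gspace_indep gV) => //; first exact: lineP.
  move=> _ Y [a ->] SY.
  by rewrite (ipZl a (gspace_L2 gV VZ) (gspace_L2 gV (SV _ SY))) ZS// mulr0.
have := Ex_indep (sigma_fun_measurable mZ) (sigma_fun_measurable mS) ind
  (X := Z) (Y := \1_A) (M := 1) (sigma_fun_meas (line_id Z)) _ iZ (indic_bdd A).
move=> ->; last first.
  apply/(sub_sigma_measP (sigma_fun_algebra S)); apply: measurable_indic.
  by rewrite /measurable/= smallest_id//; exact: sigma_fun_algebra.
by have [s2 cZ] := gV.2 _ VZ; rewrite (cnormal_Ex0 cZ) mul0r.
Qed.

(** In a Gaussian space the residual of a projection is independent of the subspace, so the linear
    projection already is the conditional expectation. *)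
Lemma gspace_cexp1 (S : set (T -> R)) X Z : fun_submod S -> S `<=` V -> V X -> S Z ->
  (forall Y, S Y -> ip P (fun w => X w - Z w) Y = 0) ->
  cexp1 P (sigma_fun S) X Z.
Proof.
move=> sS SV VX SZ XZ; have VZ := SV _ SZ.
have mS := gspace_meas gV SV; have mG := sigma_fun_measurable mS.
have LX := gspace_L2 gV VX; have LZ := gspace_L2 gV VZ.
have VXZ : V (fun w => X w - Z w) by apply: submodB => //; case: gV.
apply: cexp1_Ex => //; [exact: L2_itg|exact: L2_itg|exact: sigma_fun_meas|].
move=> A FA; have mA := mG _ FA.
apply/eqP; rewrite -subr_eq0 -ExB; [|by apply: itgM_indic => //; exact: L2_itg..].
apply/eqP; rewrite -[RHS](gspace_residual sS SV VXZ XZ FA).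
by congr Ex; apply/funext => w; rewrite mulrBl.
Qed.

End gaussian_conditional_expectation.

(** * Transport of the model along a measure-preserving map *)

Section measure_preserving.
Context {R : realType} {d d' : measure_display} {T : measurableType d}
  {T' : measurableType d'}.
Variables (P : probability T R) (P' : probability T' R) (proj : T' -> T).
Hypothesis mproj : measurable_fun setT proj.
Hypothesis projE : forall A, measurable A -> P' (proj @^-1` A) = P A.

Lemma preserving_law (X : T -> R) B : measurable_fun setT X -> measurable B ->
  P' ((fun w => X (proj w)) @^-1` B) = P (X @^-1` B).
Proof.
by move=> mX mB; apply: (projE (A := X @^-1` B)); rewrite -[_ @^-1` _]setTI; exact: mX.
Qed.

Lemma preserving_normal (X : T -> R) mu s2 : measurable_fun setT X ->
  normal_law P X mu s2 -> normal_law P' (fun w => X (proj w)) mu s2.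
Proof.
by move=> mX [s0 XE]; split => // B mB; rewrite preserving_law// XE.
Qed.

Lemma preserving_rvec k (X : T -> 'cV[R]_k) : rvec_meas X ->
  rvec_meas (fun w => X (proj w)).
Proof. by move=> mX i; exact: (measurableT_comp (mX i) mproj). Qed.

Lemma dotv_measurable k (X : T -> 'cV[R]_k) u : rvec_meas X ->
  measurable_fun setT (fun w => dotv u (X w)).
Proof. by move=> mX; apply: measurable_sum => i; apply: measurable_funM. Qed.

Lemma preserving_gauss_vec k (X : T -> 'cV[R]_k) mu S : rvec_meas X ->
  gauss_vec P X mu S -> gauss_vec P' (fun w => X (proj w)) mu S.
Proof.
move=> mX gX u.
apply: (@preserving_normal (fun w => dotv u (X w))); [exact: dotv_measurable|exact: gX].
Qed.

Lemma preserving_mutual_indep (I : eqType) (D : set I) (E : I -> set (set T))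
    (E' : I -> set (set T')) :
  (forall i, D i -> E i `<=` measurable) ->
  (forall i, D i -> E' i `<=` [set B | exists2 A, E i A & B = proj @^-1` A]) ->
  mutual_indep P D E -> mutual_indep P' D E'.
Proof.
move=> mE EE' iE s us Ds B EB.
have BA i : exists A, i \in s -> E i A /\ B i = proj @^-1` A.
  case: (boolP (i \in s)) => [si|_]; last by exists set0.
  by have [A EA BA] := EE' i (Ds _ si) _ (EB _ si); exists A.
have [A HA] := choice BA.
have -> : \big[setI/setT]_(i <- s) B i = proj @^-1` (\big[setI/setT]_(i <- s) A i).
  rewrite (eq_big_seq (fun i => proj @^-1` A i)); last by move=> i /HA[].
  elim: s {us Ds EB HA BA} => [|i s ih]; first by rewrite !big_nil preimage_setT.
  by rewrite !big_cons ih preimage_setI.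
rewrite projE; last first.
  by apply: bigsetI_measurable => i si; apply: mE (Ds _ si) _ (HA _ si).1.
rewrite (iE s us Ds A); last by move=> i /HA[].
apply: eq_big_seq => i si; rewrite (HA _ si).2 projE//.
exact: mE (Ds _ si) _ (HA _ si).1.
Qed.

Lemma preserving_rv_events k (X : T -> 'cV[R]_k) :
  rv_events (fun w => X (proj w)) `<=` [set B | exists2 A, rv_events X A & B = proj @^-1` A].
Proof. by move=> _ [B [vB ->]]; exists (X @^-1` B) => //; exists B. Qed.

Lemma preserving_ssm (n m N : nat) A (C : nat -> 'M[R]_(m, n)) P0 Q Rn
    (x q : nat -> T -> 'cV[R]_n) (y r : nat -> T -> 'cV[R]_m) :
  ssm P N A C P0 Q Rn x q y r ->
  ssm P' N A C P0 Q Rn (fun k w => x k (proj w)) (fun k w => q k (proj w))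
    (fun k w => y k (proj w)) (fun k w => r k (proj w)).
Proof.
move=> [[mx [mq mr]] [gx [gq gr]] ind xE yE]; split.
- split; first exact: preserving_rvec.
  by split => k kN; apply: preserving_rvec; [exact: mq|exact: mr].
- split; first exact: preserving_gauss_vec.
  split => k kN; apply: preserving_gauss_vec.
  - exact: mq.
  - exact: gq.
  - exact: mr.
  - exact: gr.
- apply: preserving_mutual_indep ind.
    move=> [[|k]|k] /= kN; apply: rv_events_measurable => //; [exact: mq|exact: mr].
  by move=> [[|k]|k] /= _; exact: preserving_rv_events.
- by move=> k w kN; exact: xE.
- by move=> k w kN; exact: yE.
Qed.

Lemma preserving_Ex (X : T -> R) : itg P X ->
  itg P' (fun w => X (proj w)) /\ Ex P' (fun w => X (proj w)) = Ex P X.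
Proof.
move=> iX; have mX := itg_meas iX.
have mid : measurable_fun [set: R] (id : R -> R) by [].
apply: (same_law_itg (X := fun w => X (proj w)) (Y := X) _ mX _ mid iX).
- exact: (measurableT_comp mX mproj).
- by move=> B mB; exact: preserving_law.
Qed.

End measure_preserving.

(** * Orthogonality read off from normal laws *)

Section orthogonality.
Context {R : realType} {d : measure_display} {T : measurableType d}.
Variable P : probability T R.

(** Polarization: where variances add, the mixed moment vanishes. *)
Lemma cnormal_orth (X Y : T -> R) a b : cnormal P X a -> cnormal P Y b ->
  cnormal P (fun w => X w + Y w) (a + b) -> ip P X Y = 0.
Proof.
move=> cX cY cXY; have LX := cnormal_L2 cX; have LY := cnormal_L2 cY.
have := cnormal_ip cXY; rewrite (ipDl LX LY (L2D LX LY)) (ipDr LX LY LX) (ipDr LX LY LY).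
rewrite (cnormal_ip cX) (cnormal_ip cY) (ipC P Y X) mulrDr.
by move=> h; lra.
Qed.

Lemma dotv_delta k (i : 'I_k) (v : 'cV[R]_k) : dotv (delta_mx i ord0) v = v i ord0.
Proof.
rewrite /dotv (bigD1 i)//= mxE !eqxx mul1r big1 ?addr0// => j /negbTE ji.
by rewrite mxE ji mul0r.
Qed.

Lemma dotv0l k (v : 'cV[R]_k) : dotv 0 v = 0.
Proof. by rewrite /dotv big1// => i _; rewrite mxE mul0r. Qed.

Lemma dotv0r k (v : 'cV[R]_k) : dotv v 0 = 0.
Proof. by rewrite /dotv big1// => i _; rewrite mxE mulr0. Qed.

Lemma blockdiag_cnormal n (J : nat -> T -> 'cV[R]_n) N (D : nat -> 'M[R]_n)
    (u : nat -> 'cV[R]_n) :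
  (forall k, (k <= N)%N -> rvec_meas (J k)) -> gauss_blockdiag P J N D ->
  cnormal P (fun w => \sum_(j < N.+1) dotv (u j) (J j w))
     (\sum_(j < N.+1) dotv (u j) (D j *m u j)).
Proof.
move=> mJ gJ; split; last exact: gJ.
by apply: measurable_sum => j; apply: dotv_measurable; apply: mJ; rewrite -ltnS.
Qed.

Definition single n (k : nat) (u : 'cV[R]_n) : nat -> 'cV[R]_n :=
  fun j => if j == k then u else 0.

Lemma sum_single n N k (u : 'cV[R]_n) (F : nat -> 'cV[R]_n -> R) : (k <= N)%N ->
  (forall j, F j 0 = 0) ->
  \sum_(j < N.+1) F j (single k u j) = F k u.
Proof.
move=> kN F0; rewrite (bigD1 (Ordinal (kN : (k < N.+1)%N)))//= /single eqxx.
rewrite big1 ?addr0// => j jk; rewrite ifF//.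
by apply/negbTE; apply: contraNneq jk => jk; apply/eqP/val_inj.
Qed.

Lemma blockdiag_coord n (J : nat -> T -> 'cV[R]_n) N D k i :
  (forall k, (k <= N)%N -> rvec_meas (J k)) -> gauss_blockdiag P J N D -> (k <= N)%N ->
  exists s2, cnormal P (fun w => J k w i ord0) s2.
Proof.
move=> mJ gJ kN; have := blockdiag_cnormal (single k (delta_mx i ord0)) mJ gJ.
rewrite (_ : (fun w => _) = (fun w => J k w i ord0)); first by eexists; eauto.
apply/funext => w.
rewrite (@sum_single _ N k (delta_mx i ord0) (fun j u => dotv u (J j w)))//.
  exact: dotv_delta.
by move=> j; exact: dotv0l.
Qed.

(** hypothesis (i) is tested on vectors supported at the times [j] and [k]; a block-diagonal
    quadratic form has no cross term, so variances add and [cnormal_orth] applies. *)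
Lemma blockdiag_orth n (J : nat -> T -> 'cV[R]_n) N D j k i l :
  (forall k, (k <= N)%N -> rvec_meas (J k)) -> gauss_blockdiag P J N D ->
  (j <= N)%N -> (k <= N)%N -> j != k ->
  ip P (fun w => J j w i ord0) (fun w => J k w l ord0) = 0.
Proof.
move=> mJ gJ jN kN jk.
pose u := single j (delta_mx i ord0); pose v := single k (delta_mx l ord0).
have cn k0 (i0 : 'I_n) : (k0 <= N)%N -> cnormal P (fun w => J k0 w i0 ord0)
    (\sum_(t < N.+1) dotv (single k0 (delta_mx i0 ord0) t) (D t *m single k0 (delta_mx i0 ord0) t)).
  move=> kN0; have := blockdiag_cnormal (single k0 (delta_mx i0 ord0)) mJ gJ.
  congr cnormal; apply/funext => w.
  rewrite (@sum_single _ N k0 (delta_mx i0 ord0) (fun j u => dotv u (J j w)))//.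
    exact: dotv_delta.
  by move=> t; exact: dotv0l.
apply: (cnormal_orth (cn j i jN) (cn k l kN)).
have := blockdiag_cnormal (fun t => u t + v t) mJ gJ.
have dotvDl p (a b c : 'cV[R]_p) : dotv (a + b) c = dotv a c + dotv b c.
  by rewrite /dotv -big_split/=; apply: eq_bigr => t _; rewrite mxE mulrDl.
congr cnormal.
- apply/funext => w.
  under eq_bigr do rewrite dotvDl.
  rewrite big_split/=.
  rewrite (@sum_single _ N j (delta_mx i ord0) (fun j u => dotv u (J j w)))//; last by move=> t; exact: dotv0l.
  rewrite (@sum_single _ N k (delta_mx l ord0) (fun j u => dotv u (J j w)))//; last by move=> t; exact: dotv0l.
  by rewrite !dotv_delta.
- rewrite -big_split/=; apply: eq_bigr => t _; rewrite /u /v /single.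
  have [->|tj] := eqVneq (t : nat) j.
    by rewrite (negbTE jk) !addr0 mulmx0 dotv0r addr0.
  have [->|tk] := eqVneq (t : nat) k.
    by rewrite !add0r mulmx0 dotv0r add0r.
  by rewrite !addr0 mulmx0 !dotv0r addr0.
Qed.

End orthogonality.

(** * The state-space model *)

Section state_space_model.
Context {R : realType} {d : measure_display} {T : measurableType d}.
Variable P : probability T R.
Variables (n m N : nat) (A : nat -> 'M[R]_n) (C : nat -> 'M[R]_(m, n)) (P0 : 'M[R]_n)
  (Q : nat -> 'M[R]_n) (Rn : nat -> 'M[R]_m)
  (x q : nat -> T -> 'cV[R]_n) (y r : nat -> T -> 'cV[R]_m).
Hypothesis H : ssm P N A C P0 Q Rn x q y r.

(** The initial state serves as the process noise of time 0. *)
Definition ssm_noise (k : nat) : T -> 'cV[R]_n := if k == 0%N then x 0%N else q k.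

Definition ssm_term (u : nat -> 'cV[R]_n) (v : nat -> 'cV[R]_m) (i : nat + nat) : T -> R :=
  match i with
  | inl k => fun w => dotv (u k) (ssm_noise k w)
  | inr k => fun w => dotv (v k) (r k w)
  end.

Definition ssm_var (u : nat -> 'cV[R]_n) (v : nat -> 'cV[R]_m) (i : nat + nat) : R :=
  match i with inl 0%N => dotv (u 0%N) (P0 *m u 0%N) | inl k => dotv (u k) (Q k *m u k)
  | inr k => dotv (v k) (Rn k *m v k) end.

Definition ssm_dom : set (nat + nat) :=
  [set i | match i with inl k => (k <= N)%N | inr k => (k <= N)%N end].

Lemma ssm_sum u v (s : seq (nat + nat)) : uniq s -> (forall i, i \in s -> ssm_dom i) ->
  cnormal P (fun w => \sum_(i <- s) ssm_term u v i w) (\sum_(i <- s) ssm_var u v i).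
Proof.
move=> us sD; have [[mx [mq mr]] [gx [gq gr]] ind _ _] := H.
apply: (mutual_indep_sum _ _ ind us sD).
- move=> [[|k]|k] /= kN; split; try exact: rv_events_sigma; apply: rv_events_measurable => //.
    exact: mq.
  exact: mr.
- move=> [[|k]|k] /= kN; split; try exact: rv_events_dotv.
  + split; first exact: dotv_measurable.
    by have := gx (u 0%N); rewrite dotv0r.
  + split; first by apply: dotv_measurable; exact: mq.
    by have := gq k.+1 kN (u k.+1); rewrite dotv0r.
  + split; first by apply: dotv_measurable; exact: mr.
    by have := gr k kN (v k); rewrite dotv0r.
Qed.

(** Combinations of the first [K] process noises, initial state included, and the first [L]
    measurement noises. The bounds are kept apart because states involve no measurement noise and
    [y_j] involves none later than [r_j]. *)
Definition ssm_space (K L : nat) : set (T -> R) :=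
  add_submod (lspan (idx K n) (coord ssm_noise)) (lspan (idx L m) (coord r)).

Lemma ssm_spaceP K L : fun_submod (ssm_space K L).
Proof. by apply: add_submodP; exact: lspanP. Qed.

Lemma ssm_spaceS K L K' L' : (K <= K')%N -> (L <= L')%N ->
  ssm_space K L `<=` ssm_space K' L'.
Proof.
move=> KK LL _ [U [V [SU SV ->]]]; exists U, V; split => //.
- exact: lspanS SU.
- exact: lspanS SV.
Qed.

Lemma ssm_gspace : gspace P (ssm_space N.+1 N.+1).
Proof.
split; first exact: ssm_spaceP.
move=> _ [_ [_ [[c ->] [e ->] ->]]].
pose u k : 'cV[R]_n := \col_i c (k, i); pose v k : 'cV[R]_m := \col_i e (k, i).
pose s : seq (nat + nat) := map inl (iota 0 N.+1) ++ map inr (iota 0 N.+1).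
have us : uniq s.
  rewrite cat_uniq !map_inj_uniq ?iota_uniq//; try by move=> ? ? [].
  by rewrite andbT; apply/hasPn => _ /mapP[k _ ->]; apply/mapP => -[].
have sD i : i \in s -> ssm_dom i.
  by rewrite mem_cat => /orP[] /mapP[k]; rewrite mem_iota add0n ltnS => kN ->.
exists (\sum_(i <- s) ssm_var u v i).
have := ssm_sum u v us sD; congr cnormal; apply/funext => w.
by rewrite big_cat !big_map/= !lcomb_col.
Qed.

Lemma ssm_state k i : (k <= N)%N -> ssm_space k.+1 0 (fun w => x k w i ord0).
Proof.
have [_ _ _ xE _] := H.
elim: k i => [|k ih] i kN.
  apply: sub_add_submodl; first exact: lspanP.
  exact: (coord_span ssm_noise (j := 0%N)).
rewrite (_ : (fun w => _) =
    (fun w => \sum_(l <- enum 'I_n) A k.+1 i l * x k w l ord0 + q k.+1 w i ord0)).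
  apply: submodD; first exact: ssm_spaceP.
    apply: submod_sum => [|l _]; first exact: ssm_spaceP.
    apply: submodZ; first exact: ssm_spaceP.
    by apply: (@ssm_spaceS k.+1 0) => //; apply: ih; exact: ltnW.
  apply: sub_add_submodl; first exact: lspanP.
  exact: (coord_span ssm_noise (j := k.+1)).
by apply/funext => w; rewrite xE// !mxE big_enum.
Qed.

Lemma ssm_obs k i : (k <= N)%N -> ssm_space k.+1 k.+1 (fun w => y k w i ord0).
Proof.
move=> kN; have [_ _ _ _ yE] := H.
rewrite (_ : (fun w => _) =
    (fun w => \sum_(l <- enum 'I_n) C k i l * x k w l ord0 + r k w i ord0)).
  apply: submodD; first exact: ssm_spaceP.
    apply: submod_sum => [|l _]; first exact: ssm_spaceP.
    apply: submodZ; first exact: ssm_spaceP.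
    by apply: (@ssm_spaceS k.+1 0) => //; exact: ssm_state.
  apply: sub_add_submodr; first exact: lspanP.
  exact: (coord_span r (j := k)).
by apply/funext => w; rewrite yE// !mxE big_enum.
Qed.

(** The two variables are sums of independent terms over disjoint index sets, so their variances
    add. *)
Lemma ssm_obs_noise_orth k l X : (k <= N)%N -> ssm_space N.+1 k X ->
  ip P (fun w => r k w l ord0) X = 0.
Proof.
move=> kN [_ [_ [[c ->] [e ->] ->]]].
pose u k : 'cV[R]_n := \col_i c (k, i).
(* [v] switches to the test vector at time [k], so that both variables and their sum are sums of the
   same terms over different index sets. *)
pose v j : 'cV[R]_m := if j == k then delta_mx l ord0 else \col_i e (j, i).
pose s : seq (nat + nat) := map inl (iota 0 N.+1) ++ map inr (iota 0 k).
have us : uniq s.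
  rewrite cat_uniq !map_inj_uniq ?iota_uniq//; try by move=> ? ? [].
  by rewrite andbT; apply/hasPn => _ /mapP[j _ ->]; apply/mapP => -[].
have sD i : i \in s -> ssm_dom i.
  rewrite mem_cat => /orP[] /mapP[j]; rewrite mem_iota add0n ?ltnS => jN -> //=.
  by rewrite (leq_trans (ltnW jN)).
have ks : inr k \notin s.
  rewrite mem_cat; apply/orP => -[] /mapP[j //].
  by rewrite mem_iota add0n => jk [kj]; rewrite kj ltnn in jk.
have c1 := ssm_sum u v (s := [:: inr k]) isT.
have c2 := ssm_sum u v us sD.
have us3 : uniq (inr k :: s) by rewrite cons_uniq ks us.
have ksD i : i \in inr k :: s -> ssm_dom i by rewrite in_cons => /predU1P[->//|]; exact: sD.
have k1D i : i \in [:: inr k] -> ssm_dom i by rewrite mem_seq1 => /eqP ->.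
have := c1 k1D; have := ssm_sum u v us3 ksD; rewrite big_cons big_seq1.
have e1 w : ssm_term u v (inr k) w = r k w l ord0.
  by rewrite /ssm_term /v eqxx dotv_delta.
have e2 : (fun w => \sum_(i <- s) ssm_term u v i w) =
    (fun w => lcomb (idx N.+1 n) c (coord ssm_noise) w + lcomb (idx k m) e (coord r) w).
  apply/funext => w; rewrite big_cat !big_map/= !lcomb_col; congr (_ + _).
  by apply: eq_big_seq => j; rewrite mem_iota add0n => jk; rewrite /v ltn_eqF.
rewrite (_ : (fun w => \sum_(i <- inr k :: s) _) = (fun w => r k w l ord0 +
    (lcomb (idx N.+1 n) c (coord ssm_noise) w + lcomb (idx k m) e (coord r) w))); last first.
  by apply/funext => w; rewrite big_cons e1; congr (_ + _); have := congr1 (fun f => f w) e2.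
rewrite (_ : (fun w => \sum_(i <- [:: inr k]) _) = (fun w => r k w l ord0)); last first.
  by apply/funext => w; rewrite big_seq1 e1.
by rewrite e2 in c2 => c3 c1'; exact: cnormal_orth c1' c2 c3.
Qed.

End state_space_model.

(** * Projection on spans of finite families *)

Section vector_projection.
Context {R : realType} {d : measure_display} {T : measurableType d}.
Variable P : probability T R.

Lemma ip_lspan (I : eqType) (s : seq I) (V : I -> T -> R) X Y :
  (forall i, i \in s -> L2 P (V i)) -> L2 P X ->
  (forall i, i \in s -> ip P X (V i) = 0) -> lspan s V Y -> ip P X Y = 0.
Proof.
move=> LV LX X0 [c ->].
pose V' i := if i \in s then V i else fun=> 0.
have -> : lcomb s c V = lcomb s c V'.
  by apply/funext => w; apply: eq_big_seq => i si; rewrite /V' si.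
apply: ip_lcombr => //; last by move=> i si; rewrite /V' si; exact: X0.
by move=> i; rewrite /V'; case: ifP => [/LV//|_]; exact: L2_cst.
Qed.

Lemma span_projection (I : eqType) (s : seq I) (V : I -> T -> R) X :
  uniq s -> (forall i, i \in s -> L2 P (V i)) -> L2 P X ->
  exists c : I -> R, forall Y, lspan s V Y -> ip P (fun w => X w - lcomb s c V w) Y = 0.
Proof.
move=> us LV LX.
pose V' i := if i \in s then V i else fun=> 0.
have LV' i : L2 P (V' i) by rewrite /V'; case: ifP => [/LV//|_]; exact: L2_cst.
have [c Hc] := projection_exists us LV' LX.
exists c => Y SY.
have VE : lcomb s c V = lcomb s c V'.
  by apply/funext => w; apply: eq_big_seq => i si; rewrite /V' si.
rewrite VE; apply: (ip_lspan LV _ _ SY).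
  by apply: L2B => //; exact: L2_lcomb.
by move=> i si; have := Hc i si; rewrite /V' si.
Qed.

Lemma vector_projection (I : eqType) (s : seq I) (V : I -> T -> R) p (Z : T -> 'cV[R]_p) :
  uniq s -> (forall i, i \in s -> L2 P (V i)) -> (forall i, L2 P (fun w => Z w i ord0)) ->
  exists c : 'I_p -> I -> R, forall i Y, lspan s V Y ->
    ip P (fun w => Z w i ord0 - lcomb s (c i) V w) Y = 0.
Proof.
move=> us LV LZ.
have [c Hc] := choice (fun i => span_projection us LV (LZ i)).
by exists c => i Y; exact: Hc.
Qed.

End vector_projection.

(** * Innovation representation *)

Section gaussian_representation.
Context {R : realType} {d : measure_display} {T : measurableType d}.
Variable P : probability T R.
Variables (n m N : nat) (C : nat -> 'M[R]_(m, n)).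
Variables (x : nat -> T -> 'cV[R]_n) (y r : nat -> T -> 'cV[R]_m) (J : nat -> T -> 'cV[R]_n).
Variables (V : set (T -> R)) (gV : gspace P V).

Notation cx k i := (fun w => x k w i ord0).
Notation cy k i := (fun w => y k w i ord0).
Notation cr k i := (fun w => r k w i ord0).
Notation cJ k i := (fun w => J k w i ord0).
Notation Sx K := (lspan (idx K n) (coord x)).
Notation Sy K := (lspan (idx K m) (coord y)).
Notation SJ K := (lspan (idx K n) (coord J)).

Hypothesis Vx : forall k i, (k <= N)%N -> V (cx k i).
Hypothesis Vy : forall k i, (k <= N)%N -> V (cy k i).
Hypothesis Vr : forall k i, (k <= N)%N -> V (cr k i).
(** The decomposition of [J_k] into a combination of the observations up to time [k] and a noise
    orthogonal to the whole model, in the form that the coupling provides. *)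
Hypothesis Jdec : forall k i, (k <= N)%N -> exists t v,
  [/\ Sy k.+1 t, V v, cJ k i = (fun w => t w + v w),
      forall X, Sy N.+1 X -> ip P v X = 0 & forall X, Sx N.+1 X -> ip P v X = 0].
Hypothesis Jorth : forall j k i l, (j <= N)%N -> (k <= N)%N -> j != k ->
  ip P (cJ j i) (cJ k l) = 0.
Hypothesis yE : forall k w, (k <= N)%N -> y k w = C k *m x k w + r k w.
Hypothesis yr : forall k j i l, (k <= N)%N -> (j < k)%N -> ip P (cr k l) (cy j i) = 0.

Let sV : fun_submod V := gV.1.

Lemma Sx_sub K : (K <= N.+1)%N -> Sx K `<=` V.
Proof.
by move=> KN; apply: lspan_coord_sub => // j i jK; apply: Vx; rewrite -ltnS (leq_trans jK).
Qed.

Lemma Sy_sub K : (K <= N.+1)%N -> Sy K `<=` V.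
Proof.
by move=> KN; apply: lspan_coord_sub => // j i jK; apply: Vy; rewrite -ltnS (leq_trans jK).
Qed.

Lemma VJ k i : (k <= N)%N -> V (cJ k i).
Proof.
move=> kN; have [t [v [St Vv -> _ _]]] := Jdec i kN.
by apply: submodD => //; exact: (@Sy_sub k.+1).
Qed.

Lemma SJ_sub K : (K <= N.+1)%N -> SJ K `<=` V.
Proof.
by move=> KN; apply: lspan_coord_sub => // j i jK; apply: VJ; rewrite -ltnS (leq_trans jK).
Qed.

Let LV X : V X -> L2 P X := gspace_L2 gV (X := X).

(** The variables satisfying the hypothesis of [gspace_cond_indep]; they form a linear space, so
    coordinates suffice. *)
Definition decomposable (S0 S2 : set (T -> R)) : set (T -> R) :=
  [set U | exists t v, [/\ S0 t, V v, U = (fun w => t w + v w),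
     forall X, S0 X -> ip P v X = 0 & forall X, S2 X -> ip P v X = 0]].

Lemma decomposableP S0 S2 : fun_submod S0 -> S0 `<=` V -> S2 `<=` V ->
  fun_submod (decomposable S0 S2).
Proof.
move=> sS0 S0V S2V; split.
  exists (fun=> 0), (fun=> 0); split; [exact: submod0|exact: submod0| | |].
  - by apply/funext => w; rewrite addr0.
  - by move=> X _; rewrite ip0l.
  - by move=> X _; rewrite ip0l.
move=> a _ _ [t [v [St Vv -> v0 v2]]] [t' [v' [St' Vv' -> v0' v2']]].
exists (fun w => a * t w + t' w), (fun w => a * v w + v' w).
have ipE X : V X -> ip P (fun w => a * v w + v' w) X = a * ip P v X + ip P v' X.
  move=> VX; rewrite ipDl ?ipZl//; try exact: LV.
  by apply: L2Z; exact: LV.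
split; [exact: sS0.2|exact: sV.2| | |].
- by apply/funext => w; ring.
- by move=> X SX; rewrite ipE ?v0 ?v0' ?mulr0 ?addr0//; exact: S0V.
- by move=> X SX; rewrite ipE ?v2 ?v2' ?mulr0 ?addr0//; exact: S2V.
Qed.

Lemma cond_indep_state :
  cond_indep P <<s ev_fam J [set k | (k <= N)%N] >> <<s ev_fam x [set k | (k <= N)%N] >>
    <<s ev_fam y [set k | (k <= N)%N] >>.
Proof.
rewrite (_ : [set k | (k <= N)%N] = [set k | (k < N.+1)%N]); last first.
  by apply/seteqP; split => k /=; rewrite ltnS.
rewrite !sigma_ev_fam.
have d1 := decomposableP (lspanP (idx N.+1 m) (coord y)) (@Sy_sub N.+1 (leqnn _))
  (@Sx_sub N.+1 (leqnn _)).
apply: (gspace_cond_indep gV (S0 := Sy N.+1) (S1 := SJ N.+1) (S2 := Sx N.+1)) => //;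
  try exact: lspanP.
- exact: Sy_sub.
- exact: SJ_sub.
- exact: Sx_sub.
- apply: lspan_coord_sub => // j i jN.
  have [t [v [St Vv Je v0 v2]]] := Jdec i (jN : (j <= N)%N).
  by exists t, v; split => //; apply: lspanS St.
Qed.

Lemma rv_events_span p (Z : T -> 'cV[R]_p) :
  rv_events Z `<=` sigma_fun (lspan (enum 'I_p) (fun i w => Z w i ord0)).
Proof.
apply: rv_events_sub; first exact: sigma_fun_algebra.
move=> i; apply: sigma_fun_meas.
by apply: (lspan_mem (fun i w => Z w i ord0)); rewrite ?enum_uniq ?mem_enum.
Qed.

(** Given the observations up to [k], only the noise part of [J_k] is random, and it is orthogonal
    to every observation. *)
Lemma cond_indep_causal k l : (k + l <= N)%N ->
  cond_indep P (rv_events (J k)) (rv_events (y (k + l)%N))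
    <<s ev_fam y [set j | (j <= k)%N] >>.
Proof.
move=> klN; have kN := leq_trans (leq_addr l k) klN.
rewrite (_ : [set j | (j <= k)%N] = [set j | (j < k.+1)%N]); last first.
  by apply/seteqP; split => j /=; rewrite ltnS.
rewrite sigma_ev_fam.
have SlV : lspan (enum 'I_m) (fun i w => y (k + l)%N w i ord0) `<=` Sy N.+1.
  by apply: lspan_sub; [exact: lspanP|move=> i _; exact: coord_span].
have SyV := @Sy_sub N.+1 (leqnn _).
apply: (gspace_cond_indep gV (S0 := Sy k.+1)
  (S1 := lspan (enum 'I_n) (fun i w => J k w i ord0))
  (S2 := lspan (enum 'I_m) (fun i w => y (k + l)%N w i ord0)));
  try exact: lspanP; try exact: rv_events_span.
- exact: Sy_sub.
- by apply: lspan_sub => // i _; exact: VJ.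
- exact: subset_trans SlV SyV.
- apply: lspan_sub.
    by apply: decomposableP; [exact: lspanP|exact: Sy_sub|exact: subset_trans SlV SyV].
  move=> i _; have [t [v [St Vv Je v0 v2]]] := Jdec i kN.
  exists t, v; split => //.
    by move=> X SX; apply: v0; apply: lspanS SX.
  by move=> X SX; apply: v0; exact: SlV.
Qed.

Lemma cond_expectation_exists k : (k <= N)%N -> exists X : T -> 'cV[R]_n,
  forall i, Sy k (fun w => X w i ord0) /\
    forall Y, Sy k Y -> ip P (fun w => x k w i ord0 - X w i ord0) Y = 0.
Proof.
move=> kN.
have Ly a : a \in idx k m -> L2 P (coord y a).
  by case: a => j i; rewrite mem_idx => /= jk; apply: LV; apply: Vy; exact: leq_trans (ltnW jk) kN.
have [c Hc] := vector_projection (idx_uniq k m) Ly (fun i => LV (Vx i kN)).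
exists (fun w => \col_i lcomb (idx k m) (c i) (coord y) w) => i; split.
  by exists (c i); apply/funext => w; rewrite mxE.
by move=> Y SY; rewrite -[RHS](Hc i Y SY); congr ip; apply/funext => w; rewrite mxE.
Qed.

(** * Orthogonality of the innovations *)

Section innovation.
Variable xs : nat -> T -> 'cV[R]_n.
Hypothesis xsE : forall k, (k <= N)%N -> forall i, Sy k (fun w => xs k w i ord0) /\
    forall Y, Sy k Y -> ip P (fun w => x k w i ord0 - xs k w i ord0) Y = 0.

Notation inno := (innov C y xs).
Notation cI k i := (fun w => inno k w i ord0).

Lemma Sy0 Y : Sy 0 Y -> Y = fun=> 0.
Proof. by move=> [c ->]; apply/funext => w; rewrite /lcomb big_nil. Qed.

Lemma inno_coord k i : (k <= N)%N -> (0 < k)%N ->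
  cI k i = (fun w => cy k i w - \sum_(l < n) C k i l * xs k w l ord0).
Proof. by case: k => // k kN _; apply/funext => w; rewrite /innov/= !mxE. Qed.

Lemma inno_span k i : (k <= N)%N -> Sy k.+1 (cI k i).
Proof.
move=> kN; have [->|k0] := posnP k; first exact: (coord_span y (j := 0%N)).
rewrite inno_coord//; apply: submodB; [exact: lspanP|exact: coord_span|].
apply: submod_sum => [|l _]; first exact: lspanP.
apply: submodZ; first exact: lspanP.
by have [SX _] := xsE kN l; apply: lspanS SX.
Qed.

Lemma Vinno k i : (k <= N)%N -> V (cI k i).
Proof. by move=> kN; apply: (@Sy_sub k.+1) => //; exact: inno_span. Qed.

(** The innovation is [r_k] plus [C_k] times the prediction error; the noise is orthogonal to
    earlier observations by the model and the error by projection. At time 0 the span of earlier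
    observations is zero. *)
Lemma inno_orth k i Y : (k <= N)%N -> Sy k Y -> ip P (cI k i) Y = 0.
Proof.
move=> kN; have [->|k0] := posnP k; first by move=> /Sy0 ->; rewrite ipC ip0l.
move=> SY; have VYY : V Y by apply: (@Sy_sub k) => //; exact: leqW.
rewrite inno_coord// (_ : (fun w => _) =
    (fun w => cr k i w + \sum_(l < n) C k i l * (x k w l ord0 - xs k w l ord0))); last first.
  apply/funext => w; rewrite yE// !mxE.
  under [in RHS]eq_bigr do rewrite mulrBr.
  by rewrite sumrB; ring.
have VX l : V (fun w => x k w l ord0 - xs k w l ord0).
  apply: submodB => //; first exact: Vx.
  by have [SX _] := xsE kN l; apply: (@Sy_sub k) => //; exact: leqW.
have L1 l : L2 P (fun w => C k i l * (x k w l ord0 - xs k w l ord0)) by apply: L2Z; exact: LV.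
rewrite ipDl; [|exact/LV/Vr|by apply: L2_sum|exact: LV].
rewrite ip_suml//; last exact: LV.
rewrite big1 ?addr0; last first.
  move=> l _; rewrite ipZl; [|exact: LV|exact: LV].
  by have [_ ->] := xsE kN l; rewrite ?mulr0.
apply: (ip_lspan _ _ _ SY).
- by case=> j l; rewrite mem_idx => /= jk; apply/LV/Vy; exact: leq_trans (ltnW jk) kN.
- exact/LV/Vr.
- by case=> j l; rewrite mem_idx => /= jk; exact: yr.
Qed.

(** [J_j] is a combination of observations before time [k] plus a noise orthogonal to all
    observations, hence to the innovation. *)
Lemma inno_orth_J k j i l : (k <= N)%N -> (j < k)%N -> ip P (cI k i) (cJ j l) = 0.
Proof.
move=> kN jk; have jN : (j <= N)%N by exact: leq_trans (ltnW jk) kN.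
have [t [v [St Vv -> v0 _]]] := Jdec l jN.
have St' : Sy k t by apply: lspanS St.
have Vt : V t by apply: (@Sy_sub j.+1).
rewrite ipDr; [|exact: LV|exact: LV|exact/LV/Vinno].
rewrite inno_orth// add0r ipC; apply: v0.
by apply: lspanS (inno_span i kN).
Qed.

(** Innovations span the observations: [y_j] is [I_j] plus a combination of earlier observations, so
    strong induction applies. *)
Lemma orth_obs f : V f -> (forall j i, (j <= N)%N -> ip P f (cI j i) = 0) ->
  forall Y, Sy N.+1 Y -> ip P f Y = 0.
Proof.
move=> Vf fI.
have fy j : (j <= N)%N -> forall i, ip P f (cy j i) = 0.
  elim/ltn_ind: j => j ih jN i.
  have fS Y : Sy j Y -> ip P f Y = 0.
    apply: ip_lspan; [|exact: LV|].
      by case=> t l; rewrite mem_idx => /= tj; apply/LV/Vy; exact: leq_trans (ltnW tj) jN.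
    by case=> t l; rewrite mem_idx => /= tj; apply: ih => //; exact: leq_trans (ltnW tj) jN.
  have [j0|j0] := posnP j; first by have := fI j i jN; rewrite j0.
  have SX : Sy j (fun w => \sum_(l < n) C j i l * xs j w l ord0).
    apply: submod_sum => [|l _]; first exact: lspanP.
    by apply: submodZ; [exact: lspanP|have [] := xsE jN l].
  have VX : V (fun w => \sum_(l < n) C j i l * xs j w l ord0).
    by apply: (@Sy_sub j) => //; exact: leqW.
  rewrite (_ : cy j i = (fun w => cI j i w + \sum_(l < n) C j i l * xs j w l ord0)); last first.
    apply/funext => w; have /(congr1 (fun f => f w)) /= -> := inno_coord i jN j0.
    by rewrite subrK.
  by rewrite ipDr; [rewrite fI// fS// addr0|exact/LV/Vinno|exact: LV|exact: LV].
move=> Y; apply: ip_lspan; [|exact: LV|].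
  by case=> t l; rewrite mem_idx => /= tj; apply/LV/Vy.
by case=> t l; rewrite mem_idx => /= tj; exact: fy.
Qed.

Lemma estimate_exists k j : (j < k)%N -> (k <= N)%N -> exists E : T -> 'cV[R]_m,
  forall i, SJ k (fun w => E w i ord0) /\
    forall Y, SJ k Y -> ip P (fun w => inno j w i ord0 - E w i ord0) Y = 0.
Proof.
move=> jk kN; have jN : (j <= N)%N by exact: leq_trans (ltnW jk) kN.
have Ly a : a \in idx k n -> L2 P (coord J a).
  by case: a => t i; rewrite mem_idx => /= tk; apply/LV/VJ; exact: leq_trans (ltnW tk) kN.
have [c Hc] := vector_projection (idx_uniq k n) Ly (fun i => LV (Vinno i jN)).
exists (fun w => \col_i lcomb (idx k n) (c i) (coord J) w) => i; split.
  by exists (c i); apply/funext => w; rewrite mxE.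
by move=> Y SY; rewrite -[RHS](Hc i Y SY); congr ip; apply/funext => w; rewrite mxE.
Qed.

(** * Regression of [J_k] on the innovation and upsilon *)

Section noise.
Variable e : nat -> nat -> T -> 'cV[R]_m.
Hypothesis eE : forall k j, (j < k)%N -> (k <= N)%N -> forall i, SJ k (fun w => e k j w i ord0) /\
    forall Y, SJ k Y -> ip P (fun w => inno j w i ord0 - e k j w i ord0) Y = 0.

(* Indexed by (j, i): the i-th entry of the innovation at time k if j = k, and of the
   j-th block of upsilon_k if j < k. *)
Definition regressor k (a : nat * 'I_m) : T -> R :=
  fun w => if a.1 == k then inno k w a.2 ord0 else inno a.1 w a.2 ord0 - e k a.1 w a.2 ord0.

Lemma Vestimate k j i : (j < k)%N -> (k <= N)%N -> V (fun w => e k j w i ord0).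
Proof.
move=> jk kN; have [SE _] := eE jk kN i.
by apply: (@SJ_sub k) => //; exact: leqW.
Qed.

Lemma Vregressor k a : (k <= N)%N -> a \in idx k.+1 m -> V (regressor k a).
Proof.
case: a => j i kN; rewrite mem_idx/= ltnS leq_eqVlt /regressor/=.
case: eqP => [->|_ /= jk]; first by move=> _; exact: Vinno.
apply: submodB => //; last exact: Vestimate.
by apply: Vinno; exact: leq_trans (ltnW jk) kN.
Qed.

(** The matrices are blocks of the coefficients of the projection of [J_k] on the regressors: the
    block of time [k] is [pi], those of earlier times form [phi]. *)
Lemma noise_exists k : (k <= N)%N -> exists (pi : 'M[R]_(n, m)) (phi : nat -> 'M[R]_(n, m)),
  let w o := J k o - pi *m inno k o -
    \sum_(j < k) phi (nat_of_ord j) *m (inno j o - e k j o) in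
  forall i, lspan (idx k.+1 m) (regressor k) (fun o => cJ k i o - w o i ord0) /\
    forall a, a \in idx k.+1 m -> ip P (fun o => w o i ord0) (regressor k a) = 0.
Proof.
move=> kN.
have Lr a : a \in idx k.+1 m -> L2 P (regressor k a) by move=> ak; apply/LV/Vregressor.
have [c Hc] := vector_projection (idx_uniq k.+1 m) Lr (fun i => LV (VJ i kN)).
exists (\matrix_(i, l) c i (k, l)), (fun j => \matrix_(i, l) c i (j, l)) => w i.
have wE : (fun o => w o i ord0) = (fun o => cJ k i o - lcomb (idx k.+1 m) (c i) (regressor k) o).
  apply/funext => o.
  have subE (X Y : 'cV[R]_n) : (X - Y) i ord0 = X i ord0 - Y i ord0 by rewrite !mxE.
  rewrite /w !subE lcomb_idx big_ord_recr/= opprD addrA [LHS]addrAC; congr (_ - _ - _).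
    by rewrite summxE; apply: eq_bigr => j _; rewrite mxE; apply: eq_bigr => l _;
      rewrite /regressor/= ltn_eqF// !mxE.
  by rewrite mxE; apply: eq_bigr => l _; rewrite mxE /regressor eqxx.
split.
  exists (c i); apply/funext => o.
  by have /(congr1 (fun f => f o)) /= -> := wE; rewrite opprB addrCA subrr addr0.
move=> a ak; rewrite wE; apply: Hc.
by apply: lspan_mem => //; exact: idx_uniq.
Qed.

(** * Whiteness and independence of the residuals *)

Section whiteness.
Variable w : nat -> T -> 'cV[R]_n.
Hypothesis wE : forall k, (k <= N)%N -> forall i,
  lspan (idx k.+1 m) (regressor k) (fun o => cJ k i o - w k o i ord0) /\
  forall a, a \in idx k.+1 m -> ip P (fun o => w k o i ord0) (regressor k a) = 0.

Notation cw k i := (fun o => w k o i ord0).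

Lemma whiteE k i : cw k i = (fun o => cJ k i o - (cJ k i o - cw k i o)).
Proof. by apply/funext => o; rewrite opprB addrCA subrr addr0. Qed.

Lemma regressor_span k a : (k <= N)%N -> a \in idx k.+1 m ->
  add_submod (Sy N.+1) (SJ k) (regressor k a).
Proof.
have sS : fun_submod (add_submod (Sy N.+1) (SJ k)) by apply: add_submodP; exact: lspanP.
case: a => j i kN; rewrite mem_idx/= ltnS leq_eqVlt /regressor/=.
case: eqP => [->|_ /= jk].
  by move=> _; apply: sub_add_submodl; [exact: lspanP|apply: lspanS (inno_span i kN)].
have jN : (j <= N)%N by exact: leq_trans (ltnW jk) kN.
apply: submodB => //.
  by apply: sub_add_submodl; [exact: lspanP|apply: lspanS (inno_span i jN)].
by apply: sub_add_submodr; [exact: lspanP|have [] := eE jk kN i].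
Qed.

Lemma white_span k i : (k <= N)%N -> add_submod (Sy N.+1) (SJ k.+1) (cw k i).
Proof.
move=> kN; rewrite whiteE; have [SW _] := wE kN i.
have sS : fun_submod (add_submod (Sy N.+1) (SJ k.+1)) by apply: add_submodP; exact: lspanP.
apply: submodB => //.
  by apply: sub_add_submodr; [exact: lspanP|exact: coord_span].
have SR : lspan (idx k.+1 m) (regressor k) `<=` add_submod (Sy N.+1) (SJ k.+1).
  apply: lspan_sub => // a ak; have [U [W [SU SWW ->]]] := regressor_span kN ak.
  by exists U, W; split => //; apply: lspanS SWW.
exact: SR.
Qed.

Lemma add_span_sub K : (K <= N.+1)%N -> add_submod (Sy N.+1) (SJ K) `<=` V.
Proof.
move=> KN _ [U [W [SU SW ->]]]; apply: submodD => //.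
  by apply: (@Sy_sub N.+1).
by apply: (@SJ_sub K).
Qed.

Lemma Vwhite k i : (k <= N)%N -> V (cw k i).
Proof. by move=> kN; apply: (@add_span_sub k.+1) => //; exact: white_span. Qed.

Lemma SJ_orth k f Y : V f -> (k <= N.+1)%N ->
  (forall j l, (j < k)%N -> ip P f (cJ j l) = 0) -> SJ k Y -> ip P f Y = 0.
Proof.
move=> Vf kN fJ; apply: ip_lspan; [|exact: LV|].
  by case=> j l; rewrite mem_idx => /= jk; apply/LV/VJ; rewrite -ltnS (leq_trans jk).
by case=> j l; rewrite mem_idx => /= jk; exact: fJ.
Qed.

(** The current innovation is orthogonal to earlier [J_j] by causality, and upsilon by construction,
    as the residual of a projection on them. *)
Lemma regressor_orth_J k a j l : (k <= N)%N -> a \in idx k.+1 m -> (j < k)%N ->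
  ip P (regressor k a) (cJ j l) = 0.
Proof.
case: a => t i kN; rewrite mem_idx/= ltnS leq_eqVlt /regressor/=.
case: eqP => [-> _|_ /= tk] jk; first exact: inno_orth_J.
by have [_ ->] := eE tk kN i; last exact: coord_span.
Qed.

(** [w_k] is [J_k] minus a combination of regressors; [J_k] is uncorrelated with the earlier [J_j],
    and so is each regressor. *)
Lemma white_orth_J k i Y : (k <= N)%N -> SJ k Y -> ip P (cw k i) Y = 0.
Proof.
move=> kN; apply: SJ_orth; [exact: Vwhite|exact: leqW|] => j l jk.
have jN : (j <= N)%N by exact: leq_trans (ltnW jk) kN.
have [SW _] := wE kN i.
have LR a : a \in idx k.+1 m -> L2 P (regressor k a) by move=> ak; exact/LV/Vregressor.
have VW : V (fun o => cJ k i o - cw k i o) by apply: submodB => //; [exact: VJ|exact: Vwhite].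
rewrite whiteE ipBl; [|exact/LV/VJ|exact: LV|exact/LV/VJ].
rewrite Jorth//; last by rewrite gtn_eqF.
rewrite sub0r ipC (ip_lspan LR _ _ SW) ?oppr0//; first exact/LV/VJ.
by move=> a ak; rewrite ipC; exact: regressor_orth_J.
Qed.

(** For [j < k], [I_j] is a regressor plus a combination of earlier [J]'s, and [w_k] is orthogonal
    to both. For [j > k], [I_j] is orthogonal to all that [w_k] is made of. For [j = k], [I_j] is
    itself a regressor. *)
Lemma white_orth_inno k i j l : (k <= N)%N -> (j <= N)%N -> ip P (cw k i) (cI j l) = 0.
Proof.
move=> kN jN; have [SW wR] := wE kN i.
have LR a : a \in idx k.+1 m -> L2 P (regressor k a) by move=> ak; exact/LV/Vregressor.
have [jk|kj|jk] := ltngtP j k.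
- have VE := Vestimate l jk kN; have [SE _] := eE jk kN l.
  have jR : (j, l) \in idx k.+1 m by rewrite mem_idx/= ltnS ltnW.
  have -> : cI j l = (fun o => regressor k (j, l) o + e k j o l ord0).
    by apply/funext => o; rewrite /regressor/= ltn_eqF// subrK.
  rewrite ipDr; [|exact: LR|exact: LV|exact/LV/Vwhite].
  by rewrite wR// white_orth_J// addr0.
- have Vj := Vinno l jN.
  have IS Y : Sy j Y -> ip P (cI j l) Y = 0 by exact: inno_orth.
  rewrite whiteE ipBl; [| exact/LV/VJ|apply: L2B; [exact/LV/VJ|exact/LV/Vwhite]|exact: LV].
  rewrite ipC inno_orth_J// sub0r ipC (ip_lspan LR _ _ SW) ?oppr0//; first exact: LV.
  case=> t l'; rewrite mem_idx/= ltnS leq_eqVlt /regressor/=.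
  case: eqP => [-> _|_ /= tk].
    by apply: IS; apply: lspanS (inno_span l' kN).
  have tN : (t <= N)%N by exact: leq_trans (ltnW tk) kN.
  have VE := Vestimate l' tk kN; have [SE _] := eE tk kN l'.
  rewrite ipBr; [|exact/LV/Vinno|exact: LV|exact: LV].
  rewrite IS; last by apply: lspanS (inno_span l' tN); exact: ltn_trans kj.
  rewrite (SJ_orth Vj (leqW kN) _ SE) ?subr0// => t' i' tk'.
  by apply: inno_orth_J => //; exact: ltn_trans kj.
- rewrite jk; have kR : (k, l) \in idx k.+1 m by rewrite mem_idx/=.
  by rewrite -[RHS](wR _ kR); congr ip; apply/funext => o; rewrite /regressor/= eqxx.
Qed.

Lemma white_orth_obs k i Y : (k <= N)%N -> Sy N.+1 Y -> ip P (cw k i) Y = 0.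
Proof.
move=> kN; apply: orth_obs; first exact: Vwhite.
by move=> j l jN; exact: white_orth_inno.
Qed.

Lemma white_orth_add k i Y : (k <= N)%N -> add_submod (Sy N.+1) (SJ k) Y ->
  ip P (cw k i) Y = 0.
Proof.
move=> kN [U [W [SU SW ->]]].
have VU : V U by exact: (@Sy_sub N.+1).
have VW : V W by apply: (@SJ_sub k) => //; exact: leqW.
rewrite ipDr; [|exact: LV|exact: LV|exact/LV/Vwhite].
by rewrite white_orth_obs// white_orth_J// addr0.
Qed.

(** The earlier of the two is a combination of observations and of [J]'s preceding the time of the
    later one, to all of which the later one is orthogonal. *)
Lemma white_orth j k i l : (j <= N)%N -> (k <= N)%N -> j != k -> ip P (cw j i) (cw k l) = 0.
Proof.
have lt j' k' i' l' : (k' <= N)%N -> (j' < k')%N -> ip P (cw k' i') (cw j' l') = 0.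
  move=> kN jk; have jN : (j' <= N)%N by exact: leq_trans (ltnW jk) kN.
  apply: white_orth_add => //.
  have [U [W [SU SW ->]]] := white_span l' jN.
  by exists U, W; split => //; apply: lspanS SW.
move=> jN kN; rewrite neq_ltn => /orP[jk|kj]; last exact: lt.
by rewrite ipC; exact: lt.
Qed.

Lemma white_meas k : (k <= N)%N -> rvec_meas (w k).
Proof. by move=> kN i; have [] := LV (Vwhite i kN). Qed.

Lemma white_gauss k : (k <= N)%N -> exists W : 'M[R]_n, gauss_vec P (w k) 0 W.
Proof.
move=> kN; exists (\matrix_(i, j) (ip P (cw k i) (cw k j) / kappa)) => u.
rewrite dotv0r.
have Vu : V (fun o => dotv u (w k o)).
  by apply: submod_sum => // i _; apply: submodZ => //; exact: Vwhite.
have [_] := gspaceP gV Vu; congr normal_law.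
have Lw i : L2 P (fun o => u i ord0 * w k o i ord0) by apply/L2Z/LV/Vwhite.
rewrite /dotv ip_suml//; last exact: L2_sum.
rewrite mulr_suml; apply: eq_bigr => i _; rewrite mxE.
rewrite ipZl; [|exact/LV/Vwhite|exact: L2_sum].
rewrite ip_sumr//; last exact/LV/Vwhite.
rewrite -mulrA mulr_suml; congr (_ * _); apply: eq_bigr => j _.
by rewrite mxE ipZr; [ring|exact/LV/Vwhite|exact/LV/Vwhite].
Qed.

Lemma white_indep2 k : (k <= N)%N -> indep2 P (rv_events (w k))
  <<s ev_fam y [set j | (j <= N)%N] `|` ev_fam J [set i | (i < k)%N] >>.
Proof.
move=> kN A B EA FB.
have sS : fun_submod (add_submod (Sy N.+1) (SJ k)) by apply: add_submodP; exact: lspanP.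
have S1V : lspan (enum 'I_n) (fun i o => w k o i ord0) `<=` V.
  by apply: lspan_sub => // i _; exact: Vwhite.
apply: (gspace_indep gV (lspanP _ _) sS S1V (add_span_sub (leqW kN))).
- move=> X Y SX SY; have VY : V Y by apply: (@add_span_sub k) => //; exact: leqW.
  rewrite ipC; apply: (ip_lspan _ _ _ SX).
  + by move=> i _; exact/LV/Vwhite.
  + exact: LV.
  + by move=> i _; rewrite ipC; exact: white_orth_add.
- exact: rv_events_span.
- move: B FB; apply: smallest_sub; first exact: sigma_fun_algebra.
  move=> B [|]; apply: ev_fam_sub => j i /= jN.
    by apply: sub_add_submodl; [exact: lspanP|exact: coord_span].
  by apply: sub_add_submodr; [exact: lspanP|exact: coord_span].
Qed.

Lemma white_mutual_indep : mutual_indep P [set k | (k <= N)%N] (fun k => rv_events (w k)).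
Proof.
elim=> [_ _ B _|k s ih us Ds B EB]; first by rewrite !big_nil probability_setT.
have kN : (k <= N)%N by apply: Ds; rewrite mem_head.
have sN j : j \in s -> (j <= N)%N by move=> js; apply: Ds; rewrite in_cons js orbT.
have /andP[ks us'] := us.
rewrite !big_cons -(ih us' sN B); last by move=> i si; apply: EB; rewrite in_cons si orbT.
pose s2 := [seq (j, i) | j <- s, i <- enum 'I_n].
have s2P a : a \in s2 -> a.1 \in s by move=> /allpairsP[[j i] /= [js _ ->]].
have S1V : lspan (enum 'I_n) (fun i o => w k o i ord0) `<=` V.
  by apply: lspan_sub => // i _; exact: Vwhite.
have S2V : lspan s2 (coord w) `<=` V.
  by apply: lspan_sub => // a /s2P/sN; exact: Vwhite.
apply: (gspace_indep gV (lspanP _ _) (lspanP _ _) S1V S2V).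
- move=> X Y SX SY; rewrite ipC; apply: (ip_lspan _ _ _ SX).
  + by move=> i _; exact/LV/Vwhite.
  + by apply: LV; exact: S2V.
  + move=> i _; rewrite ipC; apply: (ip_lspan _ _ _ SY).
    * by move=> a /s2P/sN; move=> h; exact/LV/Vwhite.
    * exact/LV/Vwhite.
    * case=> j l /s2P /= js; apply: white_orth => //; first exact: sN.
      by apply: contraNneq ks => ->.
- by apply: rv_events_span; apply: EB; rewrite mem_head.
- have us2 : uniq s2.
    apply: allpairs_uniq => //; first exact: enum_uniq.
    by move=> [? ?] [? ?] _ _ /= [-> ->].
  have : forall j, j \in s -> sigma_fun (lspan s2 (coord w)) (B j).
    move=> j js; have Ej : rv_events (w j) (B j) by apply: EB; rewrite in_cons js orbT.
    apply: rv_events_sub Ej; first exact: sigma_fun_algebra.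
    move=> i; apply: sigma_fun_meas; apply: (lspan_mem (coord w) (i := (j, i))) => //.
    by apply/allpairsP; exists (j, i); rewrite /= js mem_enum.
  move=> h; rewrite big_seq; elim/big_ind: _ => //.
  + exact: sigma_algebra_setT (sigma_fun_algebra _).
  + by move=> A1 A2; apply: sigma_algebra_setI; exact: sigma_fun_algebra.
Qed.

End whiteness.
End noise.
End innovation.

Lemma innovation_representation :
  exists (pi : nat -> 'M[R]_(n, m)) (phi : nat -> nat -> 'M[R]_(n, m))
         (w xs : nat -> T -> 'cV[R]_n) (e : nat -> nat -> T -> 'cV[R]_m),
    (forall k, (1 <= k <= N)%N ->
       cexp P (<<s ev_fam y [set j | (j < k)%N] >>) (x k) (xs k)) /\
    (forall k j, (j < k <= N)%N ->
       cexp P (<<s ev_fam J [set i | (i < k)%N] >>) (innov C y xs j) (e k j)) /\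
    (forall k, (k <= N)%N -> rvec_meas (w k) /\
       exists W : 'M[R]_n, gauss_vec P (w k) 0 W) /\
    mutual_indep P [set k | (k <= N)%N] (fun k => rv_events (w k)) /\
    (forall k, (k <= N)%N ->
       indep2 P (rv_events (w k))
         (<<s ev_fam y [set j | (j <= N)%N] `|` ev_fam J [set i | (i < k)%N] >>)) /\
    (forall k, (k <= N)%N ->
       {ae P, forall o, J k o =
          pi k *m innov C y xs k o
          + \sum_(j < k) phi k j *m (innov C y xs j o - e k j o)
          + w k o}).
Proof.
(* The bound on [k] sits inside the existential so that [choice] yields total families; beyond the
   horizon nothing is claimed and 0 is a witness. The pairs below serve the same purpose for [e]. *)
have xs_ex k : exists X : T -> 'cV[R]_n, (k <= N)%N -> forall i,
    Sy k (fun w => X w i ord0) /\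
    forall Y, Sy k Y -> ip P (fun w => x k w i ord0 - X w i ord0) Y = 0.
  case: (leqP k N) => [kN|_]; last by exists (fun=> 0).
  by have [X HX] := cond_expectation_exists kN; exists X.
have [xs xsE] := choice xs_ex.
have e_ex (kj : nat * nat) : exists E : T -> 'cV[R]_m, (kj.2 < kj.1)%N -> (kj.1 <= N)%N ->
    forall i, SJ kj.1 (fun w => E w i ord0) /\
    forall Y, SJ kj.1 Y -> ip P (fun w => innov C y xs kj.2 w i ord0 - E w i ord0) Y = 0.
  case: (leqP kj.1 N) => [kN|_]; last by exists (fun=> 0).
  case: (ltnP kj.2 kj.1) => [jk|_]; last by exists (fun=> 0).
  by have [E HE] := estimate_exists xsE jk kN; exists E.
have [e0 e0E] := choice e_ex; pose e k j := e0 (k, j).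
have eE k j : (j < k)%N -> (k <= N)%N -> forall i, SJ k (fun w => e k j w i ord0) /\
    forall Y, SJ k Y -> ip P (fun w => innov C y xs j w i ord0 - e k j w i ord0) Y = 0.
  exact: (e0E (k, j)).
have w_ex k : exists pp : 'M[R]_(n, m) * (nat -> 'M[R]_(n, m)), (k <= N)%N ->
  let w o := J k o - pp.1 *m innov C y xs k o -
    \sum_(j < k) pp.2 (nat_of_ord j) *m (innov C y xs j o - e k j o) in
  forall i, lspan (idx k.+1 m) (regressor xs e k) (fun o => cJ k i o - w o i ord0) /\
    forall a, a \in idx k.+1 m -> ip P (fun o => w o i ord0) (regressor xs e k a) = 0.
  case: (leqP k N) => [kN|_]; last by exists (0, fun=> 0).
  by have [pi [phi Hw]] := noise_exists xsE eE kN; exists (pi, phi).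
have [pp ppE] := choice w_ex.
pose w k o := J k o - (pp k).1 *m innov C y xs k o -
    \sum_(j < k) (pp k).2 (nat_of_ord j) *m (innov C y xs j o - e k j o).
have wE k : (k <= N)%N -> forall i,
    lspan (idx k.+1 m) (regressor xs e k) (fun o => cJ k i o - w k o i ord0) /\
    forall a, a \in idx k.+1 m -> ip P (fun o => w k o i ord0) (regressor xs e k a) = 0.
  exact: ppE.
exists (fun k => (pp k).1), (fun k => (pp k).2), w, xs, e.
split.
  move=> k /andP[_ kN] i; rewrite sigma_ev_fam; have [SX XE] := xsE k kN i.
  apply: (gspace_cexp1 gV (lspanP _ _)) => //; last exact: Vx.
  by apply: Sy_sub; exact: leqW.
split.
  move=> k j /andP[jk kN] i; rewrite sigma_ev_fam; have [SE EE] := eE k j jk kN i.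
  apply: (gspace_cexp1 gV (lspanP _ _)) => //.
    by apply: SJ_sub; exact: leqW.
  by apply: Vinno => //; exact: leq_trans (ltnW jk) kN.
split.
  move=> k kN; split; first exact: (white_meas xsE eE wE).
  exact: (white_gauss xsE eE wE).
split; first exact: (white_mutual_indep xsE eE wE).
split; first by move=> k kN; exact: (white_indep2 xsE eE wE).
move=> k kN; apply: aeW => o; rewrite /w.
have split3 (a b c : 'cV[R]_n) : a = b + c + (a - b - c) by
  rewrite -[a - b - c]addrA -opprD [X in _ = X]addrC subrK.
exact: split3.
Qed.

End gaussian_representation.

(** * The coupling *)

Section residual_moments.
Context {R : realType} {d : measure_display} {T : measurableType d}.
Variable P : probability T R.

(** [Z] is split into [Z - p] and [p]. The residual [X - L] is orthogonal to [p], a member of [S];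
    conditional independence makes [X] orthogonal to [Z - p], and [L] is so because it lies in
    [S]. *)
Lemma residual_cond_orth (V S F1 F2 : set _) (X Z L p : T -> R) :
  gspace P V -> fun_submod S -> S `<=` V ->
  sigma_algebra setT F1 -> sigma_algebra setT F2 ->
  F1 `<=` measurable -> F2 `<=` measurable ->
  cond_indep P F1 F2 (sigma_fun S) -> sigma_meas F1 X -> sigma_meas F2 Z ->
  L2 P X -> V Z -> S L -> S p ->
  (forall Y, S Y -> ip P (fun w => X w - L w) Y = 0) ->
  (forall Y, S Y -> ip P (fun w => Z w - p w) Y = 0) ->
  ip P (fun w => X w - L w) Z = 0.
Proof.
move=> gV sS SV sF1 sF2 mF1 mF2 ci F1X F2Z LX VZ SL Sp XL Zp.
have LZ := gspace_L2 gV VZ; have LL := gspace_L2 gV (SV _ SL); have Lp := gspace_L2 gV (SV _ Sp).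
have VZp : V (fun w => Z w - p w) by apply: submodB => //; [case: gV|exact: SV].
have LZp := gspace_L2 gV VZp.
have e := cond_indep_orth sF1 sF2 (sigma_fun_algebra S) mF1 mF2
  (sigma_fun_measurable (gspace_meas gV SV)) ci F1X F2Z (sigma_fun_meas Sp) LX LZ Lp
  (gspace_residual gV sS SV VZp Zp).
rewrite (_ : Z = (fun w => (Z w - p w) + p w)); last by apply/funext => w; rewrite subrK.
rewrite (ipDr LZp Lp (L2B LX LL)) (XL _ Sp) addr0 (ipBl LX LL LZp) e.
by rewrite ipC (Zp _ SL) subrr.
Qed.

Lemma integral_sqnorm k (Z : T -> 'cV[R]_k) : (forall i, L2 P (fun w => Z w i ord0)) ->
  (\int[P]_w (sqnorm (Z w))%:E =
   (\sum_(i < k) ip P (fun w => Z w i ord0) (fun w => Z w i ord0))%:E)%E.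
Proof.
move=> LZ; rewrite -Ex_sum; last by move=> i; exact: L2_itgM.
have i1 : itg P (fun w => sqnorm (Z w)) by apply: itg_sum => i; have [] := LZ i.
have := integral_indic_Ex measurableT i1; rewrite /= => ->.
by congr (EFin (Ex P _)); apply/funext => w; rewrite indicT/= mulr1.
Qed.

End residual_moments.

Section estimator.
Context {R : realType}.

(** Coefficient of the scalar indexed by [a] in coordinate [i] of the estimate at time [k]. It does
    not depend on the process, so the costs of [Jc] and of [J] are second moments of the same
    combinations. *)
Fixpoint est_coef n (A : nat -> 'M[R]_n) k (i : 'I_n) (a : nat * 'I_n) : R :=
  match k with
  | 0 => (a == (0%N, i))%:R
  | k'.+1 => \sum_(l < n) A k'.+1 i l * est_coef A k' l a + (a == (k'.+1, i))%:R
  end.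

Lemma est_lcomb d (T : measurableType d) n N (A : nat -> 'M[R]_n) (J : nat -> T -> 'cV[R]_n) k i w :
  (k <= N)%N -> est A J k w i ord0 = lcomb (idx N.+1 n) (est_coef A k i) (coord J) w.
Proof.
have dl j : (j <= N)%N -> forall i', lcomb (idx N.+1 n) (fun a => (a == (j, i'))%:R) (coord J) w =
    J j w i' ord0.
  by move=> jN i'; rewrite lcomb_delta ?idx_uniq ?mem_idx.
elim: k i => [|k ih] i kN; first by rewrite /= dl.
rewrite /= !mxE -(dl k.+1 kN i) /lcomb.
transitivity (\sum_(l < n) A k.+1 i l * lcomb (idx N.+1 n) (est_coef A k l) (coord J) w +
  \sum_(a <- idx N.+1 n) (a == (k.+1, i))%:R * coord J a w).
  by congr (_ + _); apply: eq_bigr => l _; rewrite ih// ltnW.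
rewrite (eq_bigr (fun l => \sum_(a <- idx N.+1 n) A k.+1 i l * est_coef A k l a * coord J a w)); last first.
  by move=> l _; rewrite /lcomb mulr_sumr; apply: eq_bigr => a _; rewrite mulrA.
rewrite exchange_big/= -big_split/=; apply: eq_bigr => a _.
by rewrite mulrDl mulr_suml.
Qed.

End estimator.

Section residuals.
Context {R : realType} {d : measure_display} {T : measurableType d}.
Variable P : probability T R.
Variables (n m N : nat) (A : nat -> 'M[R]_n) (C : nat -> 'M[R]_(m, n)) (P0 : 'M[R]_n)
  (Q : nat -> 'M[R]_n) (Rn : nat -> 'M[R]_m)
  (x q : nat -> T -> 'cV[R]_n) (y r : nat -> T -> 'cV[R]_m) (Jc : nat -> T -> 'cV[R]_n).
Hypothesis H : ssm P N A C P0 Q Rn x q y r.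
Hypothesis mJ : forall k, (k <= N)%N -> rvec_meas (Jc k).
Hypothesis ciJ : cond_indep P (<<s ev_fam Jc [set k | (k <= N)%N] >>)
               (<<s ev_fam x [set k | (k <= N)%N] >>)
               (<<s ev_fam y [set k | (k <= N)%N] >>).
Hypothesis LJ : forall k i, (k <= N)%N -> L2 P (fun w => Jc k w i ord0).
Hypothesis causal : forall k l, (1 <= l)%N -> (k + l <= N)%N ->
     cond_indep P (rv_events (Jc k)) (rv_events (y (k + l)%N))
                  (<<s ev_fam y [set j | (j <= k)%N] >>).

Let V0 := ssm_space x q r N.+1 N.+1.
Let gV0 : gspace P V0 := ssm_gspace H.
Notation Sx K := (lspan (idx K n) (coord x)).
Notation Sy K := (lspan (idx K m) (coord y)).

Lemma ssm_state_space k i : (k <= N)%N -> V0 (fun w => x k w i ord0).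
Proof.
move=> kN; apply: (@ssm_spaceS _ _ _ _ _ x q r k.+1 0) => //.
exact: (ssm_state H i kN).
Qed.

Lemma ssm_obs_space k i : (k <= N)%N -> V0 (fun w => y k w i ord0).
Proof.
move=> kN; apply: (@ssm_spaceS _ _ _ _ _ x q r k.+1 k.+1) => //.
exact: (ssm_obs H i kN).
Qed.

Lemma ssm_state_span : Sx N.+1 `<=` V0.
Proof. by apply: lspan_coord_sub => [|j i]; [exact: ssm_spaceP|rewrite ltnS; exact: ssm_state_space]. Qed.

Lemma ssm_obs_span K : (K <= N.+1)%N -> Sy K `<=` V0.
Proof.
move=> KN; apply: lspan_coord_sub => [|j i jK]; first exact: ssm_spaceP.
by apply: ssm_obs_space; rewrite -ltnS (leq_trans jK).
Qed.

Lemma obs_projection K Z : (K <= N.+1)%N -> L2 P Z ->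
  exists2 L, Sy K L & forall Y, Sy K Y -> ip P (fun w => Z w - L w) Y = 0.
Proof.
move=> KN LZ.
have Ly a : a \in idx K m -> L2 P (coord y a).
  case: a => j i; rewrite mem_idx => /= jk; apply: (gspace_L2 gV0).
  by apply: ssm_obs_space; rewrite -ltnS (leq_trans jk).
have [c Hc] := span_projection (idx_uniq K m) Ly LZ.
by exists (lcomb (idx K m) c (coord y)) => //; exists c.
Qed.

(** Orthogonality comes in three stages: to observations up to [k] by projection, to later ones by
    (ii), to the states by conditional independence given all observations. The second stage shows
    that [L] is also the projection on all observations, as the third requires. *)
Lemma causal_residual k i : (k <= N)%N -> exists L,
  [/\ Sy k.+1 L,
      forall Y, Sy N.+1 Y -> ip P (fun w => Jc k w i ord0 - L w) Y = 0 &
      forall Y, Sx N.+1 Y -> ip P (fun w => Jc k w i ord0 - L w) Y = 0].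
Proof.
move=> kN; have [L SL JL] := obs_projection (K := k.+1) kN (LJ i kN).
have LL : L2 P L by apply: (gspace_L2 gV0); apply: (ssm_obs_span (K := k.+1)).
have LJL : L2 P (fun w => Jc k w i ord0 - L w) by apply: L2B => //; exact: LJ.
have setE K : [set j | (j <= K)%N] = [set j | (j < K.+1)%N].
  by apply/seteqP; split => j /=; rewrite ltnS.
have my j : (j <= N)%N -> rvec_meas (y j).
  by move=> jN l; have [] := gspace_L2 gV0 (ssm_obs_space l jN).
have mx j : (j <= N)%N -> rvec_meas (x j).
  by move=> jN l; have [] := gspace_L2 gV0 (ssm_state_space l jN).
have Jy Y : Sy N.+1 Y -> ip P (fun w => Jc k w i ord0 - L w) Y = 0.
  apply: ip_lspan => //.
    by case=> j l; rewrite mem_idx => /= jN; apply: (gspace_L2 gV0); exact: ssm_obs_space.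
  case=> j l; rewrite mem_idx ltnS => /= jN.
  have [jk|kj] := leqP j k; first by apply: JL; exact: coord_span.
  have VZ := ssm_obs_space l jN.
  have [p Sp Zp] := obs_projection (K := k.+1) kN (gspace_L2 gV0 VZ).
  have jE : j = (k + (j - k))%N by rewrite subnKC// ltnW.
  have jk0 : (1 <= j - k)%N by rewrite subn_gt0.
  have := causal (k := k) jk0; rewrite -jE => cij; have := cij jN; rewrite setE sigma_ev_fam => ci.
  apply: (residual_cond_orth gV0 (lspanP _ _) _ _ _ _ _ ci _ _ (LJ i kN) VZ SL Sp JL Zp).
  - exact: ssm_obs_span.
  - exact: rv_events_sigma.
  - exact: rv_events_sigma.
  - exact/rv_events_measurable/mJ.
  - exact/rv_events_measurable/my.
  - exact: rv_events_coord.
  - exact: rv_events_coord.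
exists L; split => // Y.
apply: ip_lspan => //.
  by case=> j l; rewrite mem_idx => /= jN; apply: (gspace_L2 gV0); exact: ssm_state_space.
case=> j l; rewrite mem_idx ltnS => /= jN.
have VZ := ssm_state_space l jN.
have [p Sp Zp] := obs_projection (leqnn N.+1) (gspace_L2 gV0 VZ).
have SL' : Sy N.+1 L by apply: lspanS SL.
have ci := ciJ; rewrite setE [in X in cond_indep _ _ _ X]sigma_ev_fam in ci.
have fam_meas p' (Z : nat -> T -> 'cV[R]_p') : (forall t, (t <= N)%N -> rvec_meas (Z t)) ->
    <<s ev_fam Z [set t | (t < N.+1)%N] >> `<=` measurable.
  move=> mZ; apply: smallest_sub; first exact: sigma_algebra_measurable.
  by move=> B [t /= tN]; apply: rv_events_measurable; exact: mZ.
have fam_coord p' (Z : nat -> T -> 'cV[R]_p') t l' : (t <= N)%N ->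
    sigma_meas <<s ev_fam Z [set t | (t < N.+1)%N] >> (fun w => Z t w l' ord0).
  by move=> tN B mB; apply: sub_gen_smallest; exists t => //; exact: rv_events_coord.
apply: (residual_cond_orth gV0 (lspanP _ _) _ _ _ _ _ ci _ _ (LJ i kN) VZ SL' Sp Jy Zp).
- exact: ssm_obs_span.
- exact: smallest_sigma_algebra.
- exact: smallest_sigma_algebra.
- exact: fam_meas.
- exact: fam_meas.
- exact: fam_coord.
- exact: fam_coord.
Qed.

End residuals.

(** * The Gaussian space spanned by the model and the adjoined noise *)

Section coupled_space.
Context {R : realType} {d d' : measure_display} {T : measurableType d} {T' : measurableType d'}.
Variables (P : probability T R) (P' : probability T' R) (proj : T' -> T).
Hypothesis mproj : measurable_fun setT proj.
Hypothesis projE : forall A, measurable A -> P' (proj @^-1` A) = P A.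
Variables (V0 : set (T -> R)) (I : eqType) (s : seq I) (V : I -> T -> R) (v : I -> T' -> R).
Hypothesis gV0 : gspace P V0.
Hypothesis LV : forall i, L2 P (V i).
Hypothesis cn : forall X (c : I -> R), V0 X ->
  cnormal P' (fun w => X (proj w) + lcomb s c v w)
    ((ip P X X + ip P (lcomb s c V) (lcomb s c V)) / kappa).

Definition coupled : set (T' -> R) :=
  [set f | exists X c, V0 X /\ f = (fun w => X (proj w) + lcomb s c v w)].

Lemma coupled_gspace : gspace P' coupled.
Proof.
split; last by move=> _ [X [c [VX ->]]]; eexists; exact: cn.
split.
  exists (fun=> 0), (fun=> 0); split; first by apply: submod0; case: gV0.
  by apply/funext => w; rewrite /lcomb big1 ?addr0// => i _; rewrite mul0r.
move=> a _ _ [X [c [VX ->]]] [Y [e [VY ->]]].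
exists (fun w => a * X w + Y w), (fun i => a * c i + e i); split; first exact: gV0.1.2.
apply/funext => w; rewrite /lcomb mulrDr addrACA; congr (_ + _).
rewrite mulr_sumr -big_split/=; apply: eq_bigr => i _; ring.
Qed.

Lemma coupled_base X : V0 X -> coupled (fun w => X (proj w)).
Proof.
move=> VX; exists X, (fun=> 0); split => //.
by apply/funext => w; rewrite /lcomb big1 ?addr0// => i _; rewrite mul0r.
Qed.

Lemma coupled_noise c : coupled (lcomb s c v).
Proof.
exists (fun=> 0), c; split; first by apply: submod0; case: gV0.
by apply/funext => w; rewrite add0r.
Qed.

(** The variance in [cn] is a sum of a model part and a noise part, so [cnormal_orth] applies. *)
Lemma coupled_orth X c : V0 X -> ip P' (lcomb s c v) (fun w => X (proj w)) = 0.
Proof.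
move=> VX; have c1 := gspaceP coupled_gspace (coupled_base VX).
have V00 : V0 (fun=> 0) by apply: submod0; case: gV0.
have := cn (fun=> 0) VX; have := cn c V00; have := cn c VX.
rewrite (_ : lcomb s (fun=> 0) V = fun=> 0); last first.
  by apply/funext => w; rewrite /lcomb big1// => i _; rewrite mul0r.
rewrite (_ : (fun w => 0 + lcomb s c v w) = lcomb s c v); last first.
  by apply/funext => w; rewrite add0r.
rewrite (_ : (fun w => X (proj w) + lcomb s (fun=> 0) v w) = (fun w => X (proj w))); last first.
  by apply/funext => w; rewrite /lcomb big1 ?addr0// => i _; rewrite mul0r.
rewrite !ip0l add0r addr0 mulrDl => c12 c2 c1'.
by rewrite ipC; exact: cnormal_orth c1' c2 c12.
Qed.

Lemma coupled_moment X c : V0 X -> (forall i, i \in s -> ip P X (V i) = 0) ->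
  cnormal P' (fun w => X (proj w) + lcomb s c v w)
    (ip P (fun w => X w + lcomb s c V w) (fun w => X w + lcomb s c V w) / kappa).
Proof.
move=> VX XV; have LX := gspace_L2 gV0 VX; have Lc := L2_lcomb s c LV.
rewrite (ipDl LX Lc (L2D LX Lc)) (ipDr LX Lc LX) (ipDr LX Lc Lc) (ipC P _ X).
by rewrite (ip_lcombr c LV LX XV) addr0 add0r; exact: cn.
Qed.

Lemma preserving_ip X Y : L2 P X -> L2 P Y ->
  ip P' (fun w => X (proj w)) (fun w => Y (proj w)) = ip P X Y.
Proof.
move=> LX LY; exact: (preserving_Ex mproj projE (L2_itgM LX LY)).2.
Qed.

End coupled_space.

Theorem theorem4 (R : realType) (n m N : nat)
  (A : nat -> 'M[R]_n) (C : nat -> 'M[R]_(m, n)) (P0 : 'M[R]_n)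
  (Q : nat -> 'M[R]_n) (Rn : nat -> 'M[R]_m) (alpha : nat -> R)
  (d : measure_display) (Om : measurableType d) (P : probability Om R)
  (x q : nat -> Om -> 'cV[R]_n) (y r : nat -> Om -> 'cV[R]_m)
  (Jc : nat -> Om -> 'cV[R]_n) :
  P0^T = P0 -> (forall k, (Q k)^T = Q k) -> (forall k, (Rn k)^T = Rn k) ->
  (forall k, 0 <= alpha k) ->
  ssm P N A C P0 Q Rn x q y r ->
  (forall k, (k <= N)%N -> rvec_meas (Jc k)) ->
  (* Jc_0^N is conditionally independent of x_0^N given Y_0^N *)
  cond_indep P (<<s ev_fam Jc [set k | (k <= N)%N] >>)
               (<<s ev_fam x [set k | (k <= N)%N] >>)
               (<<s ev_fam y [set k | (k <= N)%N] >>) ->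
  (* (i) *)
  gauss_blockdiag P Jc N (diagcov P0 Q) ->
  (* (ii) *)
  (forall k l, (1 <= l)%N -> (k + l <= N)%N ->
     cond_indep P (rv_events (Jc k)) (rv_events (y (k + l)%N))
                  (<<s ev_fam y [set j | (j <= k)%N] >>)) ->
  exists (d' : measure_display) (Om' : measurableType d') (P' : probability Om' R)
         (x' q' : nat -> Om' -> 'cV[R]_n) (y' r' : nat -> Om' -> 'cV[R]_m)
         (J : nat -> Om' -> 'cV[R]_n),
    ssm P' N A C P0 Q Rn x' q' y' r' /\
        (forall k, (k <= N)%N -> rvec_meas (J k)) /\
        cond_indep P' (<<s ev_fam J [set k | (k <= N)%N] >>)
                      (<<s ev_fam x' [set k | (k <= N)%N] >>)
                      (<<s ev_fam y' [set k | (k <= N)%N] >>) /\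
        jointly_gaussian P' J y' N /\
        gauss_blockdiag P' J N (diagcov P0 Q) /\
        (forall k l, (1 <= l)%N -> (k + l <= N)%N ->
           cond_indep P' (rv_events (J k)) (rv_events (y' (k + l)%N))
                         (<<s ev_fam y' [set j | (j <= k)%N] >>)) /\
        cost P' N alpha x' (est A J) = cost P N alpha x (est A Jc) /\
        exists (pi : nat -> 'M[R]_(n, m)) (phi : nat -> nat -> 'M[R]_(n, m))
               (w : nat -> Om' -> 'cV[R]_n)
               (xs : nat -> Om' -> 'cV[R]_n) (e : nat -> nat -> Om' -> 'cV[R]_m),
          (* xs k is a version of E[x_k | y_0, ..., y_{k-1}] *)
              (forall k, (1 <= k <= N)%N ->
                 cexp P' (<<s ev_fam y' [set j | (j < k)%N] >>) (x' k) (xs k)) /\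
              (* e k j is a version of E[I_j | J_0, ..., J_{k-1}] *)
              (forall k j, (j < k <= N)%N ->
                 cexp P' (<<s ev_fam J [set i | (i < k)%N] >>)
                      (innov C y' xs j) (e k j)) /\
              (* (w_k) is a white Gaussian sequence *)
              (forall k, (k <= N)%N -> rvec_meas (w k) /\
                 exists W : 'M[R]_n, gauss_vec P' (w k) 0 W) /\
              mutual_indep P' [set k | (k <= N)%N] (fun k => rv_events (w k)) /\
              (* w_k independent of (Y_0^N, J_0^{k-1}) *)
              (forall k, (k <= N)%N ->
                 indep2 P' (rv_events (w k))
                   (<<s ev_fam y' [set j | (j <= N)%N]
                        `|` ev_fam J [set i | (i < k)%N] >>)) /\
              (* J_k = pi_k I_k + phi_k upsilon_k + w_k  (a.s.) *)
              (forall k, (k <= N)%N ->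
                 {ae P', forall o, J k o =
                    pi k *m innov C y' xs k o
                    + \sum_(j < k) phi k j *m (innov C y' xs j o - e k j o)
                    + w k o}).
Proof.
move=> _ _ _ _ H mJ ciJ gJ causal.
pose V0 := ssm_space x q r N.+1 N.+1.
have gV0 : gspace P V0 := ssm_gspace H.
have LJ k i : (k <= N)%N -> L2 P (fun w => Jc k w i ord0).
  by move=> kN; have [s2 /cnormal_L2] := blockdiag_coord i mJ gJ kN.
have Vx k i : (k <= N)%N -> V0 (fun w => x k w i ord0) := ssm_state_space H i (k := k).
have Vy k i : (k <= N)%N -> V0 (fun w => y k w i ord0) := ssm_obs_space H i (k := k).
have Lex (a : nat * 'I_n) : exists L : Om -> R, (a.1 <= N)%N ->
   [/\ lspan (idx a.1.+1 m) (coord y) L,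
      forall Y, lspan (idx N.+1 m) (coord y) Y -> ip P (fun w => coord Jc a w - L w) Y = 0 &
      forall Y, lspan (idx N.+1 n) (coord x) Y -> ip P (fun w => coord Jc a w - L w) Y = 0].
  case: (leqP a.1 N) => [kN|_]; last by exists (fun=> 0).
  by have [L HL] := causal_residual H mJ ciJ LJ causal a.2 kN; exists L.
have [L LE] := choice Lex.
(* Set to 0 beyond the horizon because [noise_extension] asks for square integrability at every
   index. *)
pose Vr (a : nat * 'I_n) : Om -> R :=
  if (a.1 <= N)%N then fun w => coord Jc a w - L a w else fun=> 0.
pose s := idx N.+1 n.
have sN a : a \in s -> (a.1 <= N)%N by rewrite mem_idx.
have VL a : (a.1 <= N)%N -> V0 (L a).
  by move=> aN; have [SL _ _] := LE a aN; apply: (ssm_obs_span H) SL.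
have LVr a : L2 P (Vr a).
  rewrite /Vr; case: ifPn => [aN|_]; last exact: L2_cst.
  have h := gspace_L2 gV0 (VL a aN).
  apply: L2B.
    exact: LJ a.1 a.2 aN.
  exact: h.
have [d' [Om' [P' [proj [v [mproj projE cn]]]]]] := noise_extension (idx_uniq N.+1 n) LVr gV0.
have gV := coupled_gspace gV0 cn.
pose J k (w : Om') : 'cV[R]_n := \col_i (L (k, i) (proj w) + v (k, i) w).
have JE k i : (fun w => J k w i ord0) = (fun w => L (k, i) (proj w) + v (k, i) w).
  by apply/funext => w; rewrite mxE.
have ssm' := preserving_ssm mproj projE H.
pose y' k w := y k (proj w); pose x' k w := x k (proj w); pose r' k w := r k (proj w).
have base p (Z : nat -> Om -> 'cV[R]_p) K X : lspan (idx K p) (coord (fun k w => Z k (proj w))) X ->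
    exists2 X0, lspan (idx K p) (coord Z) X0 & X = fun w => X0 (proj w).
  by move=> [c ->]; exists (lcomb (idx K p) c (coord Z)) => //; exists c.
have SxV : lspan (idx N.+1 n) (coord x) `<=` V0 := ssm_state_span H.
have SyV K : (K <= N.+1)%N -> lspan (idx K m) (coord y) `<=` V0 := ssm_obs_span H (K := K).
have vE a : a \in s -> v a = lcomb s (fun b => (b == a)%:R) v.
  by move=> sa; apply/funext => w; rewrite lcomb_delta// idx_uniq.
have Jdec k i : (k <= N)%N -> exists t u,
  [/\ lspan (idx k.+1 m) (coord y') t, coupled proj V0 s v u,
      (fun w => J k w i ord0) = (fun w => t w + u w),
      forall X, lspan (idx N.+1 m) (coord y') X -> ip P' u X = 0 &
      forall X, lspan (idx N.+1 n) (coord x') X -> ip P' u X = 0].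
  move=> kN; have [[c Lc] _ _] := LE (k, i) kN.
  have ks : (k, i) \in s by rewrite mem_idx.
  exists (fun w => L (k, i) (proj w)), (v (k, i)); split.
  - by exists c; rewrite Lc.
  - by rewrite vE//; exact: (coupled_noise proj s v gV0).
  - exact: JE.
  - move=> X /base[X0 SX0 ->]; rewrite vE//; apply: (coupled_orth gV0 cn).
    exact: SyV SX0.
  - move=> X /base[X0 SX0 ->]; rewrite vE//; apply: (coupled_orth gV0 cn).
    exact: SxV SX0.
have Vx' k i : (k <= N)%N -> coupled proj V0 s v (fun w => x' k w i ord0).
  by move=> kN; apply: (coupled_base proj s v (Vx k i kN)).
have Vy' k i : (k <= N)%N -> coupled proj V0 s v (fun w => y' k w i ord0).
  by move=> kN; apply: (coupled_base proj s v (Vy k i kN)).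
have Vr' k i : (k <= N)%N -> coupled proj V0 s v (fun w => r' k w i ord0).
  move=> kN; apply: (coupled_base proj s v (X := fun w => r k w i ord0)).
  by apply: sub_add_submodr; [exact: lspanP|exact: coord_span].
(* Under P the residuals Vr are orthogonal to the model and under P' so is v; hence
   replacing Vr by v leaves second moments unchanged. *)
have moment X c : V0 X -> (forall a, a \in s -> ip P X (Vr a) = 0) ->
    cnormal P' (fun w => X (proj w) + lcomb s c v w)
     (ip P (fun w => X w + lcomb s c Vr w) (fun w => X w + lcomb s c Vr w) / kappa).
  exact: coupled_moment.
have orthVr X a : a \in s ->
    add_submod (lspan (idx N.+1 n) (coord x)) (lspan (idx N.+1 m) (coord y)) X ->
    ip P X (Vr a) = 0.
  move=> sa [U [W [SU SW ->]]]; have aN := sN a sa; have [_ Ly Lx] := LE a aN.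
  have LU : L2 P U by apply: (gspace_L2 gV0); exact: SxV.
  have LW : L2 P W by apply: (gspace_L2 gV0); exact: (SyV N.+1).
  rewrite ipDl// ipC (ipC P W) /Vr aN.
  by rewrite Lx// Ly// addr0.
have SL a : a \in s -> lspan (idx N.+1 m) (coord y) (L a).
  by move=> sa; have aN := sN a sa; have [SLa _ _] := LE a aN; apply: lspanS SLa.
have JcE c w : lcomb s c L w + lcomb s c Vr w = lcomb s c (coord Jc) w.
  rewrite /lcomb -big_split/=; apply: eq_big_seq => a sa.
  by rewrite /Vr sN//; ring.
have JlE c w : lcomb s c (coord J) w = lcomb s c L (proj w) + lcomb s c v w.
  rewrite /lcomb -big_split/=; apply: eq_bigr => -[k i] _.
  by rewrite /coord /J mxE mulrDr.
have SlL c : lspan (idx N.+1 m) (coord y) (lcomb s c L).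
  by apply: submod_sum => [|a sa]; [exact: lspanP|apply: submodZ; [exact: lspanP|exact: SL]].
have gJ' : gauss_blockdiag P' J N (diagcov P0 Q).
  move=> u; pose c (a : nat * 'I_n) := u a.1 a.2 ord0.
  (* The prescribed variance is rewritten as a second moment of the given process, which reduces (i)
     to equality of second moments. *)
  have := cnormal_var (blockdiag_cnormal u mJ gJ) => ->.
  rewrite (_ : (fun w => _) = (fun w => lcomb s c L (proj w) + lcomb s c v w)); last first.
    by apply/funext => w; rewrite lcomb_dotv JlE.
  rewrite (_ : (fun w => \sum_(j < N.+1) dotv (u j) (Jc j w)) =
    (fun w => lcomb s c L w + lcomb s c Vr w)); last first.
    by apply/funext => w; rewrite lcomb_dotv JcE.
  have VlL : V0 (lcomb s c L) by exact: (SyV N.+1).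
  have olL a : a \in s -> ip P (lcomb s c L) (Vr a) = 0.
    by move=> sa; apply: orthVr => //; apply: sub_add_submodr; first exact: lspanP.
  by case: (moment _ c VlL olL).
have mJ' k : (k <= N)%N -> rvec_meas (J k).
  by move=> kN i; have [] := gspace_L2 gV (VJ gV Vy' Jdec i kN).
have Jorth j k i l : (j <= N)%N -> (k <= N)%N -> j != k ->
    ip P' (fun w => J j w i ord0) (fun w => J k w l ord0) = 0.
  exact: blockdiag_orth mJ' gJ'.
have yE k w : (k <= N)%N -> y' k w = C k *m x' k w + r' k w.
  by move=> kN; have [_ _ _ _ yCx] := H; exact: yCx.
have yr k j i l : (k <= N)%N -> (j < k)%N ->
    ip P' (fun w => r' k w l ord0) (fun w => y' j w i ord0) = 0.
  move=> kN jk; have jN : (j <= N)%N by exact: leq_trans (ltnW jk) kN.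
  have Vrk : V0 (fun w => r k w l ord0).
    by apply: sub_add_submodr; [exact: lspanP|exact: coord_span].
  have -> := preserving_ip mproj projE (gspace_L2 gV0 Vrk) (gspace_L2 gV0 (Vy j i jN)).
  apply: (ssm_obs_noise_orth H l kN).
  by apply: (ssm_spaceS _ _ (ssm_obs H i jN)).
have rep := innovation_representation gV Vx' Vy' Vr' Jdec Jorth yE yr.
exists d', Om', P', x', (fun k w => q k (proj w)), y', r', J.
split; first exact: ssm'.
split; first exact: mJ'.
split; first exact: (cond_indep_state gV Vx' Vy' Jdec).
split.
  move=> u u'; pose c (a : nat * 'I_n) := u a.1 a.2 ord0.
  pose c' (a : nat * 'I_m) := u' a.1 a.2 ord0.
  have SJ : coupled proj V0 s v (lcomb s c (coord J)).
    by apply: (SJ_sub gV Vy' Jdec (leqnn _)); exists c.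
  have Sy : coupled proj V0 s v (lcomb (idx N.+1 m) c' (coord y')).
    by apply: (Sy_sub gV Vy' (leqnn _)); exists c'.
  have [s2 [_ h]] := gV.2 _ (submodD gV.1 SJ Sy).
  exists 0, s2; move: h; congr normal_law; apply/funext => w.
  by rewrite !lcomb_dotv.
split; first exact: gJ'.
split; first by move=> k l _ klN; exact: (cond_indep_causal gV Vy' Jdec klN).
split; last exact: rep.
rewrite /cost; apply: eq_bigr => k _; congr (_ * _)%E.
have kN : (k <= N)%N by rewrite -ltnS.
pose c i : nat * 'I_n -> R := est_coef A k i.
(* The estimation error is a variable of the model minus a combination of residuals; [moment] then
   equates its second moment with that of the same expression in [v]. *)
have fE i : (fun w => (x k w - est A Jc k w) i ord0) =
    (fun w => (x k w i ord0 - lcomb s (c i) L w) + lcomb s (fun a => - c i a) Vr w).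
  apply/funext => w; rewrite !mxE (est_lcomb A Jc i w kN) -/s -JcE opprD addrA.
  by congr (_ + _); rewrite /lcomb -sumrN; apply: eq_bigr => a _; rewrite mulNr.
have fE' i : (fun w => (x' k w - est A J k w) i ord0) =
    (fun w => (x k (proj w) i ord0 - lcomb s (c i) L (proj w)) + lcomb s (fun a => - c i a) v w).
  apply/funext => w; rewrite !mxE (est_lcomb A J i w kN) -/s JlE opprD addrA.
  by congr (_ + _); rewrite /lcomb -sumrN; apply: eq_bigr => a _; rewrite mulNr.
have VX i : V0 (fun w => x k w i ord0 - lcomb s (c i) L w).
  by apply: submodB; [case: gV0|exact: Vx|exact: (SyV N.+1)].
have OX i a : a \in s -> ip P (fun w => x k w i ord0 - lcomb s (c i) L w) (Vr a) = 0.
  move=> sa; apply: orthVr => //; apply: submodB.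
  - by apply: add_submodP; exact: lspanP.
  - by apply: sub_add_submodl; [exact: lspanP|exact: coord_span].
  - by apply: sub_add_submodr; [exact: lspanP|exact: SlL].
have mom i := moment _ (fun a => - c i a) (VX i) (OX i).
rewrite !integral_sqnorm.
- congr EFin; apply: eq_bigr => i _; rewrite fE fE' (cnormal_ip (mom i)).
  by rewrite mulrC divfK// gt_eqF// kappa_gt0.
- move=> i; rewrite fE; apply: L2D; first exact: (gspace_L2 gV0 (VX i)).
  exact: L2_lcomb.
- by move=> i; rewrite fE'; exact: (cnormal_L2 (mom i)).
Qed.
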